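(* Consider the filtering model $$X_k=f(X_{k-1})+\zeta_k,\qquad Y_k=h(X_k)+\varepsilon_k,$$ described in the context, and assume: (E1) $f$ is $a$-Lipschitz, $h$ is uniformly continuous and surjective, and there are constants $b_0,b$ such that, for all $y_1,y_2\in\mathsf Y$ and all $x_1,x_2\in\mathsf X$ in the preimages under $h$ of $y_1$ and $y_2$ respectively, $|x_1-x_2|\le b_0+b|y_1-y_2|$; (E2) the density $\upsilon$ of $\varepsilon_k$ is bounded, $\lim_{|u|\to\infty}\upsilon(u)=0$, and $\inf_{y\in K}\upsilon(y)>0$ for every compact set $K\subset\mathsf Y$; (G) $\{\zeta_k\}_{k\ge0}$ is a sequence of random variables such that, for every integer $k$, $\zeta_k$ is independent of $\varepsilon_k$ and $\mathbb P(\zeta_k\in A\mid X_{k-1}=x)=\int q(x,u)\mathbf 1_A(u)\,du$ for all $A\in\mathcal X$; moreover there are a positive probability density $\psi$ and positive constants $\mu^-,\mu^+$ with $\mu^-\psi(u)\le q(x,u)\le\mu^+\psi(u)$ for all $x,u\in\mathsf X$. Let $\mathsf C$ be the local Doeblin set function defined by $\mathsf C(y,\Delta)=\{x\in\mathsf X:|h(x)-y|\le\Delta\}$. Let $\{Y_k^*\}_{k\ge0}$ be the sequence following $$X_k^*=f^*(X_{k-1}^* )+\zeta_k^*,\qquad Y_k^*=h^*(X_k^* )+\varepsilon_k^*,$$ as described in the context, and suppose that $\|f-f^*\|_\infty<\infty$, $\|h-h^*\|_\infty<\infty$ and, for all $\Delta>0$, $$\mathbb E\big(|V_+^{*\Delta}|\log_+|V_+^{*\Delta}|\big)<\infty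 .$$ Then, for any initial probability distributions $\nu,\nu'$ on $(\mathsf X,\mathcal X)$ and any $\Delta>0$ satisfying $$\nu Q\mathbf 1_{\mathsf C(Y_1^*,\Delta)}>0\ \ \mathbb P_\star\text{-a.s.},\qquad\nu'Q\mathbf 1_{\mathsf C(Y_1^*,\Delta)}>0\ \ \mathbb P_\star\text{-a.s.},$$ one has $$\limsup_{n\to\infty}n^{-1}\log\big\|\phi_{\nu,n}[Y^*_{0:n}]-\phi_{\nu',n}[Y^*_{0:n}]\big\|_{\mathrm{TV}}<0\qquad\mathbb P_\star\text{-a.s.}$$
   Context: Filtering model. $\mathsf X=\mathbb R^N$, $\mathsf Y=\mathbb R^p$ with $p\le N$, endowed with their Borel $\sigma$-fields $\mathcal X,\mathcal Y$; $f:\mathsf X\to\mathsf X$ and $h:\mathsf X\to\mathsf Y$ are measurable; $\{\varepsilon_k\}_{k\ge0}$ is a sequence of i.i.d. random variables with positive density $\upsilon$ with respect to Lebesgue measure on $\mathsf Y$. The transition kernel of $\{X_k\}$ is $Q(x,A)=\int_Aq(x,x'-f(x))\,dx'$ and the likelihood is $g(x,y)=\upsilon(y-h(x))$. The filter started from $\nu$ is $$\phi_{\nu,n}[y_{0:n}](A)=\frac{\int\nu(dx_0)g(x_0,y_0)\prod_{i=1}^nQ(x_{i-1},dx_i)g(x_i,y_i)\mathbf 1_A(x_n)}{\int\nu(dx_0)g(x_0,y_0)\prod_{i=1}^nQ(x_{i-1},dx_i)g(x_i,y_i)} .$$ $\nu Q\mathbf 1_A=\int\nu(dx)Q(x,A)$;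 $\|\cdot\|_{\mathrm{TV}}$ is the total variation norm and $\|\cdot\|_\infty$ the supremum norm; $\log_+t=\max(\log t,0)$. A set-valued function $y\mapsto\mathsf C(y)$ from $\mathsf Y$ to $\mathcal X$ is a local Doeblin set function if there is a map $(y,y')\mapsto(\varepsilon^-(y,y'),\varepsilon^+(y,y'))$ from $\mathsf Y\times\mathsf Y$ to $(0,\infty)^2$ such that, for all $(y,y')$, there is a measure $\lambda_{y,y'}$ on $(\mathsf X,\mathcal X)$ with $\varepsilon^-(y,y')\lambda_{y,y'}[A\cap\mathsf C(y')]\le Q[x,A\cap\mathsf C(y')]\le\varepsilon^+(y,y')\lambda_{y,y'}[A\cap\mathsf C(y')]$ for all $x\in\mathsf C(y)$ and $A\in\mathcal X$. Observation process (law $\mathbb P_\star$), not necessarily produced by the filtering model. $\{\varepsilon_k^*\}_{k\ge0}$ is a sequence of i.i.d. random variables; $f^*$ is $a^*$-Lipschitz; $h^*$ is surjective and, for some positive constants $b_0^*,b^*$, $|x_1-x_2|\le b_0^*+b^*|h^*(x_1)-h^*(x_2)|$ for all $x_1,x_2\in\mathsf X$. For all integers $k\ge1$, $\zeta_k^*$ is independent of $\varepsilon_k^*$ and, for all $A\in\mathcal X$, $\mathbb P(\zeta_k^*\in A\mid X_{k-1}^*=x)=\int q^*(x,u)\mathbf 1_A(u)\,du$. There are a probability density $\psi^*$ and positive constants $\mu^*_-,\mu^*_+$ with $\mu_-^*\psi^*(u)\le q^*(x,u)\le\mu_+^*\psi^*(u)$ for all $x,u\in\mathsf X$. Set $c=(a+1)b_0$,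 $d=(a+1)b$, $q^-(r)=\mu^-\inf_{|v|\le r}\psi(v)$, $\kappa=\|f-f^*\|_\infty+(b_0+b\|h^*-h\|_\infty)(1+a^* )$ and, for $\Delta>0$, $$V_+^{*\Delta}=\log q^-\big[c+d\Delta+\kappa+2a^*b^*+a^*b^*|\varepsilon_0^*|+b^*|\varepsilon_1^*|+|\zeta_+^*|\big],$$ where $\zeta_+^*$ is a random variable independent of $\{\varepsilon_k^*\}_{k\ge0}$ with density $\psi^*$. *)

(* Defs.v *)
From HB Require Import structures.
From mathcomp Require Import all_boot all_order all_algebra.
From mathcomp Require Import all_classical all_reals all_analysis.
From mathcomp Require Import measurable_realfun.
Set Implicit Arguments.
Unset Strict Implicit.
Unset Printing Implicit Defensive.
Import Order.TTheory GRing.Theory Num.Theory.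
Import numFieldNormedType.Exports.
Local Open Scope classical_set_scope.
Local Open Scope ring_scope.

(* The Borel sigma-algebra of R^n, n-dimensional vectors being row matrices
   with their library (product) topology. *)
HB.instance Definition _ (R : realType) (m n : nat) :=
  @isMeasurable.Build (sigma_display (@open 'M[R]_(m, n))) 'M[R]_(m, n)
    <<s @open 'M[R]_(m, n) >> (@sigma_algebra0 _ setT _)
    (@sigma_algebraC _ _) (@sigma_algebra_bigcup _ setT _).

Section borel.
Variables (R : realType).

Lemma open_measurable_rV n (U : set 'rV[R]_n) : open U -> measurable U.
Proof. exact: sub_sigma_algebra. Qed.

Lemma open_rV_bigcup n (U : set 'rV[R]_n) : open U ->
  U = \bigcup_(ce in [set ce : 'rV[rat]_n * rat |
         0 < ce.2 /\ ball (map_mx ratr ce.1 : 'rV[R]_n) (ratr ce.2) `<=` U])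
       ball (map_mx ratr ce.1 : 'rV[R]_n) (ratr ce.2).
Proof.
move=> oU; apply/seteqP; split => [x Ux|x [ce /= [_ sub]]]; last exact: sub.
have /nbhs_ballP[e /= e0 xeU] : nbhs x U by exact: open_nbhs_nbhs.
have e20 : 0 < e / 2 by rewrite divr_gt0.
have [q /andP[q0 qe]] : exists q : rat, 0 < (ratr q : R) < e / 2.
  by have [q] := rat_in_itvoo e20; rewrite in_itv /=; exists q.
have aux i : exists r : rat, x 0 i - ratr q < ratr r < x 0 i + ratr q.
  have : x 0 i - ratr q < x 0 i + ratr q.
    by rewrite ltrBlDr -addrA ltrDl addr_gt0.
  by move=> /rat_in_itvoo[r]; rewrite in_itv /=; exists r.
have {aux}[c cP] : exists c : 'rV[rat]_n,
    forall i, x 0 i - ratr q < ratr (c 0 i) < x 0 i + ratr q.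
  exists (\row_i sval (cid (aux i))) => i; rewrite mxE.
  by case: cid => r.
have cx : ball (map_mx ratr c : 'rV[R]_n) (ratr q) x.
  split=> // i j; rewrite !mxE (ord1 i) /ball /= ltr_distlC.
  have /andP[c1 c2] := cP j.
  by apply/andP; split; [rewrite ltrBlDr|rewrite -ltrBlDr].
exists (c, q) => //=; split; first by rewrite -(@ltr0q R).
move=> y cy; apply: xeU; rewrite (splitr e).
exact: ball_triangle (le_ball (ltW qe) (ball_sym cx)) (le_ball (ltW qe) cy).
Qed.

Definition consrV n (z : R * 'rV[R]_n) : 'rV[R]_n.+1 := row_mx z.1%:M z.2.
Definition unconsrV n (v : 'rV[R]_n.+1) : R * 'rV[R]_n :=
  (v 0 0, @rsubmx R 1 1 n v).

Lemma consrVK n : cancel (@consrV n) (@unconsrV n).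
Proof.
case=> t v; rewrite /unconsrV /consrV /= row_mxKr; congr (_, _).
have -> : (0 : 'I_n.+1) = @lshift 1 n ord0 by exact/val_inj.
by rewrite (@row_mxEl R 1 1 n) mxE eqxx mulr1n.
Qed.

Lemma unconsrVK n : cancel (@unconsrV n) (@consrV n).
Proof.
move=> v; rewrite /unconsrV /consrV /=.
rewrite (_ : (v 0 0)%:M = @lsubmx R 1 1 n v) ?hsubmxK//.
apply/matrixP => i j; rewrite !mxE !ord1 eqxx mulr1n.
by congr (v _ _); exact/val_inj.
Qed.

Lemma measurable_consrV n : measurable_fun [set: R * 'rV[R]_n] (@consrV n).
Proof.
apply: (@measurability _ _ _ _ _ _ (@open 'rV[R]_n.+1)) => //.
move=> _ [U oU <-]; rewrite setTI (open_rV_bigcup oU) preimage_bigcup.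
rewrite bigcup_mkcond; apply: countable_bigcupT_measurable.
  exact: countableP.
move=> -[c e]; case: ifPn => // /set_mem[/= e0 _].
pose B := ball (map_mx ratr c : 'rV[R]_n.+1) (ratr e).
rewrite (_ : _ @^-1` _ = (ball ((ratr (c 0 0)) : R) (ratr e)) `*`
   (ball ((unconsrV (map_mx ratr c)).2 : 'rV[R]_n) (ratr e))).
  apply: measurableX; first by apply: open_measurable; exact: ball_open.
  by apply: open_measurable_rV; exact: ball_open.
apply/seteqP; split=> -[t v] /=.
  move=> [q0 H]; split.
    have := H 0 (@lshift 1 n ord0); rewrite /consrV (@row_mxEl R 1 1 n) !mxE eqxx mulr1n.
    by rewrite (_ : @lshift 1 n ord0 = 0)//; exact/val_inj.
  split=> // i j; have := H 0 (@rshift 1 n j).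
  by rewrite /consrV (@row_mxEr R 1 1 n) !mxE/= (ord1 i).
move=> [H1 [_ H2]]; split=> [|i j]; first by rewrite ltr0q.
case: (@splitP 1 n j) => k jk.
  have -> : j = @lshift 1 n k by exact/val_inj.
  rewrite (ord1 i) (ord1 k) /consrV (@row_mxEl R 1 1 n) !mxE eqxx mulr1n.
  by rewrite (_ : @lshift 1 n ord0 = 0)//; exact/val_inj.
have -> : j = @rshift 1 n k by exact/val_inj.
by have := H2 0 k; rewrite /consrV (@row_mxEr R 1 1 n) (ord1 i) !mxE.
Qed.

Lemma open_rsubmx n (U : set 'rV[R]_n) :
  open U -> open [set v : 'rV[R]_n.+1 | U (@rsubmx R 1 1 n v)].
Proof.
move=> oU; rewrite openE => x /= Ux.
have /nbhs_ballP[e /= e0 xeU] : nbhs (@rsubmx R 1 1 n x) U by exact: open_nbhs_nbhs.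
apply/nbhs_ballP; exists e => //= y [_ H]; apply: xeU; split=> // i j.
by rewrite /= !mxE; exact: H.
Qed.

Lemma measurable_unconsrV n : measurable_fun [set: 'rV[R]_n.+1] (@unconsrV n).
Proof.
apply/measurable_fun_pairP; split.
  apply: (measurability (@RGenOpens.G R)) => [|_ [_ [a [b ->] <-]]]; first exact: RGenOpens.measurableE.
  rewrite setTI; apply: open_measurable_rV.
  apply: open_comp; last exact: interval_open.
  by move=> x _; exact: coord_continuous.
apply: (@measurability _ _ _ _ _ _ (@open 'rV[R]_n)) => //.
move=> _ [U oU <-]; rewrite setTI.
exact: open_measurable_rV (open_rsubmx oU).
Qed.

Section cons_measure.
Variables (n : nat) (m : {sigma_finite_measure set 'rV[R]_n -> \bar R}).

Definition lebesgue_cons : set 'rV[R]_n.+1 -> \bar R :=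
  pushforward (lebesgue_measure \x m)%E (@consrV n).

Let lebesgue_cons0 : lebesgue_cons set0 = 0%E.
Proof. by rewrite /lebesgue_cons /pushforward preimage_set0 measure0. Qed.

Let lebesgue_cons_ge0 A : (0 <= lebesgue_cons A)%E.
Proof. by rewrite /lebesgue_cons /pushforward; exact: measure_ge0. Qed.

Let lebesgue_cons_sigma_additive : semi_sigma_additive lebesgue_cons.
Proof.
move=> F mF tF mUF; rewrite /lebesgue_cons /pushforward preimage_bigcup.
apply: measure_semi_sigma_additive.
- by move=> k; rewrite -[X in measurable X]setTI; exact: measurable_consrV.
- apply/trivIsetP => /= i j _ _ ij; rewrite -preimage_setI.
  by move/trivIsetP : tF => /(_ _ _ _ _ ij) ->//; rewrite preimage_set0.
- by rewrite -preimage_bigcup -[X in measurable X]setTI; exact: measurable_consrV.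
Qed.

HB.instance Definition _ := isMeasure.Build _ _ _ lebesgue_cons
  lebesgue_cons0 lebesgue_cons_ge0 lebesgue_cons_sigma_additive.

Let lebesgue_cons_sigma_finite : sigma_finite setT lebesgue_cons.
Proof.
have /sigma_finiteP[F [TF ndF Foo]] := sigma_finiteT (@lebesgue_measure R).
have /sigma_finiteP[G [TG ndG Goo]] := sigma_finiteT m.
exists (fun k => @unconsrV n @^-1` (F k `*` G k)).
  apply/seteqP; split => // v _.
  have [i _ Fi] : (\bigcup_i F i) (unconsrV v).1 by rewrite -TF.
  have [j _ Gj] : (\bigcup_i G i) (unconsrV v).2 by rewrite -TG.
  exists (maxn i j) => //; split.
    by move: Fi; exact/subsetPset/ndF/leq_maxl.
  by move: Gj; exact/subsetPset/ndG/leq_maxr.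
move=> k; have [mF Fk] := Foo k; have [mG Gk] := Goo k; split.
  rewrite -[X in measurable X]setTI; apply: measurable_unconsrV => //.
  exact: measurableX.
rewrite /lebesgue_cons /pushforward (_ : _ @^-1` _ = F k `*` G k).
  by rewrite product_measure1E// lte_mul_pinfty// ge0_fin_numE.
by apply/seteqP; split=> z; rewrite /preimage /mkset consrVK.
Qed.

HB.instance Definition _ := Measure_isSigmaFinite.Build _ _ _ lebesgue_cons
  lebesgue_cons_sigma_finite.

End cons_measure.

(* Lebesgue measure on R^n, as an iterated product of the Lebesgue measure on
   R; lebesgue_rV_box computes it on boxes. *)
Fixpoint lebesgue_rV n : {sigma_finite_measure set 'rV[R]_n -> \bar R} :=
  match n with
  | 0 => dirac (0 : 'rV[R]_0)
  | n.+1 => lebesgue_cons (lebesgue_rV n)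
  end.

Lemma consrV_box n (a b : 'rV[R]_n.+1) :
  @consrV n @^-1` [set x | forall i, a 0 i <= x 0 i <= b 0 i] =
  `[a 0 0, b 0 0]%classic `*` [set v : 'rV[R]_n | forall i,
    (unconsrV a).2 0 i <= v 0 i <= (unconsrV b).2 0 i].
Proof.
have e0 : (0 : 'I_n.+1) = @lshift 1 n ord0 by exact/val_inj.
apply/seteqP; split=> -[t v] /=.
  move=> H; split=> [|i].
    have := H (@lshift 1 n ord0).
    by rewrite in_itv/= /consrV (@row_mxEl R 1 1 n) mxE eqxx mulr1n -e0.
  by have := H (@rshift 1 n i); rewrite /consrV (@row_mxEr R 1 1 n) !mxE.
move=> [H1 H2] i; case: (@splitP 1 n i) => k ik.
  have -> : i = @lshift 1 n k by exact/val_inj.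
  rewrite (ord1 k) /consrV (@row_mxEl R 1 1 n) mxE eqxx mulr1n -e0.
  by move: H1; rewrite in_itv.
have -> : i = @rshift 1 n k by exact/val_inj.
by have := H2 k; rewrite /consrV (@row_mxEr R 1 1 n) !mxE.
Qed.

Lemma measurable_box n (a b : 'rV[R]_n) :
  measurable [set x : 'rV[R]_n | forall i, a 0 i <= x 0 i <= b 0 i].
Proof.
elim: n a b => [|n ih] a b.
  by rewrite (_ : mkset _ = setT)//; apply/seteqP; split=> // x _ [].
set B := mkset _.
have -> : B = @unconsrV n @^-1` (@consrV n @^-1` B).
  by apply/seteqP; split=> v; rewrite /preimage /mkset unconsrVK.
rewrite consrV_box -[X in measurable X]setTI.
by apply: measurable_unconsrV => //; apply: measurableX; [exact: measurable_itv|exact: ih].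
Qed.

Lemma lebesgue_rV_box n (a b : 'rV[R]_n) : (forall i, a 0 i <= b 0 i) ->
  lebesgue_rV n [set x | forall i, a 0 i <= x 0 i <= b 0 i] =
  (\prod_i (b 0 i - a 0 i))%:E.
Proof.
elim: n a b => [|n ih] a b ab.
  by rewrite big_ord0 /= diracE mem_set// => -[].
rewrite /= /lebesgue_cons /pushforward consrV_box product_measure1E//; last first.
  exact: measurable_box.
have l01 : lebesgue_measure `[a 0 0, b 0 0]%classic = (b 0 0 - a 0 0)%:E.
  rewrite lebesgue_measure_itv/= lte_fin; case: ltP => // ba.
  by rewrite (@le_anti _ _ (a 0 0) (b 0 0)) ?subrr// ab.
rewrite big_ord_recl EFinM; congr (_ * _)%E; first exact: l01.
rewrite ih => [|i]; last by rewrite !mxE; exact: ab.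
congr EFin; apply: eq_bigr => i _; rewrite !mxE.
by rewrite (_ : rshift 1 i = lift ord0 i)//; exact/val_inj.
Qed.

End borel.

Section euclidean.
Variable R : realType.

(* The library norm on 'rV[R]_n is the maximum norm; |.| is Euclidean here. *)
Definition enorm n (x : 'rV[R]_n) : R := Num.sqrt (\sum_i x 0 i ^+ 2).

Definition elipschitz m n (a : R) (F : 'rV[R]_m -> 'rV[R]_n) :=
  forall x1 x2, enorm (F x1 - F x2) <= a * enorm (x1 - x2).

Definition sup_norm T n (F : T -> 'rV[R]_n) : \bar R :=
  ereal_sup (range (fun x => (enorm (F x))%:E)).

Definition is_density n (p : 'rV[R]_n -> R) :=
  [/\ measurable_fun [set: 'rV[R]_n] p, forall u, 0 <= p u &
      (\int[lebesgue_rV R n]_u (p u)%:E = 1)%E].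

Definition is_density_kernel n (q : 'rV[R]_n -> 'rV[R]_n -> R) :=
  measurable_fun [set: 'rV[R]_n * 'rV[R]_n] (fun z => q z.1 z.2) /\
  forall x, is_density (q x).

End euclidean.

Section total_variation.
Local Open Scope ereal_scope.
Context d (T : measurableType d) (R : realType).

(* Total mass of the variation |xi|, as a supremum over the finite families of
   disjoint measurable sets. *)
Definition tv_norm (xi : set T -> \bar R) : \bar R :=
  ereal_sup [set s | exists (n : nat) (A : 'I_n -> set T),
    [/\ forall i, measurable (A i), trivIset [set: 'I_n] A &
        s = \sum_(i < n) `|xi (A i)|] ].

End total_variation.

Section filter.
Local Open Scope ereal_scope.
Variables (R : realType) (N p : nat).
Implicit Types (f : 'rV[R]_N -> 'rV[R]_N) (h : 'rV[R]_N -> 'rV[R]_p).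

Definition transition f (q : 'rV[R]_N -> 'rV[R]_N -> R) (x : 'rV[R]_N)
    (A : set 'rV[R]_N) : \bar R :=
  \int[lebesgue_rV R N]_(x' in A) (q x (x' - f x)%R)%:E.

Definition likelihood h (upsilon : 'rV[R]_p -> R)
    (x : 'rV[R]_N) (y : 'rV[R]_p) : R :=
  upsilon (y - h x)%R.

Variables (Q : 'rV[R]_N -> set 'rV[R]_N -> \bar R)
  (g : 'rV[R]_N -> 'rV[R]_p -> R).

(* path_weight n y A x0 is the iterated integral of
     g(x_0, y_0) prod_(1 <= i <= n) Q(x_(i-1), dx_i) g(x_i, y_i) 1_A(x_n)
   over x_1, ..., x_n, with x_0 = x0. *)
Fixpoint path_weight (n : nat) (y : nat -> 'rV[R]_p) (A : set 'rV[R]_N)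
    (x : 'rV[R]_N) : \bar R :=
  match n with
  | 0%N => (g x (y 0%N) * \1_A x)%:E
  | n'.+1 => (g x (y 0%N))%:E *
             \int[Q x]_x' path_weight n' (fun k => y k.+1) A x'
  end.

Definition filter_dist (nu : probability 'rV[R]_N R) (n : nat)
    (y : nat -> 'rV[R]_p) (A : set 'rV[R]_N) : \bar R :=
  (\int[nu]_x path_weight n y A x) / (\int[nu]_x path_weight n y setT x).

Definition doeblin_set h (y : 'rV[R]_p) (Delta : R) : set 'rV[R]_N :=
  [set x | (enorm (h x - y) <= Delta)%R].

End filter.

Section observation.
Local Open Scope ereal_scope.
Context d (Omega : measurableType d) (R : realType) (P : probability Omega R).

Definition indep_rv d1 d2 (T1 : measurableType d1) (T2 : measurableType d2)
    (Z1 : {RV P >-> T1}) (Z2 : {RV P >-> T2}) :=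
  forall A B, measurable A -> measurable B ->
    P (Z1 @^-1` A `&` Z2 @^-1` B) = P (Z1 @^-1` A) * P (Z2 @^-1` B).

Definition iid d1 (T1 : measurableType d1) (Z : nat -> {RV P >-> T1}) :=
  (forall n (B : nat -> set T1), (forall i, measurable (B i)) ->
    P (\bigcap_(i < n) Z i @^-1` B i) = \prod_(i < n) P (Z i @^-1` B i)) /\
  (forall k B, measurable B -> P (Z k @^-1` B) = P (Z 0%N @^-1` B)).

(* W is independent of the whole sequence Z, cylinder sets being a pi-system
   generating sigma(Z_k, k >= 0). *)
Definition indep_rv_seq d1 d2 (T1 : measurableType d1) (T2 : measurableType d2)
    (W : {RV P >-> T1}) (Z : nat -> {RV P >-> T2}) :=
  forall A n (B : nat -> set T2), measurable A ->
    (forall i, measurable (B i)) ->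
    P (W @^-1` A `&` \bigcap_(i < n) Z i @^-1` B i) =
    P (W @^-1` A) * P (\bigcap_(i < n) Z i @^-1` B i).

(* sigma(X_0, ..., X_(k-1), eps_0, ..., eps_k) *)
Definition past d1 d2 (T1 : measurableType d1) (T2 : measurableType d2)
    (X : nat -> {RV P >-> T1}) (eps : nat -> {RV P >-> T2}) (k : nat)
    : set (set Omega) :=
  <<s g_sigma_preimage (fun i : 'I_k => X i : Omega -> T1) `|`
      g_sigma_preimage (fun i : 'I_k.+1 => eps i : Omega -> T2) >>.

(* Given the sigma-algebra G, the random vector Z has the (random) density r
   with respect to Lebesgue measure. *)
Definition cond_density n (G : set (set Omega)) (Z : {RV P >-> 'rV[R]_n})
    (r : Omega -> 'rV[R]_n -> R) :=
  forall F A, G F -> measurable A ->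
    P (F `&` Z @^-1` A) =
    \int[P]_(w in F) \int[lebesgue_rV R n]_(u in A) (r w u)%:E.

Definition has_density n (Z : {RV P >-> 'rV[R]_n}) (r : 'rV[R]_n -> R) :=
  forall A, measurable A ->
    P (Z @^-1` A) = \int[lebesgue_rV R n]_(u in A) (r u)%:E.

End observation.

Section entropy_condition.
Local Open Scope ereal_scope.
Variable R : realType.

(* q^-(r); extended-real infimum, so that log q^-(r) = -oo when it vanishes. *)
Definition qminus N (mu : R) (psi : 'rV[R]_N -> R) (r : R) : \bar R :=
  mu%:E * ereal_inf [set (psi v)%:E | v in [set v | (enorm v <= r)%R] ].

Definition logp (t : \bar R) : \bar R := maxe (lne t) 0.

Local Close Scope ereal_scope.

Definition kappa N p (b0 b astar : R) (f fs : 'rV[R]_N -> 'rV[R]_N)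
    (h hs : 'rV[R]_N -> 'rV[R]_p) : R :=
  fine (sup_norm (fun x => f x - fs x)) +
  (b0 + b * fine (sup_norm (fun x => hs x - h x))) * (1 + astar).

End entropy_condition.

(* Main.v *)
Require Import Defs.
From HB Require Import structures.
From mathcomp Require Import all_boot all_order all_algebra.
From mathcomp Require Import all_classical all_reals all_analysis.
From mathcomp Require Import measurable_realfun ring lra zify.
Set Implicit Arguments.
Unset Strict Implicit.
Unset Printing Implicit Defensive.
Import Order.TTheory GRing.Theory Num.Theory.
Import numFieldNormedType.Exports.
Local Open Scope classical_set_scope.
Local Open Scope ring_scope.

(** The proof has a deterministic half, which holds for a fixed sequence of
    observations, and a probabilistic half, which shows that almost every
    observation sequence satisfies its hypothesis.

    Deterministic half. Let w^A(x) be the weight of the paths that start at x and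
    end in A. Up to the normalising masses, the difference of the two filters on A
    is the integral over nu (x) nu' of the antisymmetric function w^A(x) w^1(x') -
    w^1(x) w^A(x'), and this function is propagated by the product of two copies of
    the kernel. When both coordinates move from one local Doeblin set to the next,
    and the densities of the two moves lie between eps and K, the constant eps^2 can
    be subtracted from the product density: it is symmetric, so it contributes
    nothing to the integral of an antisymmetric function, and the step gains the
    factor 1 - (eps / K)^2. The density psi may be unbounded, so K does not bound it
    everywhere; a pair that leaves the Doeblin sets, or one of whose increments has
    a density above K, is penalised by a large factor theta instead. The penalised
    step still has mass at most M + 1, because the likelihood vanishes at infinity
    and psi is integrable. Hence the gap after n steps is at most rho^(g - m) plus
    theta^-m (M + 1)^(2n), where g is the number of good steps and m is free
    (pair_contraction). The masses of the filters decay at most exponentially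
    (mass_lower), and theta, which is chosen after their rate, beats it. The only
    input is a lower bound expR (- W_k) for the density between consecutive Doeblin
    sets, with bounded averages of W_k for every radius (filter_forgetting).

    Probabilistic half. The Lipschitz properties and the approximate injectivity of
    h and hs bound the increment from one Doeblin set to the next by c + d r +
    |eps_k| + |eps_(k+1)| + |zeta_(k+1)|, up to constants (doeblin_distance), so W_k
    is the negative part of log q^- at this radius. Given the past, zeta_(k+1) has a
    law at most mups times the law of zetap, but the sequence W_k is neither
    independent nor stationary. The first 2^(m+1) variables are cut at 2^m / (m +
    1): an exponential supermartingale (exp_deviation) bounds the sum of the
    truncated variables up to probability exp (- (m + 1)), and the L log L moment
    makes the probabilities of a larger value summable. Borel and Cantelli then give
    bounded averages (bounded_averages). The norms of the noises are first replaced
    by their integer parts, so that conditioning on the past is conditioning on the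
    atoms of a countable partition; the moment condition is assumed for every Delta,
    and a larger Delta absorbs the rounding errors. *)

(** * Borel functions on row vectors and translation invariance *)

Section borel_rows.
Variable R : realType.

Lemma measurable_coord n (i : 'I_n) :
  measurable_fun [set: 'rV[R]_n] (fun x => x 0 i).
Proof.
apply: (measurability (@RGenOpens.G R)) => [|_ [_ [a [b ->] <-]]].
  exact: RGenOpens.measurableE.
rewrite setTI; apply: open_measurable_rV.
apply: open_comp; last exact: interval_open.
by move=> x _; exact: coord_continuous.
Qed.

(** Induction on n through consrV, a measurable isomorphism of R * R^n with R^n.+1. *)
Lemma measurable_rV d (T : measurableType d) n (F : T -> 'rV[R]_n) :
  (forall i, measurable_fun setT (fun t => F t 0 i)) -> measurable_fun setT F.
Proof.
elim: n F => [|n ih] F mF.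
  rewrite (_ : F = fun=> 0); first exact: measurable_cst.
  by apply/funext => t; apply/rowP => -[].
rewrite (_ : F = @consrV R n \o (fun t => (F t 0 0, @rsubmx R 1 1 n (F t)))).
  apply: measurableT_comp; first exact: measurable_consrV.
  apply: measurable_fun_pair; first exact: mF.
  apply: ih => i; rewrite (_ : (fun _ => _) = fun t => F t 0 (@rshift 1 n i)).
    exact: mF.
  by apply/funext => t; rewrite !mxE.
by apply/funext => t /=; rewrite -[LHS]unconsrVK.
Qed.

Lemma measurable_rVB d (T : measurableType d) n (F G : T -> 'rV[R]_n) :
  measurable_fun setT F -> measurable_fun setT G ->
  measurable_fun setT (fun t => F t - G t).
Proof.
move=> mF mG; apply: measurable_rV => i.
rewrite (_ : (fun _ => _) = (fun t => F t 0 i - G t 0 i)); last first.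
  by apply/funext => t; rewrite !mxE.
apply: measurable_funB; first exact: (measurableT_comp (measurable_coord i) mF).
exact: (measurableT_comp (measurable_coord i) mG).
Qed.

Lemma measurable_enorm n : measurable_fun setT (@enorm R n).
Proof.
have mS : measurable_fun setT (fun x : 'rV[R]_n => \sum_i x 0 i ^+ 2).
  by apply: measurable_sum => i; apply: measurable_funX; exact: measurable_coord.
exact: (measurableT_comp (continuous_measurable_fun (@sqrt_continuous R)) mS).
Qed.

Lemma continuous_measurable_rV m n (F : 'rV[R]_m -> 'rV[R]_n) :
  continuous F -> measurable_fun setT F.
Proof.
move=> cF; apply: (@measurability _ _ _ _ _ _ (@open 'rV[R]_n)) => //.
move=> _ [U oU <-]; rewrite setTI; apply: open_measurable_rV.
by apply: open_comp => // x _; exact: cF.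
Qed.

End borel_rows.

Section translation.
Variable R : realType.
Local Open Scope ereal_scope.

Lemma lebesgue_measure_shift (c : R) (A : set R) : measurable A ->
  pushforward (@lebesgue_measure R) (fun x : measurableTypeR R => (x - c)%R : measurableTypeR R) A
   = lebesgue_measure A.
Proof.
move=> mA.
have ms : measurable_fun setT (fun x : measurableTypeR R => (x - c)%R : measurableTypeR R).
  by apply: measurable_funB => //; exact: measurable_cst.
pose fc : {mfun measurableTypeR R >-> measurableTypeR R} :=
  HB.pack (fun x : measurableTypeR R => (x - c)%R : measurableTypeR R) (isMeasurableFun.Build _ _ _ _ _ ms).
apply/esym; apply: (@lebesgue_measure_unique R (pushforward lebesgue_measure fc)) => //= _ [[a b]] _ <-.
rewrite /pushforward.
rewrite (_ : _ @^-1` _ = `](a + c)%R, (b + c)%R]%classic); last first.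
  apply/seteqP; split=> x; rewrite /= !in_itv/=; lra.
rewrite !lebesgue_measure_itv/= !lte_fin ltrD2r.
by case: ifPn => // _; rewrite -!EFinB; congr EFin; ring.
Qed.

Lemma ge0_integral_shift1 (c : R) (F : R -> \bar R) : measurable_fun setT F ->
  (forall x, 0 <= F x) ->
  \int[@lebesgue_measure R]_x F (x - c)%R = \int[@lebesgue_measure R]_x F x.
Proof.
move=> mF F0.
have ms : measurable_fun setT (fun x : measurableTypeR R => (x - c)%R : measurableTypeR R).
  by apply: measurable_funB => //; exact: measurable_cst.
pose fc : {mfun measurableTypeR R >-> measurableTypeR R} :=
  HB.pack (fun x : measurableTypeR R => (x - c)%R : measurableTypeR R) (isMeasurableFun.Build _ _ _ _ _ ms).
transitivity (\int[pushforward (@lebesgue_measure R) fc]_x F x).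
  rewrite ge0_integral_pushforward//.
by apply: eq_measure_integral => A mA _; exact: lebesgue_measure_shift.
Qed.

(** Tonelli for the iterated-product definition of Lebesgue measure. *)
Lemma ge0_integral_consrV n (F : 'rV[R]_n.+1 -> \bar R) :
  measurable_fun setT F -> (forall x, 0 <= F x) ->
  \int[lebesgue_rV R n.+1]_x F x =
  \int[lebesgue_measure]_t \int[lebesgue_rV R n]_v F (consrV (t, v)).
Proof.
move=> mF F0 /=.
have mc : measurable_fun [set: (measurableTypeR R * 'rV[R]_n)%type] (@consrV R n) := @measurable_consrV R n.
have F0' : {in setT, forall y, 0 <= F y} by move=> y _; exact: F0.
have := ge0_integral_pushforward mc (lebesgue_measure \x lebesgue_rV R n) measurableT mF F0'.
rewrite preimage_setT => E.
rewrite -(@fubini_tonelli1 _ _ (measurableTypeR R) _ R lebesgue_measure (lebesgue_rV R n) (fun z => F (consrV z)))//; last exact: (measurableT_comp mF mc).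
Qed.

Lemma ge0_integral_shift n (c : 'rV[R]_n) (F : 'rV[R]_n -> \bar R) :
  measurable_fun setT F -> (forall x, 0 <= F x) ->
  \int[lebesgue_rV R n]_x F (x - c)%R = \int[lebesgue_rV R n]_x F x.
Proof.
elim: n c F => [|n ih] c F mF F0.
  by apply: eq_integral => x _; congr F; apply/rowP => -[].
have mB : measurable_fun setT (fun x : 'rV[R]_n.+1 => x - c)%R.
  by apply: measurable_rVB => //; exact: measurable_cst.
have mFB : measurable_fun setT (fun x : 'rV[R]_n.+1 => F (x - c)%R).
  exact: (measurableT_comp mF mB).
rewrite (ge0_integral_consrV mF F0) (ge0_integral_consrV mFB (fun=> F0 _)).
pose G t := \int[lebesgue_rV R n]_v F (consrV (t, v)).
transitivity (\int[lebesgue_measure]_t G (t - c 0 0)%R).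
  apply: eq_integral => t _; rewrite /G.
  have e1 (v : 'rV[R]_n) : consrV (t, v) 0%R 0%R = t.
    exact: (congr1 fst (consrVK (t, v))).
  have e2 (v : 'rV[R]_n) : @rsubmx R 1 1 n (consrV (t, v)) = v.
    exact: (congr1 snd (consrVK (t, v))).
  rewrite -[RHS](ih (@rsubmx R 1 1 n c)).
  - apply: eq_integral => v _; congr F.
    rewrite -[LHS]unconsrVK /unconsrV; congr (consrV (_, _)).
      by rewrite mxE [X in (X + _)%R]e1 mxE.
    by rewrite linearB/= e2.
  - apply: (measurableT_comp mF).
    apply: measurableT_comp; first exact: measurable_consrV.
    by apply: measurable_fun_pair => //; exact: measurable_cst.
  - by move=> v; exact: F0.
apply: ge0_integral_shift1; last by move=> t; exact: integral_ge0.
apply: (@measurable_fun_fubini_tonelli_F _ _ _ _ _ (lebesgue_rV R n) (fun z => F (consrV z))) => //.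
exact: (measurableT_comp mF (@measurable_consrV R n)).
Qed.

End translation.

(** * Measures with a density, integrals of sums of products *)

Section density.
Context d (T : measurableType d) (R : realType).
Variables (mu : {measure set T -> \bar R}) (p : T -> R).
Hypotheses (mp : measurable_fun setT p) (p0 : forall x, 0 <= p x).
Local Open Scope ereal_scope.

Definition density_measure (A : set T) : \bar R := \int[mu]_(x in A) (p x)%:E.

Let density0 : density_measure set0 = 0.
Proof. by rewrite /density_measure integral_set0. Qed.

Let density_ge0 A : 0 <= density_measure A.
Proof. by apply: integral_ge0 => x _; rewrite lee_fin. Qed.

Let density_sigma_additive : semi_sigma_additive density_measure.
Proof.
move=> /= F mF tF mUF; rewrite /density_measure; apply: cvg_toP.
  apply: ereal_nondecreasing_is_cvgn => m n mn.
  apply: lee_sum_nneg_natr => // k _ _.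
  by apply: integral_ge0 => x _; rewrite lee_fin.
rewrite ge0_integral_bigcup//=.
  by apply: measurable_funTS; exact/measurable_EFinP.
by move=> x _; rewrite lee_fin.
Qed.

HB.instance Definition _ := isMeasure.Build _ _ _ density_measure
  density0 density_ge0 density_sigma_additive.

Import HBNNSimple.

Let integral_density_nnsfun (f : {nnsfun T >-> R}) :
  \int[density_measure]_x (f x)%:E = \int[mu]_x ((p x)%:E * (f x)%:E).
Proof.
under [LHS]eq_integral do rewrite fimfunE -fsumEFin//.
rewrite [LHS]ge0_integral_fsum//; last 2 first.
  - by move=> r; exact/measurable_EFinP/measurableT_comp.
  - by move=> n x _; rewrite EFinM nnfun_muleindic_ge0.
under [RHS]eq_integral.
  move=> x xD; rewrite fimfunE -fsumEFin// ge0_mule_fsumr; last first.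
    by move=> r; rewrite EFinM nnfun_muleindic_ge0.
  over.
rewrite [RHS]ge0_integral_fsum//; last 2 first.
  - move=> r; under eq_fun do rewrite -EFinM.
    apply/measurable_EFinP/measurable_funM => //.
    by apply/measurableT_comp.
  - move=> n x _; apply: mule_ge0; first by rewrite lee_fin.
    by rewrite EFinM nnfun_muleindic_ge0.
apply: eq_fsbigr => r _.
rewrite integralZl_indic_nnsfun// integral_indic// setIT.
rewrite /= /density_measure integral_mkcond.
have [r0|r0] := ltP r 0%R.
  rewrite preimage_nnfun0//.
  rewrite (eq_integral (cst 0)) ?integral0 ?mule0; last first.
    by move=> x _; rewrite patchE in_set0.
  by apply/esym/integral0_eq => x _; rewrite indic0/= mulr0 mule0.
rewrite -ge0_integralZl//; last 2 first.
  - apply/(@measurable_restrictT _ _ _ _ (f @^-1` [set r]) (EFin \o p)) => //.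
    have mpE : measurable_fun setT (EFin \o p) by exact/measurable_EFinP.
    exact: (measurable_funTS mpE).
  - by move=> x _; rewrite patchE; case: ifPn => //; rewrite lee_fin.
apply: eq_integral => x _; rewrite patchE indicE.
by case: (x \in _); rewrite -!EFinM ?mulr1 ?mulr0 ?mule0 // mulrC.
Qed.

(** Simple functions first, then monotone convergence. This turns the integrals
    against the transition kernel into Lebesgue integrals. *)
Lemma ge0_integral_density (F : T -> \bar R) : measurable_fun setT F ->
  (forall x, 0 <= F x) ->
  \int[density_measure]_x F x = \int[mu]_x ((p x)%:E * F x).
Proof.
move=> mF F0; pose F_ := nnsfun_approx measurableT mF.
transitivity (limn (fun n => \int[density_measure]_x (F_ n x)%:E)).
  rewrite -monotone_convergence//.
  - by apply: eq_integral => x _; apply/esym/cvg_lim => //; apply: cvg_nnsfun_approx.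
  - by move=> n; exact/measurable_EFinP/measurable_funTS.
  - by move=> *; rewrite lee_fin.
  - by move=> x _ m n mn; rewrite lee_fin; exact/lefP/nd_nnsfun_approx.
under eq_fun do rewrite integral_density_nnsfun.
rewrite -monotone_convergence//.
- apply: eq_integral => x _; apply/cvg_lim => //.
  by apply: cvgeZl => //; apply: cvg_nnsfun_approx.
- move=> n; apply: emeasurable_funM; first exact/measurable_EFinP.
  exact/measurable_EFinP/measurable_funTS.
- by move=> n x _; rewrite mule_ge0 ?lee_fin.
- move=> x _ m n mn; rewrite lee_wpmul2l ?lee_fin//.
  exact/lefP/nd_nnsfun_approx.
Qed.

End density.

Section integral_sum.
Context d (T : measurableType d) (R : realType).
Variables (mu : {measure set T -> \bar R}).

Lemma Rintegral_sum_seq I (s : seq I) (c : I -> R) (F : I -> T -> R) :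
  (forall i, List.In i s -> mu.-integrable setT (EFin \o F i)) ->
  mu.-integrable setT (EFin \o (fun x => \sum_(i <- s) c i * F i x)) /\
  \int[mu]_x (\sum_(i <- s) c i * F i x) = \sum_(i <- s) c i * \int[mu]_x F i x.
Proof.
elim: s => [|i s ih] intF.
  split.
    rewrite (_ : _ \o _ = cst 0%E); first exact: integrable0.
    by apply/funext => x /=; rewrite big_nil.
  rewrite big_nil /Rintegral integral0_eq// => x _; by rewrite big_nil.
have [ih1 ih2] := ih (fun j js => intF j (or_intror js)).
have intc : mu.-integrable setT (EFin \o (fun x => c i * F i x)).
  rewrite (_ : _ \o _ = (fun x => (c i)%:E * (EFin \o F i) x)%E)//.
  by apply: integrableZl => //; apply: intF; left.
have e x : \sum_(j <- i :: s) c j * F j x = c i * F i x + \sum_(j <- s) c j * F j x.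
  by rewrite big_cons.
split.
  rewrite (_ : _ \o _ = (EFin \o (fun x => c i * F i x)%R) \+
     (EFin \o (fun x => \sum_(j <- s) c j * F j x)%R))%E.
    exact: integrableD.
  by apply/funext => x /=; rewrite big_cons.
under eq_Rintegral do rewrite e.
rewrite RintegralD// big_cons ih2 RintegralZl//.
by apply: intF; left.
Qed.

End integral_sum.

Section rank_one.
Context d d' (T : measurableType d) (T' : measurableType d') (R : realType).
Variables (mu : {measure set T -> \bar R}) (mu' : {measure set T' -> \bar R}).

(** A pointwise inequality between sums of products F(u) G(v) integrates to the same
    inequality between the products of the integrals: integrate in v for fixed u,
    then in u. Every inequality on pairs of paths is integrated in this form. *)
Lemma rank_one_ge0 (s : seq ((T -> R) * (T' -> R))) :
  (forall c, List.In c s -> mu.-integrable setT (EFin \o c.1)) ->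
  (forall c, List.In c s -> mu'.-integrable setT (EFin \o c.2)) ->
  (forall u v, 0 <= \sum_(c <- s) c.1 u * c.2 v) ->
  0 <= \sum_(c <- s) (\int[mu]_u c.1 u) * (\int[mu']_v c.2 v).
Proof.
move=> i1 i2 s0.
have h u : 0 <= \sum_(c <- s) c.1 u * (\int[mu']_v c.2 v).
  have [_ <-] := @Rintegral_sum_seq _ _ _ mu' _ s (fun c => c.1 u) (fun c => c.2) i2.
  by apply: Rintegral_ge0 => v _.
have [_ e] := @Rintegral_sum_seq _ _ _ mu _ s (fun c => \int[mu']_v c.2 v) (fun c => c.1) i1.
under eq_bigr do rewrite mulrC.
rewrite -e; apply: Rintegral_ge0 => u _.
by under eq_bigr do rewrite mulrC.
Qed.

End rank_one.

(** * Transition operator and path weights *)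

Section transition_operator.
Variables (R : realType) (N : nat) (f : 'rV[R]_N -> 'rV[R]_N).
Variable q : 'rV[R]_N -> 'rV[R]_N -> R.
Hypotheses (mf : measurable_fun setT f) (q_kernel : is_density_kernel q).
Local Notation leb := (lebesgue_rV R N).

(** The functions on which the transition operator acts; the bound B is kept because
    it controls the masses. *)
Definition bounded_nonneg (w : 'rV[R]_N -> R) (B : R) :=
  [/\ measurable_fun setT w, forall u, 0 <= w u & forall u, w u <= B].

Definition trans_dens (x u : 'rV[R]_N) : R := q x (u - f x).

Definition trans_op (w : 'rV[R]_N -> R) (x : 'rV[R]_N) : R :=
  \int[leb]_u (trans_dens x u * w u).

Lemma trans_dens_ge0 x u : 0 <= trans_dens x u.
Proof. by have [_ /(_ x)[_ + _]] := q_kernel; exact. Qed.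

Lemma measurable_trans_dens :
  measurable_fun setT (fun z : 'rV[R]_N * 'rV[R]_N => trans_dens z.1 z.2).
Proof.
have [mq _] := q_kernel.
have m1 : measurable_fun setT (fun z : 'rV[R]_N * 'rV[R]_N => (z.1, z.2 - f z.1)).
  apply: measurable_fun_pair => //; apply: measurable_rVB => //.
  by apply: measurableT_comp => //.
exact: (measurableT_comp mq m1).
Qed.

Lemma measurable_trans_dens2 x : measurable_fun setT (trans_dens x).
Proof.
have m1 : measurable_fun setT (fun u : 'rV[R]_N => (x, u)).
  by apply: measurable_fun_pair => //; exact: measurable_cst.
exact: (measurableT_comp measurable_trans_dens m1).
Qed.

Lemma integral_trans_dens x : (\int[leb]_u (trans_dens x u)%:E = 1)%E.
Proof.
have [_ /(_ x)[mq q0 <-]] := q_kernel.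
apply: (@ge0_integral_shift R N (f x) (EFin \o q x)) => //.
exact/measurable_EFinP.
Qed.

Lemma integrable_trans_dens x : leb.-integrable setT (EFin \o trans_dens x).
Proof.
apply/integrableP; split; first by apply/measurable_EFinP; exact: measurable_trans_dens2.
under eq_integral do rewrite gee0_abs ?lee_fin ?trans_dens_ge0//.
by rewrite integral_trans_dens ltry.
Qed.

Lemma integrable_trans_mul w B x : bounded_nonneg w B ->
  leb.-integrable setT (EFin \o (fun u => trans_dens x u * w u)).
Proof.
move=> [mw w0 wB].
have iB : leb.-integrable setT (fun u => (B%:E * (trans_dens x u)%:E)%E).
  by apply: integrableZl => //; exact: integrable_trans_dens.
apply: le_integrable iB => //.
  apply/measurable_EFinP; apply: measurable_funM => //.
  exact: measurable_trans_dens2.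
move=> u _; rewrite -EFinM !abse_EFin lee_fin.
have B0 : 0 <= B := le_trans (w0 u) (wB u).
rewrite !ger0_norm ?mulr_ge0 ?trans_dens_ge0//.
by rewrite mulrC ler_wpM2r ?trans_dens_ge0.
Qed.

Lemma trans_opE w B x : bounded_nonneg w B ->
  (\int[leb]_u (trans_dens x u * w u)%:E = (trans_op w x)%:E)%E.
Proof.
move=> wB; rewrite /trans_op /Rintegral fineK//.
by apply: integrable_fin_num => //; exact: integrable_trans_mul wB.
Qed.

Lemma trans_op_bounded w B : bounded_nonneg w B -> bounded_nonneg (trans_op w) B.
Proof.
move=> wB; have [mw w0 leB] := wB; split.
- have mG : measurable_fun setT (fun z : 'rV[R]_N * 'rV[R]_N => (trans_dens z.1 z.2 * w z.2)%:E).
    apply/measurable_EFinP; apply: measurable_funM; first exact: measurable_trans_dens.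
    by apply: measurableT_comp.
  have G0 (z : 'rV[R]_N * 'rV[R]_N) : (0 <= (trans_dens z.1 z.2 * w z.2)%:E)%E.
    by rewrite lee_fin mulr_ge0// trans_dens_ge0.
  have := measurable_fun_fubini_tonelli_F (m2 := leb) _ mG G0.
  rewrite /fubini_F /= => mF.
  apply: (measurableT_comp _ mF).
  exact: fine_measurable.
- by move=> x; apply: Rintegral_ge0 => u _; rewrite mulr_ge0// trans_dens_ge0.
- move=> x; rewrite -lee_fin -(trans_opE _ wB).
  apply: (@le_trans _ _ (\int[leb]_u (B%:E * (trans_dens x u)%:E))%E).
    apply: ge0_le_integral => //.
    + by move=> u _; rewrite lee_fin mulr_ge0// trans_dens_ge0.
    + apply/measurable_EFinP; apply: measurable_funM => //.
      exact: measurable_trans_dens2.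
    + by apply: measurable_funeM; apply/measurable_EFinP; exact: measurable_trans_dens2.
    + move=> u _; rewrite -EFinM lee_fin mulrC ler_wpM2r ?trans_dens_ge0//.
  rewrite ge0_integralZl ?integral_trans_dens ?mule1//.
  + by apply/measurable_EFinP; exact: measurable_trans_dens2.
  + by move=> u _; rewrite lee_fin trans_dens_ge0.
  + by rewrite lee_fin (le_trans (w0 x)).
Qed.

Lemma integral_transition w B x : bounded_nonneg w B ->
  (\int[transition f q x]_u (w u)%:E = (trans_op w x)%:E)%E.
Proof.
move=> wB; have [mw w0 leB] := wB.
rewrite -(trans_opE _ wB).
rewrite (ge0_integral_density leb (measurable_trans_dens2 x) (trans_dens_ge0 x) (F := EFin \o w)).
- by apply: eq_integral => u _; rewrite EFinM.
- exact/measurable_EFinP.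
- by move=> u; rewrite lee_fin.
Qed.

End transition_operator.

Section path_weights.
Variables (R : realType) (N p : nat) (f : 'rV[R]_N -> 'rV[R]_N).
Variables (q : 'rV[R]_N -> 'rV[R]_N -> R) (h : 'rV[R]_N -> 'rV[R]_p).
Hypotheses (mf : measurable_fun setT f) (q_kernel : is_density_kernel q).
Hypothesis mh : measurable_fun setT h.
Variables (upsilon : 'rV[R]_p -> R) (M : R).
Hypotheses (mu : measurable_fun setT upsilon) (upsilon_gt0 : forall u, 0 < upsilon u)
  (upsilon_le : forall u, upsilon u <= M).
Variable y : nat -> 'rV[R]_p.
Local Notation leb := (lebesgue_rV R N).
Local Notation trans_op := (trans_op f q).
Local Notation trans_dens := (trans_dens f q).
Local Notation lik k x := (likelihood h upsilon x (y k)).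

(** Real-valued path_weight, with the time k of the first observation as an index,
    so that the recursion does not shift the observation sequence. *)
Fixpoint weight (n k : nat) (A : set 'rV[R]_N) (x : 'rV[R]_N) : R :=
  match n with
  | 0%N => lik k x * \1_A x
  | n'.+1 => lik k x * trans_op (weight n' k.+1 A) x
  end.

Let M_gt0 : 0 < M. Proof. exact: lt_le_trans (upsilon_gt0 0) (upsilon_le 0). Qed.

Lemma lik_gt0 k x : 0 < lik k x. Proof. exact: upsilon_gt0. Qed.

Lemma measurable_lik k : measurable_fun setT (fun x => lik k x).
Proof.
have m1 : measurable_fun setT (fun x => y k - h x).
  by apply: measurable_rVB => //; exact: measurable_cst.
exact: (measurableT_comp mu m1).
Qed.

Lemma bounded_lik k w B : bounded_nonneg w B ->
  bounded_nonneg (fun x => lik k x * w x) (M * B).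
Proof.
move=> [mw w0 wB]; split.
- by apply: measurable_funM => //; exact: measurable_lik.
- by move=> u; rewrite mulr_ge0// ltW// lik_gt0.
- move=> u; apply: ler_pM => //; first by rewrite ltW// lik_gt0.
  exact: upsilon_le.
Qed.

Lemma weight_bounded n k A : measurable A ->
  bounded_nonneg (weight n k A) (M ^+ n.+1).
Proof.
move=> mA; elim: n k => [|n ih] k.
  rewrite -[M ^+ 1]mulr1; apply: (@bounded_lik _ \1_A).
  split; first exact: measurable_indic.
    by move=> u; rewrite indicE; case: (_ \in _).
  by move=> u; rewrite indicE; case: (_ \in _).
rewrite exprS; apply: (@bounded_lik _ (trans_op (weight n k.+1 A))).
exact: trans_op_bounded.
Qed.

Lemma weight_ge0 n k A x : measurable A -> 0 <= weight n k A x.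
Proof. by move=> /(weight_bounded n k)[_ + _]; exact. Qed.

Lemma weight_le n k A x : measurable A -> weight n k A x <= lik k x * M ^+ n.
Proof.
move=> mA; case: n => [|n] /=; rewrite ler_pM2l ?lik_gt0//.
  by rewrite indicE; case: (_ \in _).
by have [_ _] := trans_op_bounded mf q_kernel (weight_bounded n k.+1 mA); exact.
Qed.

Lemma path_weightE n k A x : measurable A ->
  path_weight (transition f q) (likelihood h upsilon) n (fun i => y (k + i)%N) A x
  = (weight n k A x)%:E.
Proof.
move=> mA; elim: n k x => [|n ih] k x /=; first by rewrite addn0.
rewrite addn0 EFinM; congr (_ * _)%E.
rewrite -(integral_transition mf q_kernel x (weight_bounded n k.+1 mA)).
congr (integral _ _ _); apply/funext => u; rewrite -ih.
by congr (path_weight _ _ _ _ _ _); apply/funext => i; rewrite addSnnS.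
Qed.

Lemma trans_op_le w w' B B' x : bounded_nonneg w B -> bounded_nonneg w' B' ->
  (forall u, w u <= w' u) -> trans_op w x <= trans_op w' x.
Proof.
move=> wB wB' ww'; apply: le_Rintegral => //.
- exact: integrable_trans_mul wB.
- exact: integrable_trans_mul wB'.
- by move=> u _; rewrite ler_wpM2l// trans_dens_ge0.
Qed.

End path_weights.

(** * Contraction of pairs of paths *)

Lemma scaled_le (R : realFieldType) (P s l X Y Z : R) :
  0 <= P -> 0 <= P - s -> P - s <= l * P -> 0 <= X -> Z <= X -> l * X <= Y ->
  (P - s) * Z <= P * Y.
Proof.
move=> P0 Ps0 Psl X0 ZX lXY.
apply: (@le_trans _ _ ((P - s) * X)); first exact: ler_wpM2l.
apply: (@le_trans _ _ (l * P * X)); first exact: ler_wpM2r.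
by rewrite mulrAC mulrC ler_wpM2l.
Qed.

(** p1 and p2 are the integrals of w^A and w^1 against the subtracted constant
    density. The product p1 * p2 appears with both signs, because that density is
    the same for the two coordinates, and cancels. *)
Lemma cancel_symmetric (R : realFieldType) (a a' b b' p1 p2 r t s s' A g1 g2 : R) :
  0 <= g1 * g2 -> 0 <= t -> s * s' <= A ->
  0 <= b * a' + (p1 * p2 + (r * b * b' + (t * s * s' +
       (-1 * a * b' + (-1 * p2 * p1 + 0))))) ->
  g1 * a * (g2 * b') <= g1 * b * (g2 * a') + r * (g1 * b * (g2 * b')) +
    t * (g1 * g2 * A).
Proof.
move=> g0 t0 sA main; have tA := ler_wpM2l t0 sA.
have H : a * b' <= b * a' + r * (b * b') + t * A by lra.
by have := ler_wpM2l g0 H; lra.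
Qed.

Section pair_contraction.
Variables (R : realType) (N p : nat) (f : 'rV[R]_N -> 'rV[R]_N).
Variables (q : 'rV[R]_N -> 'rV[R]_N -> R) (h : 'rV[R]_N -> 'rV[R]_p).
Hypotheses (mf : measurable_fun setT f) (q_kernel : is_density_kernel q).
Hypothesis mh : measurable_fun setT h.
Variables (upsilon : 'rV[R]_p -> R) (M : R).
Hypotheses (mu : measurable_fun setT upsilon) (upsilon_gt0 : forall u, 0 < upsilon u)
  (upsilon_le : forall u, upsilon u <= M).
Variable y : nat -> 'rV[R]_p.
Variables (C : nat -> set 'rV[R]_N) (D : set 'rV[R]_N) (S : nat -> bool).
Variables (theta eps K A1 : R).
Hypotheses (mC : forall k, measurable (C k)) (mD : measurable D).
Hypotheses (theta1 : 1 <= theta) (eps0 : 0 < eps) (epsK : eps <= K).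
Hypothesis q_le : forall x v, ~ D v -> q x v <= K.
Hypothesis q_ge : forall k x u, S k.+1 -> C k x -> C k.+1 u -> eps <= q x (u - f x).
Local Notation leb := (lebesgue_rV R N).
Local Notation trans_op := (trans_op f q).
Local Notation trans_dens := (trans_dens f q).
Local Notation lik k x := (likelihood h upsilon x (y k)).
Local Notation weight := (weight f q h upsilon y).

(** Cost paid outside A: theta there, 1 inside. *)
Definition penalty (A : set 'rV[R]_N) (x : 'rV[R]_N) : R := 1 + (theta - 1) * \1_(~` A) x.

Lemma penalty_in A x : A x -> penalty A x = 1.
Proof. by move=> Ax; rewrite /penalty indicE memNset ?mulr0 ?addr0//= => nA; exact: nA. Qed.

Lemma penalty_out A x : ~ A x -> penalty A x = theta.
Proof. by move=> Ax; rewrite /penalty indicE mem_set// mulr1 addrC subrK. Qed.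

Lemma penalty_ge1 A x : 1 <= penalty A x.
Proof. by have [Ax|Ax] := pselect (A x); rewrite ?(penalty_in Ax) ?(penalty_out Ax). Qed.

Lemma penalty_le A x : penalty A x <= theta.
Proof. by have [Ax|Ax] := pselect (A x); rewrite ?(penalty_in Ax) ?(penalty_out Ax). Qed.

Lemma penalty_bounded A : measurable A -> bounded_nonneg (penalty A) theta.
Proof.
move=> mA; split => [|u|u]; last exact: penalty_le.
  apply: measurable_funD => //; apply: measurable_funM => //.
  by apply: measurable_indic; exact: measurableC.
by rewrite (le_trans ler01)// penalty_ge1.
Qed.

Definition out_weight k x := lik k x * penalty (C k) x.

(** D contains all increments with a density above K. From x, a move is safe if it
    ends in the Doeblin set with an increment outside D. *)
Definition safe_set k x : set 'rV[R]_N := C k `&` [set u | ~ D (u - f x)].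

(** At most theta ^+ 2 times the likelihood, and equal to the likelihood on safe
    moves: one factor theta pays for the present bad step, the other one for the bad
    step which starts outside the Doeblin set. *)
Definition step_weight k x u := penalty (safe_set k x) u * out_weight k u.

Lemma measurable_safe_set k x : measurable (safe_set k x).
Proof.
apply: measurableI => //.
rewrite (_ : mkset _ = ~` ((fun u => u - f x) @^-1` D)); last by [].
apply: measurableC; rewrite -[X in measurable X]setTI.
have m : measurable_fun setT (fun u : 'rV[R]_N => u - f x).
  by apply: measurable_rVB => //; exact: measurable_cst.
exact: m.
Qed.

Lemma out_weight_ge0 k x : 0 <= out_weight k x.
Proof.
apply: mulr_ge0; first by rewrite ltW// upsilon_gt0.
exact: le_trans ler01 (penalty_ge1 _ _).
Qed.

Lemma out_weight_bounded k : bounded_nonneg (out_weight k) (M * theta).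
Proof. by apply: bounded_lik => //; exact: penalty_bounded. Qed.

Lemma bounded_nonnegM (w w' : 'rV[R]_N -> R) B B' :
  bounded_nonneg w B -> bounded_nonneg w' B' ->
  bounded_nonneg (fun u => w u * w' u) (B * B').
Proof.
move=> [mw w0 wB] [mw' w0' wB']; split.
- exact: measurable_funM.
- by move=> u; rewrite mulr_ge0.
- by move=> u; exact: ler_pM.
Qed.

Lemma step_weight_bounded k x : bounded_nonneg (step_weight k x) (theta * (M * theta)).
Proof.
apply: bounded_nonnegM; last exact: out_weight_bounded.
by apply: penalty_bounded; exact: measurable_safe_set.
Qed.

Hypothesis A1_ge : M <= A1.
Hypothesis step_le : forall k x, trans_op (step_weight k.+1 x) x <= A1.

Fixpoint good_count n k : nat :=
  match n with 0%N => 0%N | n'.+1 => (S k.+1 + good_count n' k.+1)%N end.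

Definition rho : R := 1 - (eps / K) ^+ 2.

(** From a pointwise inequality at the next time to the inequality at the present
    time. Terms of the next-step inequality are products of a function of u and one
    of u', so rank_one_ge0 applies; s is the constant subtracted from the two
    densities, with s = eps on good steps from inside the Doeblin set and s = 0
    otherwise. *)
Lemma integrate_step n k A x x' s r t : measurable A ->
  0 <= s -> 0 <= t ->
  (forall u, s * \1_(C k.+1) u <= trans_dens x u) ->
  (forall u, s * \1_(C k.+1) u <= trans_dens x' u) ->
  (forall u u', (trans_dens x u * trans_dens x' u' -
        (s * \1_(C k.+1) u) * (s * \1_(C k.+1) u')) *
      (weight n k.+1 A u * weight n k.+1 setT u' -
       weight n k.+1 setT u * weight n k.+1 A u') <=
     trans_dens x u * trans_dens x' u' *
     (r * (weight n k.+1 setT u * weight n k.+1 setT u') +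
      t * (step_weight k.+1 x u * step_weight k.+1 x' u'))) ->
  weight n.+1 k A x * weight n.+1 k setT x' <=
  weight n.+1 k setT x * weight n.+1 k A x' +
  r * (weight n.+1 k setT x * weight n.+1 k setT x') +
  t * (lik k x * lik k x' * A1 ^+ 2).
Proof.
move=> mA s0 t0 sK sK' H.
set a := weight n k.+1 A; set b := weight n k.+1 setT.
have ba := weight_bounded mf q_kernel mh mu upsilon_gt0 upsilon_le y n k.+1 mA.
have bb := weight_bounded mf q_kernel mh mu upsilon_gt0 upsilon_le y n k.+1 measurableT.
rewrite -/a in ba; rewrite -/b in bb.
set c := fun u => s * \1_(C k.+1) u.
have int_c z w B : (forall u, c u <= trans_dens z u) -> bounded_nonneg w B ->
    leb.-integrable setT (EFin \o (fun u => c u * w u)).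
  move=> cz wB; have [mw w0 wleB] := wB.
  apply: le_integrable (integrable_trans_mul mf q_kernel z wB) => //.
    apply/measurable_EFinP; apply: measurable_funM => //.
    by apply: measurable_funM => //; exact: measurable_indic.
  have c0 u : 0 <= c u by rewrite mulr_ge0// indicE.
  move=> u _; rewrite !abse_EFin lee_fin !ger0_norm ?mulr_ge0 ?trans_dens_ge0//.
  by rewrite ler_wpM2r.
pose F : seq (('rV[R]_N -> R) * ('rV[R]_N -> R)) :=
  [:: (fun u => trans_dens x u * b u, fun u => trans_dens x' u * a u);
      (fun u => c u * a u, fun u => c u * b u);
      (fun u => r * (trans_dens x u * b u), fun u => trans_dens x' u * b u);
      (fun u => t * (trans_dens x u * step_weight k.+1 x u),
       fun u => trans_dens x' u * step_weight k.+1 x' u);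
      (fun u => -1 * (trans_dens x u * a u), fun u => trans_dens x' u * b u);
      (fun u => -1 * (c u * b u), fun u => c u * a u)].
have intZ l w : leb.-integrable setT (EFin \o w) ->
    leb.-integrable setT (EFin \o (fun u => l * w u)).
  move=> iw; rewrite (_ : _ \o _ = (fun u => l%:E * (EFin \o w) u)%E)//.
  exact: integrableZl.
have i1 z w B := @integrable_trans_mul R N f q mf q_kernel w B z.
have is1 := i1 x _ _ (step_weight_bounded k.+1 x).
have is2 := i1 x' _ _ (step_weight_bounded k.+1 x').
have := @rank_one_ge0 _ _ _ _ R leb leb F.
have h1 : forall e, List.In e F -> leb.-integrable setT (EFin \o e.1).
  move=> e /=; case=> [<-|]; first exact: i1 bb.
  case=> [<-|]; first exact: (int_c _ _ _ sK ba).
  case=> [<-|]; first exact: intZ (i1 _ _ _ bb).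
  case=> [<-|]; first exact: intZ.
  case=> [<-|]; first exact: intZ (i1 _ _ _ ba).
  by case=> [<-|//]; exact: intZ (int_c _ _ _ sK bb).
have h2 : forall e, List.In e F -> leb.-integrable setT (EFin \o e.2).
  move=> e /=; case=> [<-|]; first exact: i1 ba.
  case=> [<-|]; first exact: (int_c _ _ _ sK' bb).
  case=> [<-|]; first exact: (i1 _ _ _ bb).
  case=> [<-|]; first exact: is2.
  case=> [<-|]; first exact: (i1 _ _ _ bb).
  by case=> [<-|//]; exact: (int_c _ _ _ sK' ba).
move=> /(_ h1 h2).
have h3 u v : 0 <= \sum_(e <- F) e.1 u * e.2 v.
  rewrite /F !big_cons big_nil /=.
  have := H u v; rewrite -/a -/b -/(c u) -/(c v).
  set Ku := trans_dens x u; set Kv := trans_dens x' v.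
  set eu := step_weight _ _ u; set ev := step_weight _ _ v.
  rewrite -subr_ge0; set l := (X in 0 <= X -> _) => l0.
  by apply: (le_trans l0); rewrite le_eqVlt; apply/orP; left; apply/eqP; rewrite /l; ring.
move=> /(_ h3); rewrite /F !big_cons big_nil /=.
rewrite !RintegralZl//; last 3 first.
  - exact: (int_c _ _ _ sK bb).
  - exact: (i1 _ _ _ ba).
  - exact: (i1 _ _ _ bb).
have se z : 0 <= trans_op (step_weight k.+1 z) z.
  by have [_ + _] := trans_op_bounded mf q_kernel (step_weight_bounded k.+1 z); exact.
apply: cancel_symmetric => //; first by rewrite mulr_ge0// ltW// upsilon_gt0.
by rewrite expr2; apply: ler_pM; [exact: se|exact: se|exact: step_le|exact: step_le].
Qed.

(** Induction on n. On a good step which starts inside the Doeblin set, a safe pair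
    gains the factor rho and keeps m; an unsafe pair uses the bound for m - 1 and is
    paid by the penalty theta. A good step which starts outside the Doeblin set also
    uses m - 1 and is paid by out_weight. When no allowance is left, m = 0, the
    trivial bound of the weights by A1 suffices. *)
Lemma pair_contraction n k m A x x' : measurable A ->
  weight n k A x * weight n k setT x' <=
  weight n k setT x * weight n k A x' +
  rho ^+ (good_count n k - m) * (weight n k setT x * weight n k setT x') +
  theta ^- m * (out_weight k x * out_weight k x' * A1 ^+ (2 * n)).
Proof.
move=> mA.
have K0 : 0 < K := lt_le_trans eps0 epsK.
have th0 : 0 < theta := lt_le_trans ltr01 theta1.
have eK1 : (eps / K) ^+ 2 <= 1.
  by rewrite expr_le1 ?divr_ge0 ?ler_pdivrMr ?mul1r// ltW.
have rho0 : 0 <= rho by rewrite /rho subr_ge0.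
have rho1 : rho <= 1 by rewrite /rho lerBlDr lerDl sqr_ge0.
have M0 : 0 < M := lt_le_trans (upsilon_gt0 0) (upsilon_le 0).
have A10 : 0 < A1 := lt_le_trans M0 A1_ge.
have w0 B j i z : measurable B -> 0 <= weight j i B z.
  by move=> mB; exact: weight_ge0.
have lik0 i z : 0 <= lik i z by rewrite ltW// upsilon_gt0.
have lik_out i z : lik i z <= out_weight i z.
  by rewrite /out_weight ler_peMr// penalty_ge1.
have out0 := out_weight_ge0.
have thm0 j : 0 <= theta ^- j by rewrite invr_ge0 exprn_ge0// ltW.
elim: n k m x x' => [|n ih] k m x x'.
  rewrite /= sub0n expr0 mul1r !muln0 expr0 mulr1 !indicE !in_setT !mulr1.
  rewrite -[leLHS]add0r -addrA; apply: lerD; first by rewrite !mulr_ge0.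
  rewrite -[leLHS]addr0; apply: lerD.
    by rewrite ler_wpM2r// ler_piMr//; case: (_ \in _).
  by rewrite mulr_ge0// mulr_ge0.
(* no allowance left: both weights are at most out_weight * A1 ^+ n.+1 *)
case: m => [|m].
  rewrite expr0 invr1 mul1r -[leLHS]add0r; apply: lerD.
    apply: addr_ge0; first by apply: mulr_ge0; exact: w0.
    by apply: mulr_ge0; [exact: exprn_ge0|apply: mulr_ge0; exact: w0].
  have wle z B : measurable B -> weight n.+1 k B z <= out_weight k z * A1 ^+ n.+1.
    move=> mB; apply: le_trans (weight_le mf q_kernel mh mu upsilon_gt0 upsilon_le y n.+1 k z mB) _.
    apply: ler_pM => //; first by rewrite exprn_ge0// ltW.
    by rewrite lerXn2r// nnegrE ltW.
  rewrite mul2n -addnn exprD [leRHS]mulrACA.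
  by apply: ler_pM; [exact: w0|exact: w0|exact: wle|exact: wle].
set r := rho ^+ (good_count n.+1 k - m.+1).
have r0 : 0 <= r by rewrite exprn_ge0.
have e2n : A1 ^+ (2 * n.+1) = A1 ^+ (2 * n) * A1 ^+ 2.
  by rewrite mulnS addnC exprD.
set T := A1 ^+ (2 * n).
have T0 : 0 <= T by rewrite exprn_ge0// ltW.
have sw0 z u : 0 <= step_weight k.+1 z u.
  by have [_ + _] := step_weight_bounded k.+1 z; exact.
have out_step z u : out_weight k.+1 u <= step_weight k.+1 z u.
  by rewrite /step_weight ler_peMl// penalty_ge1.
have td0 z u : 0 <= trans_dens z u := trans_dens_ge0 f q_kernel z u.
have thS : theta ^- m = theta * theta ^- m.+1.
  by rewrite exprS invfM mulrA divff ?mul1r// gt_eqF.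
have close_step : theta ^- m.+1 * T * (lik k x * lik k x' * A1 ^+ 2) <=
    theta ^- m.+1 * (out_weight k x * out_weight k x' * A1 ^+ (2 * n.+1)).
  rewrite -[leLHS]mulrA; apply: ler_wpM2l => //; rewrite e2n -/T [leLHS]mulrCA.
  apply: ler_pM => //; first exact: mulr_ge0.
    by rewrite mulr_ge0 ?exprn_ge0 ?ltW.
  by apply: ler_pM.
have step_out z z' u u' : T * (out_weight k.+1 u * out_weight k.+1 u') <=
    T * (step_weight k.+1 z u * step_weight k.+1 z' u').
  by apply: ler_wpM2l => //; apply: ler_pM => //; exact: out_step.
have bound_ge0 i j u u' :
    0 <= rho ^+ i * (weight n k.+1 setT u * weight n k.+1 setT u') +
         theta ^- j * (out_weight k.+1 u * out_weight k.+1 u' * T).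
  apply: addr_ge0; apply: mulr_ge0 => //; first exact: exprn_ge0.
    by apply: mulr_ge0; exact: w0.
  by apply: mulr_ge0 => //; exact: mulr_ge0.
have AC4 (a b c e : R) : a * b * (c * e) = b * e * (a * c) by ring.
(* a good step from inside the Doeblin set: subtract eps from both densities *)
have [/and3P[Sk xC x'C]|bad] := boolP [&& S k.+1, x \in C k & x' \in C k].
  rewrite inE in xC; rewrite inE in x'C.
  have trans_lower z u : C k z -> C k.+1 u -> eps <= trans_dens z u.
    by move=> zC uC; exact: (q_ge Sk).
  have epsc z u : C k z -> eps * \1_(C k.+1) u <= trans_dens z u.
    move=> zC; rewrite indicE; have [uC|uC] := boolP (u \in C k.+1).
      by rewrite mulr1 trans_lower//; rewrite inE in uC.
    by rewrite mulr0.
  have ec0 u : 0 <= eps * \1_(C k.+1) u by apply: mulr_ge0; [exact: ltW|rewrite indicE].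
  have main := @integrate_step n k A x x' eps r (theta ^- m.+1 * T) mA (ltW eps0)
    (mulr_ge0 (thm0 _) T0) (fun u => epsc _ _ xC) (fun u => epsc _ _ x'C).
  apply: (le_trans (main _)) => [u u'|]; last first.
    by rewrite lerD2l; exact: close_step.
  set P := trans_dens x u * trans_dens x' u'.
  have P0 : 0 <= P by rewrite mulr_ge0.
  have Ps0 : 0 <= P - (eps * \1_(C k.+1) u) * (eps * \1_(C k.+1) u').
    by rewrite subr_ge0; apply: ler_pM => //; exact: epsc.
  set al := weight n k.+1 A; set be := weight n k.+1 setT.
  have be0 z : 0 <= be z by exact: w0.
  have [[[uC uD] [u'C u'D]]|unsafe] :=
      pselect (safe_set k.+1 x u /\ safe_set k.+1 x' u').
    (* safe pair: the subtraction removes at least the fraction (eps / K) ^+ 2 *)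
    apply: (@scaled_le _ _ _ rho (rho ^+ (good_count n k.+1 - m.+1) * (be u * be u') +
       theta ^- m.+1 * (out_weight k.+1 u * out_weight k.+1 u' * T))) => //.
    - rewrite !indicE !mem_set// !mulr1 /rho mulrBl mul1r lerB//.
      have PK : P <= K ^+ 2.
        by rewrite expr2; apply: ler_pM => //; exact: q_le.
      rewrite -expr2 expr_div_n mulrAC ler_pdivrMr ?exprn_gt0//.
      by rewrite ler_wpM2l// sqr_ge0.
    - by rewrite lerBlDl addrA; exact: ih.
    - rewrite mulrDr; apply: lerD.
        rewrite [leLHS]mulrA -exprS; apply: ler_wpM2r; first exact: mulr_ge0.
        rewrite /r /= Sk add1n subSS; apply: ler_wiXn2l => //.
        by rewrite leq_subLR addnS -addSn -leq_subLR.
      apply: (@le_trans _ _ (theta ^- m.+1 * (out_weight k.+1 u * out_weight k.+1 u' * T))).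
        apply: ler_piMl rho1; apply: mulr_ge0; first exact: thm0.
        by apply: mulr_ge0; [exact: mulr_ge0|exact: T0].
      by rewrite -[leRHS]mulrA; apply: ler_wpM2l => //; rewrite mulrC.
  (* unsafe pair: the hypothesis for m, paid by the penalty of the increment *)
  apply: (@scaled_le _ _ _ 1 (rho ^+ (good_count n k.+1 - m) * (be u * be u') +
       theta ^- m * (out_weight k.+1 u * out_weight k.+1 u' * T))) => //.
  - by rewrite mul1r lerBlDr lerDl mulr_ge0.
  - by rewrite lerBlDl addrA; exact: ih.
  - rewrite mul1r; apply: lerD.
      by rewrite /r /= Sk add1n subSS.
    rewrite thS AC4; apply: ler_wpM2l; first exact: mulr_ge0.
    have step1 z v : ~ safe_set k.+1 z v -> theta * out_weight k.+1 v = step_weight k.+1 z v.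
      by move=> nv; rewrite /step_weight penalty_out.
    have [su|nsu] := pselect (safe_set k.+1 x u).
      rewrite mulrCA; apply: ler_pM => //.
      - by rewrite mulr_ge0// ltW.
      - by rewrite (@step1 x')// => su'; apply: unsafe.
    rewrite mulrA; apply: ler_pM => //.
    - by rewrite mulr_ge0// ltW.
    - by rewrite (@step1 x).
have zero_le z u : 0 * \1_(C k.+1) u <= trans_dens z u by rewrite mul0r.
have main t t0 := @integrate_step n k A x x' 0 r t mA (lexx 0) t0
  (fun u => zero_le _ _) (fun u => zero_le _ _).
have be0 z : 0 <= weight n k.+1 setT z by exact: w0.
(* step not counted: nothing is gained or spent *)
have [nS|Sk] := boolP (~~ S k.+1).
  apply: (le_trans (main (theta ^- m.+1 * T) _ _)) => [|u u'|].
  - exact: mulr_ge0.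
  - rewrite !mul0r subr0; apply: ler_wpM2l; first exact: mulr_ge0.
    rewrite lerBlDl addrA; apply: le_trans (ih k.+1 m.+1 u u') _.
    rewrite /r /= (negbTE nS) add0n lerD2l -[leRHS]mulrA.
    by apply: ler_wpM2l => //; rewrite mulrC.
  - by rewrite lerD2l; exact: close_step.
(* good step from outside: out_weight pays for the lost unit of the allowance *)
have out2 : theta * (lik k x * lik k x') <= out_weight k x * out_weight k x'.
  have [xC|xC] := pselect (C k x).
    rewrite mulrCA; apply: ler_pM => //; first by rewrite mulr_ge0// ltW.
    rewrite /out_weight (@penalty_out _ x') 1?mulrC// => x'C.
    by move: bad; rewrite (negPn Sk) !mem_set.
  rewrite mulrA; apply: ler_pM => //; first by rewrite mulr_ge0// ltW.
  by rewrite /out_weight (@penalty_out _ x) 1?mulrC.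
apply: (le_trans (main (theta ^- m * T) _ _)) => [|u u'|].
- exact: mulr_ge0.
- rewrite !mul0r subr0; apply: ler_wpM2l; first exact: mulr_ge0.
  rewrite lerBlDl addrA; apply: le_trans (ih k.+1 m u u') _.
  rewrite /r /= (negPn Sk) add1n subSS lerD2l -[leRHS]mulrA.
  by apply: ler_wpM2l => //; rewrite mulrC.
- rewrite lerD2l thS e2n.
  have AC5 (a b c e g : R) : a * b * c * (e * g) = b * (a * e * (c * g)) by ring.
  rewrite AC5; apply: ler_wpM2l => //.
  apply: ler_wpM2r; last exact: out2.
  by rewrite mulr_ge0 ?exprn_ge0 ?ltW.
Qed.

End pair_contraction.

(** * Masses of the filters and total variation *)

Section filter_gap.
Variables (R : realType) (N p : nat) (f : 'rV[R]_N -> 'rV[R]_N).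
Variables (q : 'rV[R]_N -> 'rV[R]_N -> R) (h : 'rV[R]_N -> 'rV[R]_p).
Hypotheses (mf : measurable_fun setT f) (q_kernel : is_density_kernel q).
Hypothesis mh : measurable_fun setT h.
Variables (upsilon : 'rV[R]_p -> R) (M : R).
Hypotheses (mu : measurable_fun setT upsilon) (upsilon_gt0 : forall u, 0 < upsilon u)
  (upsilon_le : forall u, upsilon u <= M).
Variable y : nat -> 'rV[R]_p.
Local Notation leb := (lebesgue_rV R N).
Local Notation trans_op := (trans_op f q).
Local Notation lik k x := (likelihood h upsilon x (y k)).
Local Notation weight := (weight f q h upsilon y).
Implicit Types nu : probability 'rV[R]_N R.

Let weightB n k A mA := @weight_bounded R N p f q h mf q_kernel mh upsilon M mu
  upsilon_gt0 upsilon_le y n k A mA.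

Definition mass nu n A : R := \int[nu]_x weight n 0 A x.

Lemma bounded_integrable nu w B : bounded_nonneg w B ->
  nu.-integrable setT (EFin \o w).
Proof.
move=> [mw w0 wB].
have iB : nu.-integrable setT (EFin \o cst B) by exact: finite_measure_integrable_cst.
apply: le_integrable iB => //; first exact/measurable_EFinP.
by move=> u _; rewrite !abse_EFin lee_fin !ger0_norm// (le_trans (w0 u)).
Qed.

Lemma integral_path_weight nu n A : measurable A ->
  (\int[nu]_x path_weight (transition f q) (likelihood h upsilon) n y A x =
   (mass nu n A)%:E)%E.
Proof.
move=> mA; rewrite /mass /Rintegral fineK.
  apply: eq_integral => x _.
  by rewrite -(path_weightE mf q_kernel mh mu upsilon_gt0 upsilon_le y n 0 x mA).
by apply: integrable_fin_num => //; exact: bounded_integrable (weightB n 0 mA).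
Qed.

Lemma weightU n k A B x : measurable A -> measurable B -> [disjoint A & B] ->
  weight n k (A `|` B) x = weight n k A x + weight n k B x.
Proof.
move=> mA mB AB; elim: n k x => [|n ih] k x /=.
  rewrite -mulrDr; congr (_ * _).
  rewrite !indicE in_setU; have [xA|] := boolP (x \in A); last by rewrite /= add0r.
  rewrite (_ : x \in B = false) ?addr0//; apply/negbTE/negP => xB.
  by move/disj_setPS: AB => /(_ x); apply; split; exact: set_mem.
rewrite -mulrDr; congr (_ * _).
transitivity (trans_op (fun u => weight n k.+1 A u + weight n k.+1 B u) x).
  by apply: eq_Rintegral => u _; rewrite ih.
rewrite /trans_op; under eq_Rintegral do rewrite mulrDr.
by rewrite RintegralD//; exact: (integrable_trans_mul mf q_kernel x (weightB n k.+1 _)).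
Qed.

Lemma massU nu n A B : measurable A -> measurable B -> [disjoint A & B] ->
  mass nu n (A `|` B) = mass nu n A + mass nu n B.
Proof.
move=> mA mB AB; rewrite /mass; under eq_Rintegral do rewrite weightU//.
by rewrite RintegralD//; exact: bounded_integrable (weightB n 0 _).
Qed.

Lemma filter_distE nu n A : measurable A -> 0 < mass nu n setT ->
  filter_dist (transition f q) (likelihood h upsilon) nu n y A =
  (mass nu n A / mass nu n setT)%:E.
Proof.
move=> mA m0; rewrite /filter_dist !integral_path_weight//.
by rewrite inver gt_eqF// EFinM.
Qed.

End filter_gap.

Section tv_bound.
Context d (T : measurableType d) (R : realType).

(** Grouping the sets with a nonnegative value, then those with a negative value,
    bounds the variation of an additive set function by twice its supremum. *)
Lemma tv_norm_le (xi : set T -> \bar R) (x : set T -> R) (B : R) :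
  (forall A, measurable A -> xi A = (x A)%:E) ->
  (forall A, measurable A -> `|x A| <= B) ->
  (forall A B, measurable A -> measurable B -> [disjoint A & B] ->
    x (A `|` B) = x A + x B) ->
  (tv_norm xi <= (2 * B)%:E)%E.
Proof.
move=> xiE xB xU; apply: ge_ereal_sup => _ [n [A [mA tA ->]]].
have x0 : x set0 = 0.
  have := xU set0 set0 measurable0 measurable0.
  rewrite setU0 => /(_ _)H; have : x set0 = x set0 + x set0.
    by apply: H; apply/disj_setPS; rewrite setI0.
  by move/eqP; rewrite -subr_eq subrr => /eqP.
have sumE (P : pred 'I_n) (s : seq 'I_n) : uniq s ->
    \sum_(i <- s | P i) x (A i) = x (\big[setU/set0]_(i <- s | P i) A i).
  elim: s => [|i s ih] us; first by rewrite !big_nil x0.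
  rewrite !big_cons; move: us => /= /andP[is_ us]; case: ifPn => Pi; last exact: ih.
  rewrite ih// xU//; first by apply: bigsetU_measurable.
  apply/disj_setPS => t [Ait].
  rewrite -bigcup_seq_cond => -[j /= /andP[js Pj] Ajt].
  have : i = j by apply: tA => //; exists t.
  by move=> ij; rewrite ij js in is_.
have mU (P : pred 'I_n) : measurable (\big[setU/set0]_(i < n | P i) A i).
  exact: bigsetU_measurable.
have -> : (\sum_(i < n) `|xi (A i)| = (\sum_(i < n) `|x (A i)|)%:E)%E.
  by rewrite -sumEFin; apply: eq_bigr => i _; rewrite xiE.
rewrite lee_fin (bigID (fun i => 0 <= x (A i)))/= mulr2n mulrDl mul1r.
apply: lerD.
  rewrite (eq_bigr (fun i => x (A i))); last by move=> i; exact: ger0_norm.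
  by rewrite sumE ?index_enum_uniq//; apply: le_trans (ler_norm _) (xB _ _).
rewrite (eq_bigr (fun i => - x (A i))).
  by rewrite sumrN sumE ?index_enum_uniq//; apply: le_trans (ler_norm _) _; rewrite normrN; exact: xB.
by move=> i; rewrite -ltNge => ?; rewrite ltr0_norm.
Qed.

End tv_bound.

Section mass_bounds.
Variables (R : realType) (N p : nat) (f : 'rV[R]_N -> 'rV[R]_N).
Variables (q : 'rV[R]_N -> 'rV[R]_N -> R) (h : 'rV[R]_N -> 'rV[R]_p).
Hypotheses (mf : measurable_fun setT f) (q_kernel : is_density_kernel q).
Hypothesis mh : measurable_fun setT h.
Variables (upsilon : 'rV[R]_p -> R) (M : R).
Hypotheses (mu : measurable_fun setT upsilon) (upsilon_gt0 : forall u, 0 < upsilon u)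
  (upsilon_le : forall u, upsilon u <= M).
Variable y : nat -> 'rV[R]_p.
Local Notation leb := (lebesgue_rV R N).
Local Notation trans_op := (trans_op f q).
Local Notation trans_dens := (trans_dens f q).
Local Notation lik k x := (likelihood h upsilon x (y k)).
Local Notation weight := (weight f q h upsilon y).
Local Notation mass := (mass f q h upsilon y).
Implicit Types nu : probability 'rV[R]_N R.

Let weightB n k A mA := @weight_bounded R N p f q h mf q_kernel mh upsilon M mu
  upsilon_gt0 upsilon_le y n k A mA.

(** Integrating the pointwise bound of pair_contraction over nu and nu' gives the
    gap between the two filters, before the division by their masses. *)
Lemma mass_gap nu nu' n A rho_n t O (w : 'rV[R]_N -> R) : measurable A ->
  bounded_nonneg w O -> 0 <= t ->
  (forall x x', weight n 0 A x * weight n 0 setT x' <=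
    weight n 0 setT x * weight n 0 A x' +
    rho_n * (weight n 0 setT x * weight n 0 setT x') +
    t * (w x * w x')) ->
  mass nu n A * mass nu' n setT <= mass nu n setT * mass nu' n A +
    rho_n * (mass nu n setT * mass nu' n setT) + t * O ^+ 2.
Proof.
move=> mA bw t0 H.
set a := weight n 0 A; set b := weight n 0 setT.
have ba : bounded_nonneg a _ := weightB n 0 mA.
have bb : bounded_nonneg b _ := weightB n 0 measurableT.
pose F : seq (('rV[R]_N -> R) * ('rV[R]_N -> R)) :=
  [:: (b, a); (fun u => rho_n * b u, b); (fun u => t * w u, w); (fun u => -1 * a u, b)].
have intZ (m : probability 'rV[R]_N R) l v : m.-integrable setT (EFin \o v) ->
    m.-integrable setT (EFin \o (fun u => l * v u)).
  move=> iw; rewrite (_ : _ \o _ = (fun u => l%:E * (EFin \o v) u)%E)//.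
  exact: integrableZl.
have ib m B v := @bounded_integrable R N m v B.
have h1 : forall e, List.In e F -> nu.-integrable setT (EFin \o e.1).
  move=> e /=; case=> [<-|]; first exact: ib bb.
  case=> [<-|]; first exact: intZ (ib _ _ _ bb).
  case=> [<-|]; first exact: intZ (ib _ _ _ bw).
  by case=> [<-|//]; exact: intZ (ib _ _ _ ba).
have h2 : forall e, List.In e F -> nu'.-integrable setT (EFin \o e.2).
  move=> e /=; case=> [<-|]; first exact: ib ba.
  case=> [<-|]; first exact: ib bb.
  case=> [<-|]; first exact: ib bw.
  by case=> [<-|//]; exact: ib bb.
have h3 u v : 0 <= \sum_(e <- F) e.1 u * e.2 v.
  rewrite /F !big_cons big_nil /=; have := H u v; rewrite -/a -/b.
  move: (a u) (a v) (b u) (b v) (w u) (w v) => *; lra.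
have := rank_one_ge0 h1 h2 h3; rewrite /F !big_cons big_nil /=.
rewrite !RintegralZl//; last 3 first.
- exact: ib ba.
- exact: ib bw.
- exact: ib bb.
rewrite -/(mass nu n A) -/(mass nu n setT) -/(mass nu' n A) -/(mass nu' n setT).
have wle (m : probability 'rV[R]_N R) : \int[m]_x w x <= O.
  have [mw w0 wO] := bw.
  have -> : O = \int[m]_x (cst O x).
    rewrite (@Rintegral_cst _ _ _ m setT)//.
    by rewrite -[LHS]mulr1 -[X in _ * X]/(fine 1%E) -(probability_setT m).
  apply: le_Rintegral => //; first exact: ib bw.
  exact: finite_measure_integrable_cst.
have w0 (m : probability 'rV[R]_N R) : 0 <= \int[m]_x w x.
  by apply: Rintegral_ge0 => x _; have [_ + _] := bw; exact.
have w2 : (\int[nu]_x w x) * (\int[nu']_x w x) <= O ^+ 2.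
  by rewrite expr2; apply: ler_pM.
move: (ler_wpM2l t0 w2).
move: (mass nu n A) (mass nu n setT) (mass nu' n A) (mass nu' n setT).
move: (\int[nu]_x w x) (\int[nu']_x w x) => *; lra.
Qed.

Variables (C : nat -> set 'rV[R]_N) (l : nat -> R) (gm v : R).
Hypotheses (gm0 : 0 < gm) (v0 : 0 < v) (l0 : forall k, 0 <= l k).
Hypothesis lik_lower : forall k x, C k x -> gm <= lik k x.
Hypothesis trans_lower : forall k x u, C k x -> C k.+1 u -> l k.+1 <= trans_dens x u.
Hypothesis C_box : forall k, exists B,
  [/\ measurable B, B `<=` C k & leb B = v%:E].

(** It is enough to count the paths that stay in the Doeblin sets: each step has a
    density at least l on a box of volume v and a likelihood at least gm. *)
Lemma weight_lower n k x : C k x ->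
  gm * \prod_(i < n) (l (k + i.+1)%N * v * gm) <= weight n k setT x.
Proof.
elim: n k x => [|n ih] k x Ck /=.
  by rewrite big_ord0 mulr1 indicE in_setT mulr1 lik_lower.
rewrite big_ord_recl /=.
have [B [mB BC vB]] := C_box k.+1.
set c := gm * \prod_(i < n) (l (k.+1 + i.+1)%N * v * gm).
have c0 : 0 <= c.
  apply: mulr_ge0; first exact: ltW.
  by apply: prodr_ge0 => i _; apply: mulr_ge0; [apply: mulr_ge0 => //|]; exact: ltW.
have -> : gm * (l (k + 1)%N * v * gm * \prod_(i < n) (l (k + (bump 0 i).+1)%N * v * gm))
    = gm * (l k.+1 * v * c).
  rewrite addn1 /c; congr (_ * _); rewrite -!mulrA; congr (_ * (_ * (_ * _))).
  by apply: eq_bigr => i _; rewrite /bump /= add1n addnS addSn.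
apply: ler_pM; [exact: ltW| |exact: lik_lower|].
  by apply: mulr_ge0 => //; apply: mulr_ge0 => //; exact: ltW.
rewrite -lee_fin -(trans_opE mf q_kernel x (weightB n k.+1 measurableT)).
apply: (@le_trans _ _ (\int[leb]_u ((l k.+1 * c)%:E * (\1_B u)%:E))%E).
  rewrite ge0_integralZl//; last 2 first.
  - by apply/measurable_EFinP; exact: measurable_indic.
  - by rewrite lee_fin mulr_ge0.
  rewrite integral_indic// setIT [X in (_ * X)%E](_ : _ = v%:E); last exact: vB.
  by rewrite -EFinM lee_fin mulrAC.
apply: ge0_le_integral => //.
- by move=> u _; apply: mule_ge0; rewrite lee_fin// mulr_ge0.
- by apply: measurable_funeM; apply/measurable_EFinP; exact: measurable_indic.
- apply/measurable_EFinP; apply: measurable_funM.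
    exact: measurable_trans_dens2.
  by have [] := weightB n k.+1 measurableT.
move=> u _; rewrite -EFinM lee_fin indicE; have [uB|uB] := boolP (u \in B).
  have Cu : C k.+1 u by apply: BC; rewrite inE in uB.
  by rewrite mulr1; apply: ler_pM => //; [exact: trans_lower|exact: ih].
by rewrite mulr0 mulr_ge0// ?trans_dens_ge0//; have [_ + _] := weightB n k.+1 measurableT; exact.
Qed.

Hypothesis mC : forall k, measurable (C k).

(** The initial law enters only through the positive mass that it sends into the
    first Doeblin set; from there weight_lower applies. *)
Lemma mass_lower nu : (0 < \int[nu]_x transition f q x (C 1%N))%E ->
  exists2 c, 0 < c & forall n,
  c * \prod_(i < n) (l i.+2 * v * gm) <= mass nu n.+1 setT.
Proof.
move=> nuQ; set F := fun x => lik 0%N x * trans_op \1_(C 1%N) x.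
have iC : bounded_nonneg (\1_(C 1%N) : 'rV[R]_N -> R) 1.
  split; first exact: measurable_indic.
    by move=> u; rewrite indicE.
  by move=> u; rewrite indicE; case: (_ \in _).
have bO : bounded_nonneg (trans_op \1_(C 1%N)) 1 by exact: trans_op_bounded.
have bF : bounded_nonneg F (M * 1) by apply: (bounded_lik mh mu upsilon_gt0 upsilon_le y).
have QE x : transition f q x (C 1%N) = (trans_op \1_(C 1%N) x)%:E.
  rewrite -(trans_opE mf q_kernel x iC) /transition integral_mkcond.
  apply: eq_integral => u _; rewrite patchE indicE.
  by case: ifPn => _; rewrite ?mulr1 ?mulr0.
(* the likelihood is positive, so a vanishing integral of F would make the kernel
   vanish nu-almost everywhere *)
have F0 : 0 < \int[nu]_x F x.
  rewrite lt_neqAle eq_sym; apply/andP; split; last first.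
    by apply: Rintegral_ge0 => x _; have [_ + _] := bF; exact.
  apply/eqP => F0; move: nuQ; apply/negP; rewrite -leNgt.
  have iF := bounded_integrable nu bF.
  have : (\int[nu]_x `|(F x)%:E| = 0)%E.
    transitivity ((\int[nu]_x F x)%:E); last by rewrite F0.
    rewrite /Rintegral fineK ?integrable_fin_num//; apply: eq_integral => x _.
    by rewrite gee0_abs// lee_fin; have [_ + _] := bF; exact.
  have mF : measurable_fun setT (EFin \o F) by apply/measurable_EFinP; have [] := bF.
  move=> /(ae_eq_integral_abs nu measurableT mF) F0ae.
  suff -> : (\int[nu]_x transition f q x (C 1%N) = 0)%E by [].
  transitivity (\int[nu]_x cst 0%E x)%E; last exact: integral0.
  apply: ae_eq_integral => //.
    rewrite (_ : (fun _ => _) = EFin \o trans_op \1_(C 1%N)); last exact/funext.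
    by apply/measurable_EFinP; have [] := bO.
  apply: filterS F0ae => x /= /(_ I)[] /eqP.
  rewrite mulf_eq0 gt_eqF ?upsilon_gt0//= => /eqP e _.
  by rewrite [LHS]QE e.
exists (gm * \int[nu]_x F x) => [|n]; first exact: mulr_gt0.
set c := gm * \prod_(i < n) (l i.+2 * v * gm).
have c0 : 0 <= c.
  apply: mulr_ge0; first exact: ltW.
  by apply: prodr_ge0 => i _; apply: mulr_ge0; [apply: mulr_ge0 => //|]; exact: ltW.
rewrite [leLHS](_ : _ = c * \int[nu]_x F x); last by rewrite /c mulrAC.
have iF := bounded_integrable nu bF.
rewrite -(@RintegralZl _ _ _ nu setT F c measurableT iF).
apply: le_Rintegral => //.
- rewrite (_ : _ \o _ = (fun u => c%:E * (EFin \o F) u)%E)//.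
  exact: integrableZl.
- exact: bounded_integrable (weightB n.+1 0 measurableT).
move=> x _; rewrite /F mulrCA /=; apply: ler_wpM2l; first exact: ltW (upsilon_gt0 _).
have icC : bounded_nonneg (fun u => c * \1_(C 1%N) u) (c * 1).
  have [m1 m2 m3] := iC; split.
  - by apply: measurable_funM.
  - by move=> u; rewrite mulr_ge0.
  - by move=> u; rewrite ler_wpM2l.
rewrite [leLHS](_ : _ = trans_op (fun u => c * \1_(C 1%N) u) x).
  apply: (trans_op_le mf q_kernel x icC (weightB n 1 measurableT)) => u.
  rewrite indicE; have [uC|uC] := boolP (u \in C 1%N).
    by rewrite mulr1; apply: (@weight_lower n 1%N u); rewrite inE in uC.
  by rewrite mulr0; have [_ + _] := weightB n 1 measurableT; exact.
rewrite /trans_op -(@RintegralZl _ _ _ leb setT _ c measurableT (integrable_trans_mul mf q_kernel x iC)).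
by apply: eq_Rintegral => u _; rewrite mulrCA.
Qed.

End mass_bounds.

(** * Euclidean norm and local Doeblin sets *)

Section euclidean_norm.
Variable R : realType.

Lemma enorm_ge0 n (x : 'rV[R]_n) : 0 <= enorm x. Proof. exact: sqrtr_ge0. Qed.

Lemma sqr_enorm n (x : 'rV[R]_n) : enorm x ^+ 2 = \sum_i x 0 i ^+ 2.
Proof. by rewrite sqr_sqrtr// sumr_ge0// => i _; rewrite sqr_ge0. Qed.

Lemma enormN n (x : 'rV[R]_n) : enorm (- x) = enorm x.
Proof. by congr Num.sqrt; apply: eq_bigr => i _; rewrite mxE sqrrN. Qed.

Lemma enormB n (x y : 'rV[R]_n) : enorm (x - y) = enorm (y - x).
Proof. by rewrite -enormN opprB. Qed.

Lemma coord_le_enorm n (x : 'rV[R]_n) i : `|x 0 i| <= enorm x.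
Proof.
rewrite -sqrtr_sqr; apply: ler_wsqrtr.
by rewrite (bigD1 i)//= lerDl sumr_ge0// => j _; rewrite sqr_ge0.
Qed.

Lemma enorm_le_max n (x : 'rV[R]_n) e : 0 <= e -> (forall i, `|x 0 i| <= e) ->
  enorm x <= n%:R * e.
Proof.
move=> e0 xe; rewrite -(@ler_pXn2r _ 2)// ?nnegrE ?enorm_ge0 ?mulr_ge0//.
rewrite sqr_enorm; apply: (@le_trans _ _ (\sum_(i < n) e ^+ 2)).
  apply: ler_sum => i _; rewrite -real_normK ?num_real//.
  by rewrite ler_pXn2r ?nnegrE.
rewrite sumr_const card_ord -[leLHS]mulr_natl exprMn ler_wpM2r ?sqr_ge0//.
by rewrite -natrX ler_nat; case: n {x xe} => // n; rewrite leq_pmull.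
Qed.

Lemma cauchy_schwarz n (x y : 'rV[R]_n) :
  \sum_i x 0 i * y 0 i <= enorm x * enorm y.
Proof.
set A := \sum_i x 0 i ^+ 2; set B := \sum_i y 0 i ^+ 2.
set D := \sum_i x 0 i * y 0 i.
have A0 : 0 <= A by rewrite sumr_ge0// => i _; rewrite sqr_ge0.
have B0 : 0 <= B by rewrite sumr_ge0// => i _; rewrite sqr_ge0.
have key : 0 <= B * (A * B - D ^+ 2).
  rewrite [leRHS](_ : _ = \sum_i (B * x 0 i - D * y 0 i) ^+ 2).
    by rewrite sumr_ge0// => i _; rewrite sqr_ge0.
  rewrite (eq_bigr (fun i => B ^+ 2 * x 0 i ^+ 2 +
    (- (2 * B * D)) * (x 0 i * y 0 i) + D ^+ 2 * y 0 i ^+ 2)).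
    by rewrite !big_split/= -!mulr_sumr -/A -/B -/D; move: A B D {A0 B0} => *; ring.
  by move=> i _; move: A B D {A0 B0} => *; ring.
have DAB : D ^+ 2 <= A * B.
  have [B0'|] := ltP 0 B; first by move: key; rewrite pmulr_rge0// subr_ge0.
  move=> B0'; have BE : B = 0 by apply/eqP; rewrite eq_le B0'.
  rewrite BE mulr0 (_ : D = 0) ?expr0n//.
  apply: big1 => i _; have : y 0 i ^+ 2 <= 0.
    rewrite -BE /B (bigD1 i)//= lerDl sumr_ge0// => j _; exact: sqr_ge0.
  by rewrite le_eqVlt ltNge sqr_ge0 orbF sqrf_eq0 => /eqP ->; rewrite mulr0.
rewrite /enorm -/A -/B -sqrtrM// (le_trans (ler_norm _))//.
by rewrite -sqrtr_sqr; exact: ler_wsqrtr.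
Qed.

Lemma enormD n (x y : 'rV[R]_n) : enorm (x + y) <= enorm x + enorm y.
Proof.
rewrite -(@ler_pXn2r _ 2)// ?nnegrE ?enorm_ge0 ?addr_ge0 ?enorm_ge0//.
rewrite sqrrD !sqr_enorm.
under eq_bigr do rewrite mxE sqrrD.
rewrite !big_split/= lerD2r lerD2l.
by rewrite mulr2n; apply: lerD; exact: cauchy_schwarz.
Qed.

Lemma enorm_triangle n (x y z : 'rV[R]_n) : enorm (x - z) <= enorm (x - y) + enorm (y - z).
Proof. by apply: le_trans (enormD _ _); rewrite addrA subrK. Qed.

Lemma compact_cube n (r : R) : compact [set u : 'rV[R]_n | forall i, u 0 i \in `[- r, r]].
Proof.
have := @rV_compact R n (fun=> [set` `[- r, r]]) (fun=> @segment_compact R (- r) r).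
exact.
Qed.

Lemma measurable_ball_enorm n (c : 'rV[R]_n) r :
  measurable [set x : 'rV[R]_n | enorm (x - c) <= r].
Proof.
have m1 : measurable_fun setT (fun x : 'rV[R]_n => x - c).
  by apply: measurable_rVB => //; exact: measurable_cst.
have m2 := measurableT_comp (@measurable_enorm R n) m1.
rewrite (_ : mkset _ = (@enorm R n \o (fun x => x - c)) @^-1` `]-oo, r]%classic).
  by rewrite -[X in measurable X]setTI; apply: m2 => //; exact: measurable_itv.
by apply/seteqP; split => x; rewrite /= in_itv.
Qed.

End euclidean_norm.

Section doeblin_sets.
Variables (R : realType) (N p : nat) (h : 'rV[R]_N -> 'rV[R]_p).
Hypothesis mh : measurable_fun setT h.

Lemma measurable_doeblin_set y r : measurable (doeblin_set h y r).
Proof.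
rewrite (_ : doeblin_set h y r = h @^-1` [set z | enorm (z - y) <= r])//.
by rewrite -[X in measurable X]setTI; apply: mh => //; exact: measurable_ball_enorm.
Qed.

(** Uniform continuity of h puts a cube around any preimage of y inside the Doeblin
    set, and the side of the cube does not depend on y. *)
Lemma doeblin_set_box (r : R) : unif_continuous h -> range h = setT -> 0 < r ->
  exists2 v, 0 < v & forall y, exists B,
    [/\ measurable B, B `<=` doeblin_set h y r & lebesgue_rV R N B = v%:E].
Proof.
move=> /unif_continuousP hc hs r0.
have e0 : 0 < r / p.+1%:R by rewrite divr_gt0.
have [e ep he] := hc _ e0.
exists (\prod_(i < N) e) => [|y]; first by rewrite prodr_gt0.
have [x _ xy] : range h y by rewrite hs.
pose lo : 'rV[R]_N := x - const_mx (e / 2).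
pose hi : 'rV[R]_N := x + const_mx (e / 2).
exists [set u : 'rV[R]_N | forall i, lo 0 i <= u 0 i <= hi 0 i]; split.
- exact: measurable_box.
- move=> u Bu; rewrite /doeblin_set /=.
  have /(he (x, u))/= [_ hxu] : ball x e u.
    split=> // i j; rewrite (ord1 i) /ball/= ltr_distlC.
    by have := Bu j; rewrite !mxE => /andP[u1 u2]; apply/andP; split; lra.
  apply: (@le_trans _ _ (p%:R * (r / p.+1%:R))).
    apply: enorm_le_max => [|i]; first exact: ltW.
    have := hxu 0 i; rewrite /ball/= xy distrC => /ltW.
    by rewrite !mxE.
  rewrite mulrA ler_pdivrMr// mulrC ler_pM2l// ler_nat//.
- rewrite lebesgue_rV_box => [|i]; last by rewrite !mxE; lra.
  by congr EFin; apply: eq_bigr => i _; rewrite !mxE; field.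
Qed.

End doeblin_sets.

Section density_tail.
Context d (T : measurableType d) (R : realType) (mu : {measure set T -> \bar R}).
Variable F : T -> R.
Hypotheses (iF : mu.-integrable setT (EFin \o F)) (F0 : forall x, 0 <= F x).

(** Dominated convergence; this is the substitute for an upper bound of the
    transition density. *)
Lemma integral_tail_small (e : R) : 0 < e -> exists2 K, 1 <= K &
  (\int[mu]_x (F x * \1_[set z | K < F z] x)%:E <= e%:E)%E.
Proof.
move=> e0; have mF : measurable_fun setT F by apply/measurable_EFinP; exact: measurable_int iF.
have mD K : measurable [set z | K < F z].
  rewrite (_ : mkset _ = F @^-1` `]K, +oo[%classic); last first.
    by apply/seteqP; split => x; rewrite /= in_itv/= andbT.
  by rewrite -[X in measurable X]setTI; apply: mF.
pose G n x := (F x * \1_[set z | n.+1%:R < F z] x)%:E.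
have [] := @dominated_convergence _ _ _ mu setT measurableT G (cst 0%E) (EFin \o F).
- move=> n; apply/measurable_EFinP; apply: measurable_funM; first exact: mF.
  by apply: measurable_indic; exact: mD.
- exact: measurable_cst.
- apply: aeW => x _; apply: cvg_near_cst.
  exists (Num.truncn (F x)) => // n /= nx.
  apply/eqP; rewrite /G indicE memNset ?mulr0//= => /lt_geF/negP; apply.
  have /andP[_] := truncn_itv (F0 x); move=> /ltW/le_trans; apply.
  by rewrite ler_nat.
- exact: iF.
- apply: aeW => x n _; rewrite /G abse_EFin lee_fin ger0_norm ?mulr_ge0// ?indicE//.
  by rewrite ler_piMr//; case: (_ \in _).
move=> _ _; rewrite integral0 => /fine_cvgP[fG /(cvgr_lt _)/(_ _ e0) ltG].
have [n _ /(_ n (leqnn n))[/= Gfin Ge]] := filterI fG ltG.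
exists n.+1%:R; first by rewrite ler1n.
by rewrite -(fineK Gfin) lee_fin ltW.
Qed.

End density_tail.

(** * Forgetting for a fixed observation sequence *)

Section step_bound.
Variables (R : realType) (N p : nat) (f : 'rV[R]_N -> 'rV[R]_N).
Variables (q : 'rV[R]_N -> 'rV[R]_N -> R) (h : 'rV[R]_N -> 'rV[R]_p).
Hypotheses (mf : measurable_fun setT f) (q_kernel : is_density_kernel q).
Hypothesis mh : measurable_fun setT h.
Variables (upsilon : 'rV[R]_p -> R) (M : R).
Hypotheses (mu : measurable_fun setT upsilon) (upsilon_gt0 : forall u, 0 < upsilon u)
  (upsilon_le : forall u, upsilon u <= M).
Variable y : nat -> 'rV[R]_p.
Local Notation leb := (lebesgue_rV R N).

(** Three cases: a safe move costs the likelihood, at most M; a move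
    outside the Doeblin set has a likelihood at most eta; the moves whose dominating
    density F is above K have a small total mass e. The last two are affordable once
    eta and e are small compared with theta ^- 2. *)
Lemma trans_step_le (F : 'rV[R]_N -> R) (Delta K theta eta e : R) k x :
  measurable_fun setT F -> (forall v, 0 <= F v) -> (forall z v, q z v <= F v) ->
  (\int[leb]_v (F v * \1_[set v | K < F v] v)%:E <= e%:E)%E ->
  (forall u, Delta < enorm u -> upsilon u <= eta) -> 1 <= theta -> 0 <= eta ->
  measurable [set v | K < F v] ->
  trans_op f q (step_weight f h upsilon y (fun k => doeblin_set h (y k) Delta)
    [set v | K < F v] theta k x) x <= M + theta ^+ 2 * eta + theta ^+ 2 * M * e.
Proof.
move=> mF F0 qF tailF upsD th1 eta0 mD.
set D := [set v | K < F v]; set C := fun k => doeblin_set h (y k) Delta.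
have mC i : measurable (C i) by exact: measurable_doeblin_set.
have th0 : 0 <= theta := le_trans ler01 th1.
have M0 : 0 <= M := le_trans (ltW (upsilon_gt0 0)) (upsilon_le 0).
have sb := step_weight_bounded f mh mu upsilon_gt0 upsilon_le y mC mD th1 k x.
rewrite -lee_fin -(trans_opE mf q_kernel x sb).
set a := M + theta ^+ 2 * eta; set b := theta ^+ 2 * M.
have a0 : 0 <= a by rewrite addr_ge0// mulr_ge0// exprn_ge0.
have b0 : 0 <= b by rewrite mulr_ge0// exprn_ge0.
have td0 u := trans_dens_ge0 f q_kernel x u.
have mtd := measurable_trans_dens2 mf q_kernel x.
pose T v := F v * \1_D v.
have mT : measurable_fun setT T by apply: measurable_funM => //; exact: measurable_indic.
have mshift : measurable_fun setT (fun u : 'rV[R]_N => u - f x).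
  by apply: measurable_rVB => //; exact: measurable_cst.
have mTs : measurable_fun setT (fun u : 'rV[R]_N => T (u - f x)).
  exact: (measurableT_comp mT mshift).
have T0 v : 0 <= T v by rewrite mulr_ge0// indicE.
apply: (@le_trans _ _ (\int[leb]_u (a%:E * (trans_dens f q x u)%:E + b%:E * (T (u - f x))%:E))%E).
  apply: ge0_le_integral => //.
  - move=> u _; rewrite lee_fin mulr_ge0//.
    by have [_ + _] := sb; exact.
  - apply/measurable_EFinP; apply: measurable_funM => //; by have [] := sb.
  - apply: emeasurable_funD; apply: measurable_funeM; exact/measurable_EFinP.
  move=> u _; rewrite -!EFinM -EFinD lee_fin.
  have q_le_F : trans_dens f q x u <= F (u - f x) by exact: qF.
  have lik0 : 0 < likelihood h upsilon u (y k) by exact: upsilon_gt0.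
  have likM : likelihood h upsilon u (y k) <= M by exact: upsilon_le.
  have th2 : theta <= theta ^+ 2 by rewrite expr2 ler_peMr.
  have th21 : 1 <= theta ^+ 2 by rewrite (le_trans th1).
  rewrite /step_weight /out_weight.
  have bT : 0 <= b * T (u - f x) by rewrite mulr_ge0.
  have [uC|uC] := pselect (C k u); last first.
    rewrite (@penalty_out _ _ _ (C k))//.
    have pl := @penalty_le _ _ _ th1 (safe_set f C D k x) u.
    have p1 := @penalty_ge1 _ _ _ th1 (safe_set f C D k x) u.
    have lik_eta : likelihood h upsilon u (y k) <= eta.
      apply: upsD; rewrite enormB ltNge; apply/negP; exact: uC.
    apply: (@le_trans _ _ (trans_dens f q x u * (theta * (eta * theta)))).
      apply: ler_wpM2l => //; apply: ler_pM => //; first exact: le_trans ler01 p1.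
        by rewrite mulr_ge0// ltW.
      by apply: ler_wpM2r.
    have -> : theta * (eta * theta) = theta ^+ 2 * eta by ring.
    rewrite mulrC; apply: (@le_trans _ _ (a * trans_dens f q x u)); last by rewrite lerDl.
    by rewrite ler_wpM2r// /a lerDr.
  rewrite (@penalty_in _ _ _ (C k))// mulr1.
  have [uD|uD] := pselect (D (u - f x)).
    rewrite penalty_out; last by case.
    have -> : T (u - f x) = F (u - f x) by rewrite /T indicE mem_set// mulr1.
    apply: (@le_trans _ _ (b * F (u - f x))); last by rewrite lerDr mulr_ge0.
    rewrite mulrC; apply: ler_pM => //; first by rewrite mulr_ge0// ltW.
    by apply: ler_pM => //; exact: ltW.
  rewrite penalty_in// mul1r; apply: (@le_trans _ _ (a * trans_dens f q x u)); last by rewrite lerDl.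
  rewrite mulrC ler_wpM2r// (le_trans likM)// /a lerDl mulr_ge0// exprn_ge0//.
rewrite ge0_integralD//; last 4 first.
- by move=> u _; rewrite -EFinM lee_fin mulr_ge0.
- by apply: measurable_funeM; exact/measurable_EFinP.
- by move=> u _; rewrite -EFinM lee_fin mulr_ge0.
- by apply: measurable_funeM; exact/measurable_EFinP.
rewrite ge0_integralZl//; last 2 first.
- exact/measurable_EFinP.
- by move=> u _; rewrite lee_fin.
rewrite integral_trans_dens// mule1 ge0_integralZl//; last 2 first.
- exact/measurable_EFinP.
- by move=> u _; rewrite lee_fin.
rewrite (@ge0_integral_shift R N (f x) (EFin \o T))//; last exact/measurable_EFinP.
rewrite -/a -/b [leRHS]EFinD; apply: leeD2l; rewrite [leRHS]EFinM.
by apply: lee_wpmul2l => //; rewrite lee_fin.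
Qed.

End step_bound.

(** A step which is not good costs more than B: Markov's inequality for averages. *)
Lemma good_count_ge (R : realFieldType) (W : nat -> R) (B : R) n k :
  0 < B -> (forall i, 0 <= W i) ->
  B * n%:R <= B * (good_count (fun i => W i <= B) n k)%:R + \sum_(i < n) W (k + i.+1)%N.
Proof.
move=> B0 W0; elim: n k => [|n ih] k; first by rewrite big_ord0 !mulr0 addr0.
rewrite big_ord_recl /= natrD mulrDr -natr1 mulrDr mulr1 addn1.
have -> : \sum_(i < n) W (k + (bump 0 i).+1)%N = \sum_(i < n) W (k.+1 + i.+1)%N.
  by apply: eq_bigr => i _; rewrite /bump /= add1n addnS addSn.
have := ih k.+1; case: (leP (W k.+1) B) => WB /=; have := W0 k.+1; lra.
Qed.

(** The exponent n %/ 4 comes from giving a quarter of the steps to the allowance m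
    of pair_contraction, while at least half of the steps are good. *)
Lemma geometric_limsup_lt0 (R : realType) (u : nat -> \bar R) (G r : R) n0 :
  0 < G -> 0 < r -> r < 1 ->
  (forall n, (n0 <= n)%N -> (u n <= (G * r ^+ (n %/ 4))%:E)%E) ->
  (limn_esup (fun n => n%:R^-1%:E * lne (u n)) < 0)%E.
Proof.
move=> G0 r0 r1 H; have lr : ln r < 0 by rewrite ln_lt0// r0 r1.
pose L := ln G - 3 / 4 * ln r.
(* past n1 the constant L is absorbed in half of the rate ln r / 4 *)
pose n1 := maxn (maxn n0 1) (Num.truncn (`|L| / (- ln r / 8))).+1.
apply: (@le_lt_trans _ _ (ln r / 8)%:E); last by rewrite lte_fin; lra.
apply: (@le_trans _ _ (ereal_sup ((fun n => n%:R^-1%:E * lne (u n))%E @` [set n | (n1 <= n)%N]))).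
  by apply: ereal_inf_lbound; exists [set n | (n1 <= n)%N] => //; exists n1.
apply: ge_ereal_sup => _ [n /= n1n <-].
have n0n : (n0 <= n)%N by apply: leq_trans n1n; rewrite /n1 !leq_max leqnn.
have n_gt0 : (0 < n)%N by apply: leq_trans n1n; rewrite /n1 !leq_max leqnn orbT.
have nR : 0 < n%:R :> R by rewrite ltr0n.
have Ln : `|L| <= (- ln r / 8) * n%:R.
  rewrite mulrC -ler_pdivrMr; last lra.
  have := truncn_itv (_ : 0 <= `|L| / (- ln r / 8)).
  rewrite divr_ge0//; last lra.
  move=> /(_ isT) /andP[_ /ltW] /le_trans; apply.
  by rewrite ler_nat; apply: leq_trans n1n; rewrite /n1 leq_max leqnn orbT.
have un : (lne (u n) <= (ln (G * r ^+ (n %/ 4)))%:E)%E.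
  have Gr : 0 < G * r ^+ (n %/ 4) by rewrite mulr_gt0// exprn_gt0.
  have := H n n0n; case: (u n) => [z|//|_]; last by rewrite leNye.
  rewrite lee_fin /= => zG; case: ifPn => [|z0]; first by rewrite leNye.
  by rewrite lee_fin ler_ln ?posrE// ltNge.
apply: (@le_trans _ _ (n%:R^-1 * ln (G * r ^+ (n %/ 4)))%:E).
  by rewrite EFinM; apply: lee_wpmul2l => //; rewrite lee_fin invr_ge0.
rewrite lee_fin ler_pdivrMl// lnM ?posrE ?exprn_gt0// lnXn//.
have n4 : n%:R <= (n %/ 4)%:R * 4 + 3 :> R.
  rewrite {1}(divn_eq n 4) natrD natrM lerD2l.
  by rewrite (ler_nat _ _ 3) -ltnS ltn_pmod.
rewrite -[ln r *+ _]mulr_natl.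
have LL := ler_norm L; rewrite /L in LL Ln.
have mr : (n %/ 4)%:R * ln r <= (n%:R - 3) / 4 * ln r by rewrite ler_nM2r//; lra.
by lra.
Qed.

(** With the penalty (2 * L) ^+ 4, an allowance of n %/ 4 pays for the growth L ^+ n
    and leaves a geometric decay. *)
Lemma power_budget (R : realFieldType) (L : R) n : 1 <= L ->
  ((2 * L) ^+ 4) ^- (n %/ 4) * L ^+ n <= L ^+ 3 * 2^-1 ^+ (n %/ 4).
Proof.
move=> L1; have L0 : 0 < L := lt_le_trans ltr01 L1.
set m := (n %/ 4)%N; have L4 : 0 < (2 * L) ^+ 4 by rewrite exprn_gt0// mulr_gt0.
have p0 : 0 < ((2 * L) ^+ 4) ^+ m by rewrite exprn_gt0.
rewrite [leLHS]mulrC ler_pdivrMr//.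
rewrite -[leRHS]mulrA -exprMn.
apply: (@le_trans _ _ (L ^+ 3 * (L ^+ 4) ^+ m)).
  rewrite -exprM -exprD ler_weXn2l// {1}(divn_eq n 4) -/m mulnC addnC leq_add2r.
  by rewrite -ltnS ltn_pmod.
apply: ler_wpM2l; first by rewrite exprn_ge0// ltW.
apply: lerXn2r; rewrite ?nnegrE ?mulr_ge0 ?exprn_ge0 ?ltW// ?mulr_gt0//.
have := exprn_gt0 4 L0; rewrite exprMn; lra.
Qed.

Lemma quarter_le n g : (n <= 2 * g)%N -> (n %/ 4 <= g - n %/ 4)%N.
Proof. by move=> ng; have := leq_divM n 4; lia. Qed.

Section forgetting.
Variables (R : realType) (N p : nat) (f : 'rV[R]_N -> 'rV[R]_N).
Variables (q : 'rV[R]_N -> 'rV[R]_N -> R) (h : 'rV[R]_N -> 'rV[R]_p).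
Hypotheses (mf : measurable_fun setT f) (q_kernel : is_density_kernel q).
Hypotheses (mh : measurable_fun setT h) (h_ucont : unif_continuous h)
  (h_surj : range h = setT).
Variables (upsilon : 'rV[R]_p -> R) (M : R).
Hypotheses (mu : measurable_fun setT upsilon) (upsilon_gt0 : forall u, 0 < upsilon u)
  (upsilon_le : forall u, upsilon u <= M).
Hypothesis upsilon_vanish : forall e : R, 0 < e ->
    exists M, forall u, M <= enorm u -> upsilon u <= e.
Hypothesis upsilon_compact : forall K : set 'rV[R]_p, compact K ->
    (0 < ereal_inf [set (upsilon y)%:E | y in K])%E.
Variable F : 'rV[R]_N -> R.
Local Notation leb := (lebesgue_rV R N).
Hypotheses (iF : leb.-integrable setT (EFin \o F)) (F0 : forall v, 0 <= F v)
  (q_le : forall x v, q x v <= F v).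
Variable y : nat -> 'rV[R]_p.
Local Notation mass := (mass f q h upsilon y).
Local Notation C r k := (doeblin_set h (y k) r).
Local Notation phi nu n A :=
  (filter_dist (transition f q) (likelihood h upsilon) nu n y A).
Implicit Types nu : probability 'rV[R]_N R.

Hypothesis doeblin_lower : forall r : R, 0 < r -> exists W c n0,
  [/\ forall i, 0 <= W i,
      forall k x u, C r k x -> C r k.+1 u -> expR (- W k.+1) <= q x (u - f x) &
      forall n, (n0 <= n)%N -> \sum_(i < n) W i.+1 <= c * n%:R].

Let M_gt0 : 0 < M. Proof. exact: lt_le_trans (upsilon_gt0 0) (upsilon_le 0). Qed.

(** On the Doeblin set y - h x lies in a cube, on which upsilon is bounded below. *)
Lemma lik_lower_doeblin (r : R) : 0 < r ->
  exists2 gm, 0 < gm & forall k x, C r k x -> gm <= likelihood h upsilon x (y k).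
Proof.
move=> r0; have := upsilon_compact (@compact_cube R p r).
set I := ereal_inf _ => I0.
exists (fine (mine I 1%E)).
  rewrite fine_gt0// lt_min I0 lte01/= gt_min ltry orbT//.
move=> k x xC; rewrite -lee_fin fineK; last first.
  by rewrite ge0_fin_numE ?gt_min ?ltry ?orbT// le_min ltW//= lee01.
apply: (@le_trans _ _ I); first by rewrite ge_min lexx.
apply: ereal_inf_lbound; exists (y k - h x) => //= i.
rewrite in_itv/= -ler_norml; apply: le_trans (coord_le_enorm _ _) _.
by rewrite enormB.
Qed.

(** The rate s depends on the radius but not on the initial law, so that the penalty
    can be chosen from s alone. *)
Lemma mass_exponential (r : R) : 0 < r -> exists s n0, [/\ 0 < s, s <= 1 &
  forall nu, (0 < \int[nu]_x transition f q x (C r 1%N))%E ->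
  exists2 c, 0 < c & forall n, (n0 <= n)%N -> c * s ^+ n <= mass nu n setT].
Proof.
move=> r0.
have [gm gm0 lik_lower] := lik_lower_doeblin r0.
have [v v0 Cbox] := doeblin_set_box h_ucont h_surj r0.
have [W [c [n0 [W0 Wq Wsum]]]] := doeblin_lower r0.
pose a := Num.min 1 (v * gm).
have a0 : 0 < a by rewrite lt_min ltr01 mulr_gt0.
have a1 : a <= 1 by rewrite ge_min lexx.
pose s := expR (- `|c|) * a.
exists s, (maxn n0 1); split.
- by rewrite mulr_gt0// expR_gt0.
- by rewrite mulr_ile1// ?expR_ge0 ?ltW// -expR0 ler_expR oppr_le0.
move=> nu nuC.
have [d d0 H] := mass_lower mf q_kernel mh mu upsilon_gt0 upsilon_le
  (C := fun k => C r k) (l := fun k => expR (- W k)) gm0 v0 (fun k => expR_ge0 _)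
  lik_lower Wq (fun k => Cbox (y k)) (fun k => measurable_doeblin_set mh (y k) r) nuC.
exists d => // -[|n]; first by rewrite geq_max ltn0 andbF.
rewrite geq_max => /andP[n0n _]; apply: le_trans (H n).
rewrite ler_pM2l// exprMn.
have -> : \prod_(i < n) (expR (- W i.+2) * v * gm) =
    expR (- \sum_(i < n) W i.+2) * (v * gm) ^+ n.
  under eq_bigr do rewrite -mulrA.
  by rewrite big_split/= prodr_const card_ord -expR_sum -sumrN.
apply: ler_pM; [exact/exprn_ge0/expR_ge0|exact/exprn_ge0/ltW| |].
  rewrite -expRM_natl ler_expR mulrN lerN2.
  apply: (@le_trans _ _ (\sum_(i < n.+1) W i.+1)).
    by rewrite big_ord_recl lerDr W0.
  by apply: le_trans (Wsum _ n0n) _; rewrite mulrC ler_wpM2l// ler_norm.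
rewrite exprS; apply: (@le_trans _ _ (a ^+ n)).
  by rewrite ler_piMl// exprn_ge0// ltW.
apply: lerXn2r; rewrite ?nnegrE; first exact: ltW.
  by rewrite ltW// mulr_gt0.
by rewrite ge_min lexx orbT.
Qed.

(** Order of the choices: the radius r gives the rate s of the masses; s gives the
    penalty theta; theta gives a second radius D, outside which the likelihood is
    small, and the level K; D gives the bound B such that at least half of the steps
    have a density at least expR (- B). *)
Lemma filter_gap_decay (r : R) : 0 < r -> forall nu nu',
  (0 < \int[nu]_x transition f q x (C r 1%N))%E ->
  (0 < \int[nu']_x transition f q x (C r 1%N))%E ->
  exists G rho n0, [/\ 0 < G, 0 < rho, rho < 1 &
    forall n, (n0 <= n)%N -> [/\ 0 < mass nu n setT, 0 < mass nu' n setT &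
      forall A, measurable A -> mass nu n A / mass nu n setT -
        mass nu' n A / mass nu' n setT <= G * rho ^+ (n %/ 4)]].
Proof.
move=> r0 nu nu' nuC nuC'.
have [s [n1 [s0 s1 mass_s]]] := mass_exponential r0.
have [c1 c10 H1] := mass_s nu nuC; have [c2 c20 H2] := mass_s nu' nuC'.
(* Lam is the growth per step of the error term relative to the two masses *)
pose A1 := M + 1; pose Lam := (A1 / s) ^+ 2.
have A11 : 1 <= A1 by rewrite /A1 lerDr ltW.
have Lam1 : 1 <= Lam.
  by rewrite exprn_ege1// ler_pdivlMr// mul1r (le_trans s1).
pose theta := (2 * Lam) ^+ 4.
have th1 : 1 <= theta by rewrite exprn_ege1//; lra.
have th0 : 0 < theta := lt_le_trans ltr01 th1.
have t20 : 0 < theta ^+ 2 by rewrite exprn_gt0.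
pose eta := (2 * theta ^+ 2)^-1.
have eta0 : 0 < eta by rewrite invr_gt0 mulr_gt0.
have [D0 upsD] := upsilon_vanish eta0.
pose D := Num.max D0 1.
have Dgt0 : 0 < D by rewrite lt_max ltr01 orbT.
have upsD' u : D < enorm u -> upsilon u <= eta.
  by move=> /ltW Du; apply: upsD; apply: le_trans Du; rewrite le_max lexx.
pose e := (2 * theta ^+ 2 * M)^-1.
have e0 : 0 < e by rewrite invr_gt0; apply: mulr_gt0 => //; exact: mulr_gt0.
have [K K1 tailK] := integral_tail_small iF F0 e0.
have mF : measurable_fun setT F by apply/measurable_EFinP; exact: measurable_int iF.
have mD : measurable [set v | K < F v].
  rewrite (_ : mkset _ = F @^-1` `]K, +oo[%classic); last first.
    by apply/seteqP; split => x; rewrite /= in_itv/= andbT.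
  by rewrite -[X in measurable X]setTI; apply: mF.
have mC k : measurable (C D k) by exact: measurable_doeblin_set.
have half_inv (z : R) : 0 < z -> z * (2 * z)^-1 = 2^-1.
  by move=> z0; field; rewrite gt_eqF.
have stepA1 k x : trans_op f q (step_weight f h upsilon y (fun k => C D k)
    [set v | K < F v] theta k.+1 x) x <= A1.
  apply: le_trans (trans_step_le mf q_kernel mh mu upsilon_gt0 upsilon_le y k.+1 x mF F0 q_le
    tailK upsD' th1 (ltW eta0) mD) _.
  rewrite /A1 -addrA lerD2l.
  have -> : theta ^+ 2 * eta = 2^-1.
    exact: half_inv.
  have -> : theta ^+ 2 * M * e = 2^-1.
    by rewrite /e -[2 * _ * M]mulrA half_inv// mulr_gt0.
  lra.
have [W [c [n2 [W0 Wq Wsum]]]] := doeblin_lower Dgt0.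
pose B := 2 * Num.max c 1.
have B0 : 0 < B by rewrite mulr_gt0// lt_max ltr01 orbT.
pose S i := W i <= B.
have eK : expR (- B) <= K.
  by apply: le_trans K1; rewrite -expR0 ler_expR oppr_le0 ltW.
have q_leK x v : ~ [set v | K < F v] v -> q x v <= K.
  by move=> /negP; rewrite -leNgt; exact: le_trans.
have q_geS k x u : S k.+1 -> C D k x -> C D k.+1 u -> expR (- B) <= q x (u - f x).
  move=> Sk Cx Cu; apply: le_trans (Wq k x u Cx Cu).
  by rewrite ler_expR lerN2.
have A1M : M <= A1 by rewrite lerDl.
have contr n m A x x' :=
  @pair_contraction R N p f q h mf q_kernel mh upsilon M mu upsilon_gt0
  upsilon_le y (fun k => C D k) [set v | K < F v] S theta (expR (- B)) K A1 mC mD th1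
  (expR_gt0 _) eK q_leK q_geS A1M stepA1 n 0%N m A x x'.
have bw := out_weight_bounded mh mu upsilon_gt0 upsilon_le y mC th1 0%N.
set w := out_weight _ _ _ _ _ _ in bw.
pose rh := rho (expR (- B)) K.
have K0 : 0 < K := lt_le_trans ltr01 K1.
have rh1 : rh < 1 by rewrite /rh /rho ltrBlDr ltrDl exprn_gt0// divr_gt0// expR_gt0.
have rh0 : 0 <= rh.
  rewrite /rh /rho subr_ge0 expr_le1 ?divr_ge0 ?expR_ge0 ?(ltW K0)//.
  by rewrite ler_pdivrMr// mul1r.
pose ro := Num.max rh 2^-1.
have ro0 : 0 < ro by rewrite lt_max invr_gt0 ltr0n orbT.
exists (1 + (M * theta) ^+ 2 / (c1 * c2) * Lam ^+ 3), ro, (maxn n1 n2).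
have cc0 : 0 < c1 * c2 by rewrite mulr_gt0.
have G0 : 0 <= (M * theta) ^+ 2 / (c1 * c2).
  by rewrite divr_ge0 ?sqr_ge0// ltW.
have Lam0 : 0 < Lam := lt_le_trans ltr01 Lam1.
split => //.
- rewrite (lt_le_trans ltr01)// lerDl mulr_ge0// exprn_ge0// ltW//.
- by rewrite gt_max rh1/= invf_lt1// ltr1n.
move=> n; rewrite geq_max => /andP[n1n n2n].
have sn0 : 0 < s ^+ n by rewrite exprn_gt0.
have m1_ge := H1 n n1n; have m2_ge := H2 n n1n.
set m1 := mass nu n setT in m1_ge *; set m2 := mass nu' n setT in m2_ge *.
have m10 : 0 < m1 by rewrite (lt_le_trans _ m1_ge)// mulr_gt0.
have m20 : 0 < m2 by rewrite (lt_le_trans _ m2_ge)// mulr_gt0.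
split=> // A mA; set m := (n %/ 4)%N.
pose t := theta ^- m * A1 ^+ (2 * n).
have t0 : 0 <= t.
  apply: mulr_ge0; last exact: exprn_ge0 (le_trans ler01 A11).
  by rewrite invr_ge0; exact: exprn_ge0 (ltW th0).
have gap : mass nu n A * m2 <= m1 * mass nu' n A +
    rh ^+ (good_count S n 0 - m) * (m1 * m2) + t * (M * theta) ^+ 2.
  apply: (mass_gap mf q_kernel mh mu upsilon_gt0 upsilon_le nu nu' mA bw t0) => x x'.
  apply: le_trans (contr n m A x x' mA) _; rewrite lerD2l /t.
  by rewrite [_ * A1 ^+ _]mulrC mulrA.
have cnt : (m <= good_count S n 0 - m)%N.
  have := @good_count_ge R W B n 0%N B0 W0.
  have c1B : \sum_(i < n) W (0 + i.+1)%N <= B * n%:R / 2.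
    apply: le_trans (Wsum n n2n) _; rewrite /B mulrAC [2 * _]mulrC mulfK//.
    by rewrite ler_wpM2r// le_max lexx.
  move=> Bn; have : n%:R <= (2 * good_count S n 0)%:R :> R.
    rewrite natrM -(ler_pM2l B0).
    move: Bn; rewrite -/(S); set gc := (good_count _ _ _)%:R => Bn.
    have -> : B * (2%:R * gc) = 2 * (B * gc) by rewrite mulrCA.
    by move: (B * gc) (B * n%:R) Bn c1B; move: (\sum_(i < n) _) => *; lra.
  by rewrite ler_nat; exact: quarter_le.
have rro : rh <= ro by rewrite le_max lexx.
have hro : 2^-1 <= ro by rewrite /ro maxC le_max lexx.
move: (good_count S n 0 - m)%N cnt gap => gcm cnt gap.
have roP : rh ^+ gcm <= ro ^+ m.
  apply: (@le_trans _ _ (rh ^+ m)); first exact: (ler_wiXn2l rh0 (ltW rh1) cnt).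
  by apply: lerXn2r => //; rewrite nnegrE ltW.
have tP : t / (m1 * m2) <= Lam ^+ 3 * ro ^+ m / (c1 * c2).
  have mm : c1 * c2 * (s ^+ n) ^+ 2 <= m1 * m2.
    by rewrite expr2 mulrACA; apply: ler_pM => //; rewrite mulr_ge0 ?(ltW sn0) ?ltW.
  rewrite ler_pdivrMr ?mulr_gt0//.
  apply: (@le_trans _ _ (Lam ^+ 3 * ro ^+ m / (c1 * c2) * (c1 * c2 * (s ^+ n) ^+ 2))); last first.
    by rewrite ler_wpM2l// divr_ge0 ?(ltW cc0)// mulr_ge0// exprn_ge0 ?ltW.
  rewrite mulrA divfK ?gt_eqF//.
  have -> : t = theta ^- m * Lam ^+ n * (s ^+ n) ^+ 2.
    rewrite /t /Lam -[RHS]mulrA; congr (_ * _).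
    by rewrite exprM [(s ^+ n) ^+ 2]exprAC -!exprMn divfK ?gt_eqF.
  apply: ler_wpM2r; first exact: sqr_ge0.
  apply: le_trans (power_budget n Lam1) _.
  apply: ler_wpM2l; first by rewrite exprn_ge0 ?ltW.
  by apply: lerXn2r => //; rewrite nnegrE ?invr_ge0 ?ler0n// ltW.
rewrite lerBlDr.
(* divide the gap by the two masses *)
have key : mass nu n A / m1 <= mass nu' n A / m2 + rh ^+ gcm +
    (M * theta) ^+ 2 * (t / (m1 * m2)).
  rewrite ler_pdivrMr// -(ler_pM2r m20).
  apply: le_trans gap _; rewrite le_eqVlt; apply/orP; left; apply/eqP.
  move: (mass nu n A) (mass nu' n A) (rh ^+ _) => a1 a2 a3.
  clearbody m1 m2 t; field.
  by rewrite !gt_eqF.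
apply: le_trans key _.
rewrite mulrDl mul1r -addrA addrC lerD2r; apply: lerD => //.
rewrite -[leRHS]mulrA -[leRHS]mulrA; apply: ler_wpM2l; first exact: sqr_ge0.
by apply: le_trans tP _; rewrite [leRHS]mulrC.
Qed.

(** filter_gap_decay bounds the difference of the filters from above on every set;
    exchanging nu and nu' bounds it from below. *)
Lemma filter_forgetting (r : R) : 0 < r -> forall nu nu',
  (0 < \int[nu]_x transition f q x (C r 1%N))%E ->
  (0 < \int[nu']_x transition f q x (C r 1%N))%E ->
  (limn_esup (fun n => n%:R^-1%:E *
     lne (tv_norm (fun A => phi nu n A - phi nu' n A))) < 0)%E.
Proof.
move=> r0 nu nu' nuC nuC'.
have [G1 [ro1 [n1 [G10 ro10 ro11 H1]]]] := filter_gap_decay r0 nuC nuC'.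
have [G2 [ro2 [n2 [G20 ro20 ro21 H2]]]] := filter_gap_decay r0 nuC' nuC.
pose ro := Num.max ro1 ro2; pose G := G1 + G2.
have ro0 : 0 < ro by rewrite lt_max ro10.
have ro1' : ro < 1 by rewrite gt_max ro11.
have G0 : 0 < G by rewrite addr_gt0.
apply: (@geometric_limsup_lt0 R _ (2 * G) ro (maxn n1 n2)) => //.
  by rewrite mulr_gt0.
move=> n; rewrite geq_max => /andP[/H1[m1 m2 D1] /H2[_ _ D2]].
rewrite -mulrA.
pose x A := mass nu n A / mass nu n setT - mass nu' n A / mass nu' n setT.
have pw1 (z : R) Gi : 0 < z -> z <= ro -> 0 < Gi -> Gi <= G ->
    Gi * z ^+ (n %/ 4) <= G * ro ^+ (n %/ 4).
  move=> z0 zr Gi0 GiG; apply: ler_pM => //; [exact: ltW|exact/exprn_ge0/ltW|].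
  by apply: lerXn2r => //; rewrite nnegrE ltW.
apply: (@tv_norm_le _ _ _ _ x).
- move=> A mA.
  rewrite (filter_distE mf q_kernel mh mu upsilon_gt0 upsilon_le mA m1).
  by rewrite (filter_distE mf q_kernel mh mu upsilon_gt0 upsilon_le mA m2).
- move=> A mA; rewrite ler_norml lerNl /x opprB; apply/andP; split.
    apply: le_trans (D2 A mA) _; apply: pw1 => //.
      by rewrite le_max lexx orbT.
    by rewrite lerDr ltW.
  apply: le_trans (D1 A mA) _; apply: pw1 => //.
    by rewrite le_max lexx.
  by rewrite lerDl ltW.
- move=> A A' mA mA' AA'; rewrite /x.
  rewrite (massU mf q_kernel mh mu upsilon_gt0 upsilon_le y nu n mA mA' AA').
  rewrite (massU mf q_kernel mh mu upsilon_gt0 upsilon_le y nu' n mA mA' AA').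
  by rewrite !mulrDl opprD addrACA.
Qed.

End forgetting.

(** * Exponential deviations of discrete adapted sequences *)

(** Conditioning on a discrete variable X amounts to integrating over its fibres,
    which avoids conditional expectations altogether. *)
Section countable_fibers.
Context d (T : measurableType d) (R : realType) (P : {measure set T -> \bar R}).
Local Open Scope ereal_scope.

Lemma measurable_preimage_count (S : countType) (X : T -> S) (B : set S) :
  (forall s, measurable (X @^-1` [set s])) -> measurable (X @^-1` B).
Proof.
move=> mX; have -> : X @^-1` B = \bigcup_(s in B) (X @^-1` [set s]).
  by apply/seteqP; split => [w Bw|w [s Bs /= ws]]; [exists (X w)|rewrite /preimage /= ws].
rewrite bigcup_mkcond; apply: countable_bigcupT_measurable; first exact: countableP.
by move=> s; case: ifPn.
Qed.

Lemma measurable_const_on_fibers (S : countType) (X : T -> S) d' (T' : measurableType d')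
    (f : T -> T') :
  (forall s, measurable (X @^-1` [set s])) ->
  (forall w w', X w = X w' -> f w = f w') -> measurable_fun setT f.
Proof.
move=> mX fX _ B mB; rewrite setTI.
have -> : f @^-1` B = X @^-1` (X @` (f @^-1` B)).
  apply/seteqP; split => [w Bw|w [w' Bw' /fX e]]; first by exists w.
  by rewrite /preimage /= -e.
exact: measurable_preimage_count.
Qed.

Variables (S : countType) (X : T -> S).
Hypothesis mX : forall s, measurable (X @^-1` [set s]).

Lemma integral_fibers (D : set T) (f : T -> \bar R) : measurable D ->
  measurable_fun setT f -> (forall w, 0 <= f w) ->
  \int[P]_(w in D) f w =
  \sum_(n <oo) \int[P]_(w in D `&` X @^-1` [set s | pickle s = n]) f w.
Proof.
move=> mD mf f0.
have mDn n : measurable (D `&` X @^-1` [set s | pickle s = n]).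
  by apply: measurableI => //; exact: measurable_preimage_count.
rewrite -ge0_integral_bigcup//.
- congr (integral _ _ _); apply/seteqP; split => [w Dw|w [n _ []]//].
  by exists (pickle (X w)).
- exact: measurable_funTS.
- by move=> i j _ _ [w [[_ /= <-] [_ /= <-]]].
Qed.

Lemma pickle_fiber n : (exists s0, [set s : S | pickle s = n] = [set s0]) \/
  [set s : S | pickle s = n] = set0.
Proof.
have [[s sn]|no] := pselect (exists s : S, pickle s = n); [left|right].
  exists s; apply/seteqP; split => [t /= tn|t /= ->//].
  by apply: (pcan_inj (@pickleK S)); rewrite tn.
by apply/seteqP; split => // s sn; apply: no; exists s.
Qed.

Lemma le_integral_fibers (D : set T) (f g : T -> \bar R) : measurable D ->
  measurable_fun setT f -> (forall w, 0 <= f w) ->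
  measurable_fun setT g -> (forall w, 0 <= g w) ->
  (forall s, \int[P]_(w in D `&` X @^-1` [set s]) f w <=
             \int[P]_(w in D `&` X @^-1` [set s]) g w) ->
  \int[P]_(w in D) f w <= \int[P]_(w in D) g w.
Proof.
move=> mD mf f0 mg g0 fg; rewrite !integral_fibers//.
apply: lee_nneseries => [n _ _|n _]; first exact: integral_ge0.
have [[s ->]|->] := pickle_fiber n; first exact: fg.
by rewrite preimage_set0 setI0 !integral_set0.
Qed.

Lemma integral_cst_fiber (D : set T) (phi : S -> R) s : measurable D ->
  \int[P]_(w in D `&` X @^-1` [set s]) (phi (X w))%:E =
  (phi s)%:E * P (D `&` X @^-1` [set s]).
Proof.
move=> mD; rewrite -integral_cst//; last exact: measurableI.
by apply: eq_integral => w; rewrite inE => -[_ /= ->].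
Qed.

Lemma measurable_comp_fibers (phi : S -> R) :
  measurable_fun setT (fun w => (phi (X w))%:E).
Proof. by apply: (@measurable_const_on_fibers _ X) => // w w' ->. Qed.

End countable_fibers.

(** A comparison of two sub-probability laws on a countable set, atom by atom,
    carries over to the integrals of nonnegative functions. *)
Lemma le_integral_law d (T : measurableType d) (R : realType)
    (P : {measure set T -> \bar R}) (S : countType) (X Y : T -> S)
    (D E : set T) (phi : S -> R) (a b : R) :
  (forall s, measurable (X @^-1` [set s])) -> (forall s, measurable (Y @^-1` [set s])) ->
  measurable D -> measurable E -> (forall s, 0 <= phi s) -> 0 <= a -> 0 <= b ->
  (forall s, a%:E * P (D `&` X @^-1` [set s]) <= b%:E * P (E `&` Y @^-1` [set s]))%E ->
  (a%:E * \int[P]_(w in D) (phi (X w))%:E <= b%:E * \int[P]_(w in E) (phi (Y w))%:E)%E.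
Proof.
move=> mX mY mD mE phi0 a0 b0 H.
have phiX w : (0 <= (phi (X w))%:E)%E by rewrite lee_fin.
have phiY w : (0 <= (phi (Y w))%:E)%E by rewrite lee_fin.
rewrite (integral_fibers P mX mD (measurable_comp_fibers mX phi) phiX).
rewrite (integral_fibers P mY mE (measurable_comp_fibers mY phi) phiY).
rewrite -!nneseriesZl; last 2 first.
- by move=> n _; exact: integral_ge0.
- by move=> n _; exact: integral_ge0.
apply: lee_nneseries => [n _ _|n _].
  by rewrite mule_ge0 ?lee_fin// integral_ge0.
have [[s ->]|->] := pickle_fiber S n; last first.
  by rewrite !preimage_set0 !setI0 !integral_set0 !mule0.
rewrite !integral_cst_fiber// muleCA [leRHS]muleCA.
by apply: lee_wpmul2l; [rewrite lee_fin|exact: H].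
Qed.

(** h k generates the past at time k: it determines U j for j < k and c j for j <=
    k, and the mean of U k given h k is at most c k. *)
Section exponential_supermartingale.
Context d (T : measurableType d) (R : realType) (P : probability T R).
Variables (S : countType) (h : nat -> T -> S) (U c : nat -> T -> R).
Hypothesis mh : forall k s, measurable (h k @^-1` [set s]).
Hypothesis mU : forall k, measurable_fun setT (U k).
Hypotheses (U0 : forall k w, 0 <= U k w) (U1 : forall k w, U k w <= 1)
  (c0 : forall k w, 0 <= c k w).
Hypothesis hU : forall j k w w', (j < k)%N -> h k w = h k w' -> U j w = U j w'.
Hypothesis hc : forall j k w w', (j <= k)%N -> h k w = h k w' -> c j w = c j w'.
Hypothesis cond_le : forall k s,
  (\int[P]_(w in h k @^-1` [set s]) (U k w)%:E <=
   \int[P]_(w in h k @^-1` [set s]) (c k w)%:E)%E.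

Let Z n w : R := \sum_(k < n) (U k w / 2 - c k w).

Let mc k : measurable_fun setT (c k).
Proof. by apply: (measurable_const_on_fibers (X := h k)) => // w w'; exact: hc. Qed.

Let mZ n : measurable_fun setT (fun w => expR (Z n w)).
Proof.
apply: measurableT_comp => //; apply: measurable_sum => k.
by apply: measurable_funB => //; apply: measurable_funM.
Qed.

Let expR_half (x : R) : 0 <= x -> x <= 1 -> expR (x / 2) <= 1 + x.
Proof.
move=> x0 x1; have := expR_ge1Dx (- (x / 2)).
rewrite expRN => H.
have e0 := expR_gt0 (x / 2).
have : 1 - x / 2 <= (expR (x / 2))^-1 by [].
rewrite -(ler_pM2r e0) mulVf ?gt_eqF// => H1.
have p : 0 < 1 - x / 2 by lra.
rewrite -(ler_pM2l p); apply: le_trans H1 _; nra.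
Qed.

(** Given the past, the mean of exp (U / 2) is at most 1 + c, hence at most exp c. *)
Lemma exp_supermartingale n : (\int[P]_w (expR (Z n w))%:E <= 1)%E.
Proof.
elim: n => [|n ih].
  rewrite /Z; under eq_integral do rewrite big_ord0 expR0.
  rewrite integral_cst// mul1e le_eqVlt; apply/orP; left; apply/eqP.
  exact: probability_setT.
apply: le_trans ih.
apply: (le_integral_fibers (X := h n)) => //.
- by apply/measurable_EFinP; exact: mZ.
- by apply/measurable_EFinP; exact: mZ.
move=> s; rewrite setTI; set D := h n @^-1` [set s].
have mD : measurable D by exact: mh.
have [[w0 w0s]|no] := pselect (exists w0, h n w0 = s); last first.
  by rewrite (_ : D = set0) ?integral_set0//; apply/seteqP; split => // w ws; apply: no; exists w.
have ZE w : D w -> Z n w = Z n w0.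
  move=> ws; apply: eq_bigr => k _; have kn := ltn_ord k.
  have e : h n w = h n w0 by rewrite w0s.
  by rewrite (hU kn e) (hc (ltnW kn) e).
have cE w : D w -> c n w = c n w0.
  by move=> ws; apply: (@hc n n) => //; rewrite w0s.
set z := expR (Z n w0); have z0 : 0 < z by exact: expR_gt0.
set cc := c n w0.
have -> : (\int[P]_(w in D) (expR (Z n w))%:E = z%:E * P D)%E.
  by rewrite -integral_cst//; apply: eq_integral => w; rewrite inE => Dw; rewrite ZE.
have condD : (\int[P]_(w in D) (U n w)%:E <= cc%:E * P D)%E.
  apply: le_trans (cond_le n s) _; rewrite -integral_cst//.
  by rewrite le_eqVlt; apply/orP; left; apply/eqP; apply: eq_integral => w; rewrite inE => Dw; rewrite cE.
have mUD : measurable_fun D (EFin \o U n) by apply: measurable_funTS; exact/measurable_EFinP.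
apply: (@le_trans _ _ (\int[P]_(w in D) ((z * expR (- cc))%:E * (1 + (U n w)%:E)))%E).
  apply: ge0_le_integral => //.
  - by apply: measurable_funTS; apply/measurable_EFinP; exact: mZ.
  - by apply: measurable_funeM; apply: emeasurable_funD.
  move=> w Dw; rewrite -EFinD -EFinM lee_fin /Z big_ord_recr/= -/(Z n w) ZE//.
  rewrite expRD -/z -mulrA ler_pM2l// addrC expRD cE// -/cc ler_pM2l ?expR_gt0//.
  exact: expR_half.
rewrite ge0_integralZl//; last 3 first.
- by apply: emeasurable_funD.
- by move=> w _; rewrite -EFinD lee_fin addr_ge0.
- by rewrite lee_fin mulr_ge0 ?expR_ge0// ltW.
rewrite ge0_integralD//; last by move=> w _; rewrite lee_fin.
rewrite integral_cst// mul1e.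
have PD : P D \is a fin_num by exact: fin_num_measure.
rewrite -(fineK PD) in condD *.
apply: (@le_trans _ _ ((z * expR (- cc))%:E * ((fine (P D))%:E + cc%:E * (fine (P D))%:E))%E).
  apply: lee_wpmul2l; first by rewrite lee_fin mulr_ge0 ?expR_ge0 ?ltW.
  by apply: leeD => //; rewrite le_eqVlt; apply/orP; left; apply/eqP/esym/fineK.
set pp := fine (P D).
rewrite -[leLHS]/((z * expR (- cc) * (pp + cc * pp))%:E) -[leRHS]/((z * pp)%:E).
rewrite lee_fin -mulrA ler_pM2l// -[X in X + _]mul1r -mulrDl mulrA.
rewrite ler_piMl ?fine_ge0// expRN mulrC ler_pdivrMr ?expR_gt0// mul1r.
exact: expR_ge1Dx.
Qed.

(** Markov's inequality for the exponential supermartingale. *)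
Lemma exp_deviation n t :
  (P [set w | (t * 2 + 2 * \sum_(k < n) c k w <= \sum_(k < n) U k w)%R] <= (expR (- t))%:E)%E.
Proof.
have -> : [set w | t * 2 + 2 * \sum_(k < n) c k w <= \sum_(k < n) U k w] =
          [set w | (expR t <= `|expR (Z n w)|)].
  apply/seteqP; split => w /=; rewrite ger0_norm ?expR_ge0// ler_expR /Z sumrB -mulr_suml;
  lra.
have := @le_integral_abse _ _ _ P setT measurableT (fun w => (expR (Z n w))%:E) (expR t).
rewrite setTI => /(_ _ (expR_gt0 _)) H.
rewrite -(@lee_pmul2l _ (expR t)%:E)// -?EFinM; last by rewrite lte_fin expR_gt0.
rewrite expRN mulfV ?gt_eqF ?expR_gt0//.
apply: le_trans (H _) _; first by apply/measurable_EFinP; exact: mZ.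
under eq_integral do rewrite gee0_abs ?lee_fin ?expR_ge0//.
exact: exp_supermartingale.
Qed.

End exponential_supermartingale.

(** * Bounded averages under an L log L moment *)

Section dyadic_tail.
Variable R : realType.

(** Truncation level for the first 2 ^+ m.+1 costs: small enough for a deviation of
    m + 1 units to stay of order 2 ^+ m, large enough for the values above it to be
    summable under an L log L moment. *)
Definition cutoff (m : nat) : R := 2 ^+ m / m.+1%:R.

Lemma cutoff_gt0 m : 0 < cutoff m. Proof. by rewrite divr_gt0 ?exprn_gt0. Qed.

Lemma expR_half_le2 : expR (2^-1) <= 2 :> R.
Proof.
have := expR_ge1Dx (- 2^-1 : R); rewrite expRN.
have e0 := expR_gt0 (2^-1 : R).
rewrite -(ler_pM2r e0) mulVf ?gt_eqF// => H; lra.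
Qed.

(** A value above the cutoff satisfies m + 1 = O(log x). *)
Lemma cutoff_index_le m (x : R) : cutoff m < x -> m.+1%:R <= 12 + 4 * Num.max (ln x) 0.
Proof.
move=> cx; have x0 : 0 < x := lt_trans (cutoff_gt0 m) cx.
set a : R := m.+1%:R / 4.
have a0 : 0 < a by rewrite divr_gt0.
have e8 : expR a <= 8 * x.
  have h1 : m.+1%:R <= 4 * expR a.
    have := expR_ge1Dx a; rewrite /a; set b := m.+1%:R; lra.
  have h2 : expR a * expR a <= 2 ^+ m.+1.
    rewrite -expRD (_ : a + a = m.+1%:R * 2^-1); last by rewrite /a; field.
    by rewrite expRM_natl lerXn2r ?nnegrE ?expR_ge0// expR_half_le2.
  have h3 : 2 ^+ m < m.+1%:R * x.
    by move: cx; rewrite /cutoff ltr_pdivrMr ?ltr0n// mulrC.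
  have e0 := expR_gt0 a.
  rewrite -(ler_pM2l e0); apply: le_trans h2 _; rewrite exprS.
  have : m.+1%:R * x <= 4 * expR a * x by rewrite ler_pM2r.
  move: (expR a) h3 => b; lra.
have l8 : a <= 3 + ln x.
  rewrite -ler_expR; apply: le_trans e8 _; rewrite expRD lnK ?posrE//.
  rewrite ler_pM2r//.
  have h := expR_ge1Dx (1 : R).
  have -> : expR 3 = expR 1 ^+ 3 :> R by rewrite -expRM_natl mulr1.
  have -> : 8 = 2 ^+ 3 :> R by ring.
  by rewrite lerXn2r ?nnegrE ?expR_ge0//; lra.
have : ln x <= Num.max (ln x) 0 by rewrite le_max lexx.
rewrite /a in l8; move: (Num.max _ _) => y; lra.
Qed.

Lemma le_llogl (x : R) : 0 <= x -> x <= 4 + x * Num.max (ln x) 0.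
Proof.
move=> x0; have [x4|x4] := leP x 4.
  by rewrite ler_wpDr// mulr_ge0// le_max lexx orbT.
have : 1 <= ln x.
  rewrite -ler_expR lnK ?posrE; last by lra.
  apply: le_trans (ltW x4).
  rewrite (_ : 1 = 2^-1 + 2^-1 :> R); last by field.
  rewrite expRD; have := expR_half_le2; have := expR_gt0 (2^-1 : R); nra.
move=> l1; have : 1 <= Num.max (ln x) 0 by rewrite le_max l1.
move: (Num.max _ _) => y y1; nra.
Qed.

(** The sum is geometric, so its largest term decides: 2 ^+ m < x * m.+1 = O(x log
    x) for the last m with cutoff m < x. *)
Lemma dyadic_tail_sum_le M (x : R) : 0 <= x ->
  \sum_(m < M) 2 ^+ m * (cutoff m < x)%R%:R <= 96 + 32 * (x * Num.max (ln x) 0).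
Proof.
move=> x0; have key n : \sum_(m < n) 2 ^+ m <= 2 ^+ n :> R.
  elim: n => [|n ih]; first by rewrite big_ord0.
  by rewrite big_ord_recr/= exprS; lra.
have y0 : 0 <= x * Num.max (ln x) 0 by rewrite mulr_ge0// le_max lexx orbT.
have xl := le_llogl x0.
elim: M => [|M ih]; first by rewrite big_ord0; lra.
rewrite big_ord_recr/=; have [cx|] := boolP (cutoff M < x); last first.
  by rewrite mulr0 addr0.
rewrite mulr1 -[X in _ + X]mulr1.
apply: (@le_trans _ _ (2 ^+ M.+1)).
  apply: le_trans (key M.+1); rewrite big_ord_recr/= mulr1 lerD2r.
  by apply: ler_sum => i _; rewrite ler_piMr ?exprn_ge0//; case: (_ < _).
have := cutoff_index_le cx; move: cx; rewrite /cutoff ltr_pdivrMr ?ltr0n// => cx H.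
rewrite exprS.
have : x * M.+1%:R <= x * (12 + 4 * Num.max (ln x) 0) by rewrite ler_wpM2l.
move: (Num.max _ _) y0 xl => y; lra.
Qed.

End dyadic_tail.

Lemma measurable_map_fiber d (T : measurableType d) (f : nat -> T -> nat) (l : seq nat) s :
  (forall i j, i \in l -> measurable (f i @^-1` [set j])) ->
  measurable ((fun x => [seq f i x | i <- l]) @^-1` [set s]).
Proof.
elim: l s => [|i l ih] [|a s] mf.
- by rewrite (_ : _ @^-1` _ = setT)//; apply/seteqP; split.
- by rewrite (_ : _ @^-1` _ = set0)//; apply/seteqP; split.
- by rewrite (_ : _ @^-1` _ = set0)//; apply/seteqP; split.
rewrite (_ : _ @^-1` _ = f i @^-1` [set a] `&`
    ((fun x => [seq f i x | i <- l]) @^-1` [set s])).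
  apply: measurableI; first by apply: mf; rewrite mem_head.
  by apply: ih => j b jl; apply: mf; rewrite in_cons jl orbT.
by apply/seteqP; split => x /=; [case|case=> -> ->].
Qed.

(** e and z are the integer parts of the norms of the two noises, and w their cost;
    zp is a variable independent of (e 0, e 1), whose law dominates that of z. A
    variable z k.+1 is dominated given e 0, ..., e k.+1 and z 1, ..., z k, but the
    earlier z may depend on e k.+1, which therefore cannot be averaged given the
    history: the deviations are estimated in two stages, z k.+1 given the history,
    then pairs of consecutive e. *)
Section averages.
Context d (T : measurableType d) (R : realType) (P : probability T R).
Variables (e z : nat -> T -> nat) (zp : T -> nat) (w : nat -> nat -> nat -> R) (mu : R).
Hypotheses (me : forall k i, measurable (e k @^-1` [set i]))
  (mz : forall k i, measurable (z k @^-1` [set i]))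
  (mzp : forall i, measurable (zp @^-1` [set i])).
Hypotheses (w0 : forall j j' i, 0 <= w j j' i) (mu0 : 0 <= mu).

Definition history k x : seq nat * seq nat :=
  ([seq e i x | i <- iota 0 k.+2], [seq z i x | i <- iota 1 k]).
Definition block n x : seq nat := [seq e i x | i <- iota 0 n].
Definition adjacent n x : nat * nat := (e n x, e n.+1 x).

Hypothesis z_dom : forall k s i,
  (P (history k @^-1` [set s] `&` z k.+1 @^-1` [set i]) <=
   mu%:E * P (history k @^-1` [set s]) * P (zp @^-1` [set i]))%E.
Hypothesis e_indep : forall n s t,
  (P (block n @^-1` [set s] `&` adjacent n @^-1` [set t]) =
   P (block n @^-1` [set s]) * P (adjacent 0 @^-1` [set t]))%E.
Hypothesis zp_indep : forall t i,
  (P (adjacent 0 @^-1` [set t] `&` zp @^-1` [set i]) =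
   P (adjacent 0 @^-1` [set t]) * P (zp @^-1` [set i]))%E.

Let wp x := w (e 0 x) (e 1 x) (zp x).
Let wk k x := w (e k x) (e k.+1 x) (z k.+1 x).

Let measurable_pair_fiber (S S' : countType) (X : T -> S) (Y : T -> S') :
  (forall s, measurable (X @^-1` [set s])) -> (forall s, measurable (Y @^-1` [set s])) ->
  forall s, measurable ((fun x => (X x, Y x)) @^-1` [set s]).
Proof.
move=> mX mY [s s'].
rewrite (_ : _ @^-1` _ = X @^-1` [set s] `&` Y @^-1` [set s']); first exact: measurableI.
by apply/seteqP; split => x /=; [case|case=> -> ->].
Qed.

Let m_hist k s : measurable (history k @^-1` [set s]).
Proof. by apply: measurable_pair_fiber => t; apply: measurable_map_fiber => i j _. Qed.
Let m_block n s : measurable (block n @^-1` [set s]).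
Proof. by apply: measurable_map_fiber => i j _. Qed.
Let m_adj n s : measurable (adjacent n @^-1` [set s]).
Proof. exact: measurable_pair_fiber. Qed.

Let hist_e k x x' i : history k x = history k x' -> (i < k.+2)%N -> e i x = e i x'.
Proof.
by move=> /(congr1 fst)/eq_in_map H ik; apply: H; rewrite mem_iota.
Qed.

Let hist_z k x x' i : history k x = history k x' -> (0 < i)%N -> (i <= k)%N -> z i x = z i x'.
Proof.
by move=> /(congr1 snd)/= /eq_in_map H i0 ik; apply: H; rewrite mem_iota i0.
Qed.

Let block_e n x x' i : block n x = block n x' -> (i < n)%N -> e i x = e i x'.
Proof. by move=> /eq_in_map H i_n; apply: H; rewrite mem_iota. Qed.

Let measurable_fun_triple (g : T -> R) : (forall x x', e 0 x = e 0 x' ->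
    e 1 x = e 1 x' -> zp x = zp x' -> g x = g x') -> measurable_fun setT g.
Proof.
move=> H; apply: (measurable_const_on_fibers (X := fun x => (adjacent 0 x, zp x))).
  by apply: measurable_pair_fiber => // t; exact: m_adj.
by move=> x x' -[*]; exact: H.
Qed.

Let P_fin A : measurable A -> P A \is a fin_num.
Proof. by move=> mA; exact: fin_num_measure. Qed.

Section truncated.
Variable c : R.
Hypothesis c0 : 0 < c.

(** Values above c are discarded, the others rescaled to the unit interval. *)
Definition clipped j j' i : R := (if w j j' i <= c then w j j' i else 0) / c.
Local Notation u := clipped.
Let u0 j j' i : 0 <= u j j' i.
Proof. by rewrite /clipped; case: ifP => _; rewrite divr_ge0// ltW. Qed.
Let u1 j j' i : u j j' i <= 1.
Proof. by rewrite /clipped; case: ifP => H; rewrite ler_pdivrMr// mul1r// ltW. Qed.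

Definition clipped_mean j j' : R := \int[P]_x u j j' (zp x).
Local Notation ubar := clipped_mean.

Let mfib (S : countType) (X : T -> S) (phi : S -> R) :
  (forall s, measurable (X @^-1` [set s])) -> measurable_fun setT (fun x => phi (X x)).
Proof. by move=> mX; apply: (measurable_const_on_fibers (X := X)) => // x x' ->. Qed.

Let int_bounded (f : T -> R) : measurable_fun setT f -> (forall x, 0 <= f x) ->
  (forall x, f x <= 1) -> P.-integrable setT (EFin \o f).
Proof.
move=> mf f0 f1.
apply: (@le_integrable _ _ _ P setT measurableT _ (EFin \o cst 1)) => //.
- exact/measurable_EFinP.
- by move=> x _; rewrite !abse_EFin lee_fin !ger0_norm.
- exact: finite_measure_integrable_cst.
Qed.

Let ubarE j j' : (\int[P]_x (u j j' (zp x))%:E = (ubar j j')%:E)%E.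
Proof.
rewrite /clipped_mean /Rintegral fineK//; apply: integrable_fin_num => //.
by apply: int_bounded => //; exact: mfib.
Qed.

Let ubar0 j j' : 0 <= ubar j j'. Proof. by apply: Rintegral_ge0. Qed.

Let ubar1 j j' : ubar j j' <= 1.
Proof.
rewrite -lee_fin -ubarE; apply: (@le_trans _ _ (\int[P]_x cst 1%E x)%E).
  apply: ge0_le_integral => //; first by move=> x _; rewrite lee_fin.
    by apply/measurable_EFinP; exact: mfib.
  by move=> x _; rewrite lee_fin.
by rewrite integral_cst// mul1e; apply: probability_le1.
Qed.

(** First stage: z k.+1 is averaged out given the history. *)
Lemma truncated_deviation1 n t :
  (P [set x | (t * 2 + 2 * \sum_(k < n) mu * ubar (e k x) (e k.+1 x) <=
     \sum_(k < n) u (e k x) (e k.+1 x) (z k.+1 x))%R] <= (expR (- t))%:E)%E.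
Proof.
apply: (exp_deviation (S := (seq nat * seq nat)%type) (h := history)
  (U := fun k x => u (e k x) (e k.+1 x) (z k.+1 x))
  (c := fun k x => mu * ubar (e k x) (e k.+1 x))) => //.
- move=> k; apply: (mfib (X := fun x => ((e k x, e k.+1 x), z k.+1 x))
    (fun s => u s.1.1 s.1.2 s.2)).
  by apply: measurable_pair_fiber => //; exact: m_adj.
- move=> j k x x' jk H; rewrite (hist_e H) ?(hist_e (i := j.+1) H) ?(hist_z H)//; lia.
- move=> j k x x' jk H; rewrite (hist_e H) ?(hist_e (i := j.+1) H)//; lia.
move=> k s; set D := history k @^-1` [set s].
have mD : measurable D by exact: m_hist.
have [[x0 x0D]|no] := pselect (exists x0, D x0); last first.
  by rewrite (_ : D = set0) ?integral_set0//; apply/seteqP; split => // x ws; apply: no; exists x.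
have eE x i : D x -> (i < k.+2)%N -> e i x = e i x0.
  by move=> Dx; apply: hist_e; rewrite Dx x0D.
have -> : (\int[P]_(x in D) (u (e k x) (e k.+1 x) (z k.+1 x))%:E =
   1%:E * \int[P]_(x in D) (u (e k x0) (e k.+1 x0) (z k.+1 x))%:E)%E.
  by rewrite mul1e; apply: eq_integral => x; rewrite inE => Dx; rewrite !(eE x).
have -> : (\int[P]_(x in D) (mu * ubar (e k x) (e k.+1 x))%:E =
   (mu * fine (P D))%:E * \int[P]_(x in setT) (u (e k x0) (e k.+1 x0) (zp x))%:E)%E.
  rewrite ubarE [X in (X * _)%E]EFinM fineK ?P_fin// muleAC -EFinM.
  rewrite -integral_cst//; apply: eq_integral => x; rewrite inE => Dx; rewrite !(eE x)//.
apply: le_integral_law => //; first by rewrite mulr_ge0// fine_ge0.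
move=> i; rewrite mul1e EFinM fineK ?P_fin// setTI; exact: z_dom.
Qed.

Variable mbar : R.
Hypothesis mbarP : (\int[P]_x (wp x)%:E <= mbar%:E)%E.

Let mean_ubar : (\int[P]_x (ubar (e 0 x) (e 1 x))%:E <= (mbar / c)%:E)%E.
Proof.
have m3 : forall s, measurable ((fun x => ((e 0 x, e 1 x), zp x)) @^-1` [set s]).
  by apply: measurable_pair_fiber => //; exact: m_adj.
apply: (@le_trans _ _ (\int[P]_x (u (e 0 x) (e 1 x) (zp x))%:E)%E).
  apply: (le_integral_fibers (X := adjacent 0)) => //.
  - by apply/measurable_EFinP; exact: (mfib (fun s => ubar s.1 s.2) (m_adj 0)).
  - by move=> x; rewrite lee_fin.
  - by apply/measurable_EFinP; exact: (mfib (fun s => u s.1.1 s.1.2 s.2) m3).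
  - by move=> x; rewrite lee_fin.
  move=> -[j j']; rewrite setTI; set D := adjacent 0 @^-1` _.
  have mD : measurable D by exact: m_adj.
  have -> : (\int[P]_(x in D) (ubar (e 0 x) (e 1 x))%:E =
      (fine (P D))%:E * \int[P]_(x in setT) (u j j' (zp x))%:E)%E.
    rewrite ubarE fineK ?P_fin// muleC -integral_cst//.
    by apply: eq_integral => x; rewrite inE => -[-> ->].
  have -> : (\int[P]_(x in D) (u (e 0 x) (e 1 x) (zp x))%:E =
      1%:E * \int[P]_(x in D) (u j j' (zp x))%:E)%E.
    by rewrite mul1e; apply: eq_integral => x; rewrite inE => -[-> ->].
  apply: le_integral_law => //; first exact: fine_ge0.
  move=> i; rewrite mul1e setTI fineK ?P_fin//.
  by rewrite le_eqVlt; apply/orP; left; apply/eqP; exact: esym (zp_indep (j, j') i).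
have mwp : measurable_fun setT (EFin \o wp).
  by apply/measurable_EFinP; exact: (mfib (fun s => w s.1.1 s.1.2 s.2) m3).
apply: (@le_trans _ _ ((c^-1)%:E * \int[P]_x (wp x)%:E)%E); last first.
  rewrite mulrC EFinM; apply: lee_wpmul2l => //.
  by rewrite lee_fin invr_ge0 ltW.
rewrite -ge0_integralZl//; last 2 first.
- by move=> x _; rewrite lee_fin; exact: w0.
- by rewrite lee_fin invr_ge0 ltW.
apply: ge0_le_integral => //.
- by move=> x _; rewrite lee_fin.
- by apply/measurable_EFinP; exact: (mfib (fun s => u s.1.1 s.1.2 s.2) m3).
- exact: measurable_funeM.
move=> x _; rewrite -EFinM lee_fin /clipped mulrC ler_pM2l ?invr_gt0//.
by rewrite /wp; case: ifP.
Qed.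

(** Second stage: the averaged cost depends on (e k, e k.+1), and these pairs are
    independent along the indices of a given parity b. *)
Lemma truncated_deviation2 b n t :
  (P [set x | (t * 2 + 2 * \sum_(k < n) mbar / c <=
     \sum_(k < n) ubar (e (2 * k + b)%N x) (e (2 * k + b).+1 x))%R] <= (expR (- t))%:E)%E.
Proof.
have mb0 : 0 <= mbar.
  rewrite -lee_fin; apply: le_trans mbarP; apply: integral_ge0 => x _.
  by rewrite lee_fin; exact: w0.
apply: (exp_deviation (S := seq nat) (h := fun k => block (2 * k + b))
  (U := fun k x => ubar (e (2 * k + b)%N x) (e (2 * k + b).+1 x))
  (c := fun k x => mbar / c)) => //.
- move=> k; exact: (mfib (fun s => ubar s.1 s.2) (m_adj (2 * k + b))).
- move=> j k x x' jk H.
  rewrite (block_e H) ?(block_e (i := (2 * j + b).+1) H)//; lia.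
move=> k s; set D := _ @^-1` [set s].
have mD : measurable D by exact: m_block.
rewrite integral_cst// muleC.
apply: (@le_trans _ _ ((fine (P D))%:E * \int[P]_(x in setT) (ubar (e 0 x) (e 1 x))%:E)%E); last first.
  by rewrite fineK ?P_fin//; apply: lee_wpmul2l.
rewrite -[leLHS]mul1e.
apply: (le_integral_law (phi := fun s => ubar s.1 s.2) (X := adjacent (2 * k + b))
   (Y := adjacent 0)) => //; first exact: fine_ge0.
move=> t'; rewrite mul1e setTI fineK ?P_fin//.
by rewrite le_eqVlt; apply/orP; left; apply/eqP; exact: e_indep.
Qed.

End truncated.

Hypothesis triple_dom : forall k t i,
  (P (adjacent k @^-1` [set t] `&` z k.+1 @^-1` [set i]) <=
   mu%:E * (P (adjacent 0 @^-1` [set t]) * P (zp @^-1` [set i])))%E.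

Let m_wk k c : measurable [set x | c < wk k x].
Proof.
apply: (measurable_preimage_count (X := fun x => (adjacent k x, z k.+1 x))
  [set s | c < w s.1.1 s.1.2 s.2]) => s.
by apply: measurable_pair_fiber => // t; exact: m_adj.
Qed.

Let m_wp c : measurable [set x | c < wp x].
Proof.
apply: (measurable_preimage_count (X := fun x => (adjacent 0 x, zp x))
  [set s | c < w s.1.1 s.1.2 s.2]) => s.
by apply: measurable_pair_fiber => // t; exact: m_adj.
Qed.

(** The atoms of the law of (e k, e k.+1, z k.+1) are at most mu times those of (e
    0, e 1, zp). *)
Lemma tail_dom k c : (P [set x | (c < wk k x)%R] <= mu%:E * P [set x | (c < wp x)%R])%E.
Proof.
have intP (f : T -> R) : measurable [set x | c < f x] ->
    (\int[P]_(x in setT) ((c < f x)%R%:R)%:E = P [set x | (c < f x)%R])%E.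
  move=> mf; transitivity (P ([set x | (c < f x)%R] `&` setT)); last by rewrite setIT.
  rewrite -integral_indic//.
  by apply: eq_integral => x _; rewrite indicE; congr ((nat_of_bool _)%:R%:E); apply/idP/idP; rewrite inE.
rewrite -(intP (wk k))// -(intP wp)// -[leLHS]mul1e.
apply: (@le_integral_law _ _ _ P _ (fun x => (adjacent k x, z k.+1 x))
  (fun x => (adjacent 0 x, zp x)) setT setT
  (fun s => (c < w s.1.1 s.1.2 s.2)%R%:R) 1 mu) => //.
- by apply: measurable_pair_fiber => // t; exact: m_adj.
- by apply: measurable_pair_fiber => // t; exact: m_adj.
move=> [t i]; rewrite mul1e !setTI.
have E (n : nat) (X : T -> nat) : (fun x => (adjacent n x, X x)) @^-1` [set (t, i)] =
    adjacent n @^-1` [set t] `&` X @^-1` [set i].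
  by apply/seteqP; split => x /=; [case|case=> -> ->].
rewrite !E; apply: le_trans (triple_dom k t i) _.
apply: lee_wpmul2l; first by rewrite lee_fin.
by rewrite le_eqVlt; apply/orP; left; apply/eqP; exact: esym (zp_indep t i).
Qed.

Let llogl x := wp x * Num.max (ln (wp x)) 0.
Hypothesis moment : (\int[P]_x (llogl x)%:E < +oo)%E.

Let llogl0 x : 0 <= llogl x.
Proof. by rewrite /llogl mulr_ge0// ?w0// le_max lexx orbT. Qed.

Let m_llogl : measurable_fun setT (EFin \o llogl).
Proof.
apply/measurable_EFinP.
by apply: measurable_fun_triple => x x'; rewrite /llogl /wp => -> -> ->.
Qed.

Let m_wpE : measurable_fun setT (EFin \o wp).
Proof.
apply/measurable_EFinP.
by apply: measurable_fun_triple => x x'; rewrite /wp => -> -> ->.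
Qed.

Let int_affine (a b : R) : 0 <= a -> 0 <= b ->
  (\int[P]_x (a + b * llogl x)%:E <= (a + b * fine (\int[P]_x (llogl x)%:E))%:E)%E.
Proof.
move=> a0 b0; under eq_integral do rewrite EFinD EFinM.
have l0 x : (0 <= (llogl x)%:E)%E by rewrite lee_fin.
rewrite ge0_integralD//; last 2 first.
- by move=> x _; rewrite mule_ge0// lee_fin.
- exact: measurable_funeM.
rewrite integral_cst// ge0_integralZl//.
rewrite EFinD EFinM fineK; last by rewrite ge0_fin_numE// integral_ge0.
apply: leeD => //; rewrite -[leRHS]mule1; apply: lee_wpmul2l; first by rewrite lee_fin.
exact: probability_le1.
Qed.

Let mbar := 4 + 1 * fine (\int[P]_x (llogl x)%:E).

Let mbarP : (\int[P]_x (wp x)%:E <= mbar%:E)%E.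
Proof.
apply: le_trans (int_affine (ler0n _ 4) ler01).
apply: ge0_le_integral => //.
- by move=> x _; rewrite lee_fin; exact: w0.
- apply/measurable_EFinP; apply: measurable_funD => //.
  by apply: measurable_funM => //; exact/measurable_EFinP.
by move=> x _; rewrite lee_fin mul1r; apply: le_llogl; exact: w0.
Qed.

(** The bad events for the first 2 * 2 ^ m costs: a deviation in the first stage, a
    deviation in the second stage for the even or for the odd indices, or a value
    above the cutoff. *)
Let dev m : set T :=
  [set x | m.+1%:R * 2 + 2 * \sum_(k < 2 * 2 ^ m) mu * clipped_mean (cutoff R m) (e k x) (e k.+1 x) <=
     \sum_(k < 2 * 2 ^ m) clipped (cutoff R m) (e k x) (e k.+1 x) (z k.+1 x)].
Let dev_mean b m : set T :=
  [set x | m.+1%:R * 2 + 2 * \sum_(k < 2 ^ m) mbar / cutoff R m <=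
     \sum_(k < 2 ^ m) clipped_mean (cutoff R m) (e (2 * k + b)%N x) (e (2 * k + b).+1 x)].
Let big_jump m : set T := \big[setU/set0]_(k < 2 * 2 ^ m) [set x | cutoff R m < wk k x].
Let bad m := (dev m `|` (dev_mean 0 m `|` dev_mean 1 m)) `|` big_jump m.

Lemma sum_even_odd (F : nat -> R) n :
  \sum_(k < 2 * n) F k = \sum_(k < n) F (2 * k + 0)%N + \sum_(k < n) F (2 * k + 1)%N.
Proof.
elim: n => [|n ih]; first by rewrite muln0 !big_ord0 addr0.
rewrite mulnS add2n !big_ord_recr/= ih addn0 addn1; ring.
Qed.

(** Off the bad event nothing was discarded, so the sum is cutoff times the clipped
    sum, and the two deviation bounds apply in turn. *)
Lemma good_sum_le m x : ~ bad m x ->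
  \sum_(k < 2 * 2 ^ m) wk k x <= (2 + 8 * mu + 8 * mu * mbar) * 2 ^+ m.
Proof.
move=> gx; set c := cutoff R m; have c0 : 0 < c := cutoff_gt0 R m.
have nd : ~ dev m x by move=> h; apply: gx; left; left.
have n0 : ~ dev_mean 0 m x by move=> h; apply: gx; left; right; left.
have n1 : ~ dev_mean 1 m x by move=> h; apply: gx; left; right; right.
have nj k : (k < 2 * 2 ^ m)%N -> wk k x <= c.
  move=> kn; rewrite leNgt; apply/negP => h; apply: gx; right.
  exact: (@bigsetU_sup _ k (2 * 2 ^ m)%N (fun k => [set x | c < wk k x]) kn x h).
move/negP: nd; rewrite -ltNge => nd.
move/negP: n0; rewrite -ltNge => n0; move/negP: n1; rewrite -ltNge => n1.
have -> : \sum_(k < 2 * 2 ^ m) wk k x =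
    c * \sum_(k < 2 * 2 ^ m) clipped c (e k x) (e k.+1 x) (z k.+1 x).
  rewrite mulr_sumr; apply: eq_bigr => k _; rewrite /clipped.
  by rewrite (nj k (ltn_ord k)) mulrC divfK// gt_eqF.
rewrite -mulr_sumr (sum_even_odd (fun k => clipped_mean c (e k x) (e k.+1 x))) in nd.
rewrite sumr_const card_ord -[_ *+ (2 ^ m)%N]mulr_natl natrX in n0.
rewrite sumr_const card_ord -[_ *+ (2 ^ m)%N]mulr_natl natrX in n1.
have ct : c * m.+1%:R = 2 ^+ m by rewrite /c /cutoff divfK.
have cm : c * (mbar / c) = mbar by rewrite mulrC divfK// gt_eqF.
move: nd n0 n1; rewrite -/c.
set A := \sum_(k < _) clipped _ _ _ _; set B := \sum_(k < _) _; set D := \sum_(k < _) _.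
set q := mbar / c in cm *; set N := 2 ^+ m in ct *; set t := m.+1%:R in ct *.
move=> nd n0 n1.
have h0 : mu * B <= mu * (t * 2 + 2 * (N * q)) by rewrite ler_wpM2l// ltW.
have h1 : mu * D <= mu * (t * 2 + 2 * (N * q)) by rewrite ler_wpM2l// ltW.
have h : A <= t * 2 + 4 * (mu * (t * 2 + 2 * (N * q))).
  by apply: (le_trans (ltW nd)); rewrite mulrDr; lra.
have := ler_wpM2l (ltW c0) h.
have -> : c * (t * 2 + 4 * (mu * (t * 2 + 2 * (N * q)))) =
   (2 + 8 * mu) * (c * t) + 8 * mu * N * (c * q) by ring.
rewrite ct cm => /le_trans; apply; rewrite le_eqVlt; apply/orP; left; apply/eqP; ring.
Qed.

Let m_clip k c : measurable_fun setT (fun x => clipped c (e k x) (e k.+1 x) (z k.+1 x)).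
Proof.
apply: (measurable_const_on_fibers (X := fun x => (adjacent k x, z k.+1 x))).
  by apply: measurable_pair_fiber => // t; exact: m_adj.
by move=> x x'; rewrite /adjacent => -[-> -> ->].
Qed.

Let m_clip_mean k c : measurable_fun setT (fun x => clipped_mean c (e k x) (e k.+1 x)).
Proof.
apply: (measurable_const_on_fibers (X := adjacent k)); first exact: m_adj.
by move=> x x'; rewrite /adjacent => -[-> ->].
Qed.

Let m_le (f g : T -> R) : measurable_fun setT f -> measurable_fun setT g ->
  measurable [set x | f x <= g x].
Proof.
move=> mf mg; rewrite (_ : mkset _ = (fun x => g x - f x) @^-1` `[0, +oo[%classic).
  by rewrite -[X in measurable X]setTI; apply: measurable_funB => //; exact: measurable_itv.
by apply/seteqP; split => x; rewrite /= in_itv/= andbT subr_ge0.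
Qed.

Let m_dev m : measurable (dev m).
Proof.
apply: m_le; last by apply: measurable_sum => k; exact: m_clip.
apply: measurable_funD => //; apply: measurable_funM => //.
by apply: measurable_sum => k; apply: measurable_funM.
Qed.

Let m_dev_mean b m : measurable (dev_mean b m).
Proof. by apply: m_le => //; apply: measurable_sum => k; exact: m_clip_mean. Qed.

Let m_big_jump m : measurable (big_jump m).
Proof. by apply: bigsetU_measurable => k _; exact: m_wk. Qed.

Let m_bad m : measurable (bad m).
Proof.
apply: measurableU; last exact: m_big_jump.
by apply: measurableU; [exact: m_dev|apply: measurableU; exact: m_dev_mean].
Qed.

Let exp_half_pow m : expR (- m.+1%:R) <= 2^-1 ^+ m.+1 :> R.
Proof.
rewrite expRN exprVn lef_pV2 ?posrE ?expR_gt0 ?exprn_gt0//.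
rewrite -[m.+1%:R]mulr1 expRM_natl; apply: lerXn2r; rewrite ?nnegrE ?expR_ge0//.
by have := expR_ge1Dx (1 : R).
Qed.

Lemma bad_le m : (P (bad m) <= (3 * 2^-1 ^+ m.+1)%:E +
  (2 * mu)%:E * \int[P]_x (2 ^+ m * (cutoff R m < wp x)%R%:R)%:E)%E.
Proof.
have c0 := cutoff_gt0 R m.
have d1 : (P (dev m) <= (2^-1 ^+ m.+1)%:E)%E.
  by apply: le_trans (truncated_deviation1 c0 _ _) _; rewrite lee_fin.
have d2 b : (P (dev_mean b m) <= (2^-1 ^+ m.+1)%:E)%E.
  by apply: le_trans (truncated_deviation2 c0 mbarP _ _ _) _; rewrite lee_fin.
have jump : (P (big_jump m) <= (2 * mu)%:E *
    \int[P]_x (2 ^+ m * (cutoff R m < wp x)%R%:R)%:E)%E.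
  have -> : (\int[P]_x (2 ^+ m * (cutoff R m < wp x)%R%:R)%:E =
      (2 ^+ m)%:E * P [set x | (cutoff R m < wp x)%R])%E.
    under eq_integral do rewrite EFinM.
    rewrite ge0_integralZl//; last first.
      apply/measurable_EFinP.
      by apply: measurable_fun_triple => x x'; rewrite /wp => -> -> ->.
    congr (_ * _)%E; transitivity (P ([set x | (cutoff R m < wp x)%R] `&` setT)); last by rewrite setIT.
    rewrite -integral_indic//.
    by apply: eq_integral => x _; rewrite indicE; congr ((nat_of_bool _)%:R%:E); apply/idP/idP; rewrite inE.
  apply: le_trans (@Boole_inequality _ _ _ P (fun k => [set x | cutoff R m < wk k x]) (2 * 2 ^ m) _) _.
    by move=> k _; exact: m_wk.
  apply: (@le_trans _ _ (\sum_(k < 2 * 2 ^ m) mu%:E * P [set x | (cutoff R m < wp x)%R])%E).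
    by apply: lee_sum => k _; exact: tail_dom.
  rewrite -(fineK (P_fin (m_wp (cutoff R m)))) -!EFinM sumEFin lee_fin.
  rewrite sumr_const card_ord -[_ *+ (2 * 2 ^ m)%N]mulr_natl natrM natrX.
  by rewrite le_eqVlt; apply/orP; left; apply/eqP; ring.
have PU A B : measurable A -> measurable B -> (P (A `|` B) <= P A + P B)%E.
  by move=> mA mB; exact: measureU2.
apply: le_trans (PU _ _ _ (m_big_jump m)) _.
  by apply: measurableU; [exact: m_dev|apply: measurableU; exact: m_dev_mean].
apply: leeD => //.
apply: le_trans (PU _ _ (m_dev m) _) _; first by apply: measurableU; exact: m_dev_mean.
apply: le_trans (leeD d1 (le_trans (PU _ _ (m_dev_mean 0 m) (m_dev_mean 1 m)) (leeD (d2 0) (d2 1)))) _.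
by rewrite -!EFinD lee_fin; lra.
Qed.

(** The deviations sum as a geometric series and the jumps by dyadic_tail_sum_le
    under the L log L moment. *)
Lemma bad_summable : (\sum_(m <oo) P (bad m) < +oo)%E.
Proof.
set L := fine (\int[P]_x (llogl x)%:E).
apply: (@le_lt_trans _ _ (3 + 2 * mu * (96 + 32 * L))%:E); last by rewrite ltry.
apply: lime_le; first exact: is_cvg_nneseries.
apply: nearW => M; rewrite big_mkord.
apply: (@le_trans _ _ (\sum_(m < M) ((3 * 2^-1 ^+ m.+1)%:E +
  (2 * mu)%:E * \int[P]_x (2 ^+ m * (cutoff R m < wp x)%R%:R)%:E))%E).
  by apply: lee_sum => m _; exact: bad_le.
have i0 (m : nat) : (0 <= \int[P]_x (2 ^+ m * (cutoff R m < wp x)%R%:R)%:E)%E.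
  by apply: integral_ge0 => x _; rewrite lee_fin mulr_ge0// exprn_ge0.
rewrite big_split/= EFinD; apply: leeD.
  rewrite sumEFin lee_fin -mulr_sumr -[leRHS]mulr1 ler_pM2l//.
  have -> : \sum_(m < M) 2^-1 ^+ m.+1 = 1 - 2^-1 ^+ M :> R.
    elim: M => [|M ih]; first by rewrite big_ord0 expr0 subrr.
    by rewrite big_ord_recr/= ih !exprS; lra.
  by rewrite lerBlDr lerDl exprn_ge0// invr_ge0.
rewrite -ge0_sume_distrr => [|m _]; last exact: i0.
rewrite [leRHS]EFinM; apply: lee_wpmul2l; first by rewrite lee_fin mulr_ge0.
rewrite -ge0_integral_sum//; last first.
  move=> m; apply/measurable_EFinP.
  by apply: measurable_fun_triple => x x'; rewrite /wp => -> -> ->.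
apply: le_trans (int_affine (ler0n _ 96) (ler0n _ 32)).
apply: ge0_le_integral => //.
- by move=> x _; apply: sume_ge0 => m _; rewrite lee_fin mulr_ge0// exprn_ge0.
- apply: emeasurable_sum => m; apply/measurable_EFinP.
  by apply: measurable_fun_triple => x x'; rewrite /wp => -> -> ->.
- apply/measurable_EFinP; apply: measurable_funD => //.
  by apply: measurable_funM => //; exact/measurable_EFinP.
move=> x _; rewrite sumEFin lee_fin; apply: dyadic_tail_sum_le; exact: w0.
Qed.

(** Borel-Cantelli for the bad events; the sum of the first n costs, with 2 ^ m <= n
    < 2 ^ m.+1, is bounded by the sum of the first 2 ^ m.+1 ones. *)
Lemma bounded_averages : {ae P, forall x, exists C n0,
  forall n, (n0 <= n)%N -> \sum_(k < n) w (e k x) (e k.+1 x) (z k.+1 x) <= C * n%:R}.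
Proof.
have lim0 := lim_sup_set_cvg0 m_bad bad_summable.
exists (lim_sup_set bad); split => //.
  by apply: bigcap_measurable => // k _; apply: bigcup_measurable.
move=> x; apply: contra_notP => /= nx.
have [m0 Hm] : exists m0, forall m, (m0 <= m)%N -> ~ bad m x.
  apply: contra_notP nx => no m0 _; apply: contra_notP no => no.
  by exists m0 => m m0m bx; apply: no; exists m.
set C := 2 + 8 * mu + 8 * mu * mbar.
have mb0 : 0 <= mbar.
  by rewrite /mbar mul1r addr_ge0// fine_ge0// integral_ge0// => y _; rewrite lee_fin.
have C0 : 0 <= C by rewrite !addr_ge0 ?mulr_ge0.
exists C, (2 ^ m0)%N => n n0n.
have n_gt0 : (0 < n)%N by apply: leq_trans n0n; rewrite expn_gt0.
have /andP[l1 l2] := trunc_log_bounds (isT : (1 < 2)%N) n_gt0.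
set m := trunc_log 2 n in l1 l2.
have m0m : (m0 <= m)%N by rewrite trunc_log_max.
apply: (@le_trans _ _ (\sum_(k < 2 * 2 ^ m) wk k x)).
  rewrite -!(big_mkord xpredT (wk ^~ x)) (@big_cat_nat _ _ _ n 0 (2 * 2 ^ m))//=; last first.
    by rewrite -expnS ltnW.
  by rewrite lerDl sumr_ge0// => k _; exact: w0.
apply: le_trans (good_sum_le (Hm m m0m)) _.
by rewrite -/C ler_wpM2l// -natrX ler_nat.
Qed.

End averages.

(** * Discretised noises *)

Section radius.
Variable R : realType.

Definition radius n (v : 'rV[R]_n) : nat := Num.truncn (enorm v).

Lemma radius_le n (v : 'rV[R]_n) : (radius v)%:R <= enorm v.
Proof. by have /andP[] := truncn_itv (enorm_ge0 v). Qed.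

Lemma lt_radius n (v : 'rV[R]_n) : enorm v < (radius v).+1%:R.
Proof. by have /andP[] := truncn_itv (enorm_ge0 v). Qed.

Lemma measurable_radius n i : measurable (@radius n @^-1` [set i]).
Proof.
rewrite (_ : _ @^-1` _ = @enorm R n @^-1` `[i%:R, i.+1%:R[).
  by rewrite -[X in measurable X]setTI; apply: measurable_enorm => //; exact: measurable_itv.
apply/seteqP; split => v /=; rewrite in_itv/=.
  by move=> <-; exact: truncn_itv (enorm_ge0 v).
exact: truncn_def.
Qed.

End radius.

(** The events known before zeta k is drawn. The noise zeta i with i < k is among
    them because it is X i - F (X i.-1). *)
Section past.
Context d (Omega : measurableType d) (R : realType) (P : probability Omega R).
Variables (N p : nat) (X zeta : nat -> {RV P >-> 'rV[R]_N})
  (eps : nat -> {RV P >-> 'rV[R]_p}).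
Variable F : 'rV[R]_N -> 'rV[R]_N.
Hypothesis mF : measurable_fun setT F.
Hypothesis X_rec : forall k w, (1 <= k)%N -> X k w = F (X k.-1 w) + zeta k w.

Lemma past_X k i A : (i < k)%N -> measurable A -> past X eps k (X i @^-1` A).
Proof.
move=> ik mA; apply: sub_sigma_algebra; left; apply: sub_sigma_algebra.
by rewrite (bigD1 (Ordinal ik))//=; left; exists A => //; rewrite setTI.
Qed.

Lemma past_eps k i A : (i <= k)%N -> measurable A -> past X eps k (eps i @^-1` A).
Proof.
rewrite -ltnS => ik mA; apply: sub_sigma_algebra; right; apply: sub_sigma_algebra.
by rewrite (bigD1 (Ordinal ik))//=; left; exists A => //; rewrite setTI.
Qed.

Lemma past_measurable k A : past X eps k A -> measurable A.
Proof.
apply: smallest_sub; first exact: sigma_algebra_measurable.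
have sub n Y (W : 'I_n -> {RV P >-> 'rV[R]_Y}) :
    g_sigma_preimage (fun i => W i : Omega -> 'rV[R]_Y) `<=` measurable.
  apply: smallest_sub; first exact: sigma_algebra_measurable.
  apply: (big_ind (fun B : set (set Omega) => B `<=` measurable)) => //.
    by move=> A1 A2 s1 s2; rewrite subUset.
  by move=> i _ _ [B mB <-]; rewrite setTI; exact: measurable_funPTI.
by rewrite subUset; split; exact: sub.
Qed.

Lemma past_zeta k i A : (0 < i < k)%N -> measurable A -> past X eps k (zeta i @^-1` A).
Proof.
move=> /andP[i0 ik] mA.
pose G := g_sigma_preimage (fun i : 'I_k => X i : Omega -> 'rV[R]_N) `|`
  g_sigma_preimage (fun i : 'I_k.+1 => eps i : Omega -> 'rV[R]_p).
have mX j : (j < k)%N -> measurable_fun setT (X j : g_sigma_algebraType G -> 'rV[R]_N).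
  by move=> jk _ B mB; rewrite setTI; exact: past_X.
have mz : measurable_fun setT (zeta i : g_sigma_algebraType G -> 'rV[R]_N).
  rewrite (_ : (zeta i : g_sigma_algebraType G -> _) = fun w => X i w - F (X i.-1 w)).
    apply: measurable_rVB; first exact: mX.
    apply: measurableT_comp => //; apply: mX; exact: leq_ltn_trans (leq_pred i) ik.
  by apply/funext => w; rewrite X_rec// addrC addKr.
by have := mz measurableT A mA; rewrite setTI.
Qed.

Lemma past_setI k A B : past X eps k A -> past X eps k B -> past X eps k (A `&` B).
Proof.
pose G := g_sigma_preimage (fun i : 'I_k => X i : Omega -> 'rV[R]_N) `|`
  g_sigma_preimage (fun i : 'I_k.+1 => eps i : Omega -> 'rV[R]_p).
exact: (@measurableI _ (g_sigma_algebraType G)).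
Qed.

Lemma past_map_fiber k (f : nat -> Omega -> nat) (l : seq nat) s :
  (forall i j, i \in l -> past X eps k (f i @^-1` [set j])) ->
  past X eps k ((fun x => [seq f i x | i <- l]) @^-1` [set s]).
Proof.
pose G := g_sigma_preimage (fun i : 'I_k => X i : Omega -> 'rV[R]_N) `|`
  g_sigma_preimage (fun i : 'I_k.+1 => eps i : Omega -> 'rV[R]_p).
exact: (@measurable_map_fiber _ (g_sigma_algebraType G)).
Qed.

End past.

(** The integral of a nonnegative function is a supremum over simple functions,
    hence monotone without any measurability. It spares a proof that log q^- of
    the noises is measurable. *)
Lemma ge0_le_integral_any d (T : measurableType d) (R : realType)
    (m : {measure set T -> \bar R}) (D : set T) (f g : T -> \bar R) :
  (forall x, D x -> 0 <= f x)%E -> (forall x, D x -> f x <= g x)%E ->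
  (\int[m]_(x in D) f x <= \int[m]_(x in D) g x)%E.
Proof.
move=> f0 fg; rewrite !ge0_integralE//; last by move=> x Dx; exact: le_trans (f0 _ Dx) (fg _ Dx).
apply: ge_ereal_sup => _ [h /= hf] <-; apply: ereal_sup_ubound; exists h => // x.
apply: le_trans (hf x) _; rewrite /patch; case: ifPn => // /set_mem; exact: fg.
Qed.

(** Given the past, Z has a density at most mu times that of W. *)
Lemma past_domination d (Omega : measurableType d) (R : realType) (P : probability Omega R)
    N p (X : nat -> {RV P >-> 'rV[R]_N}) (eps : nat -> {RV P >-> 'rV[R]_p})
    (Z W : {RV P >-> 'rV[R]_N}) (q : 'rV[R]_N -> 'rV[R]_N -> R) (psi : 'rV[R]_N -> R)
    (mu : R) k F A :
  cond_density (past X eps k) Z (fun w => q (X k.-1 w)) -> has_density W psi ->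
  is_density psi -> (forall x, is_density (q x)) -> 0 <= mu ->
  (forall x u, q x u <= mu * psi u) ->
  past X eps k F -> measurable A ->
  (P (F `&` Z @^-1` A) <= mu%:E * P F * P (W @^-1` A))%E.
Proof.
move=> condZ densW [mpsi psi0 _] qd mu0 q_le pF mA.
have mF := past_measurable pF.
rewrite condZ// densW//.
have mpsiA : measurable_fun A (EFin \o psi).
  by apply: measurable_funTS; exact/measurable_EFinP.
apply: (@le_trans _ _ (\int[P]_(w in F)
    (mu%:E * \int[lebesgue_rV R N]_(u in A) (psi u)%:E))%E).
  apply: ge0_le_integral_any => w _.
    by apply: integral_ge0 => u _; rewrite lee_fin; have [_ ->] := qd (X k.-1 w).
  rewrite -ge0_integralZl//; last by move=> u _; rewrite lee_fin.
  apply: ge0_le_integral_any => u _; rewrite ?lee_fin ?q_le//.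
  by have [_ ->] := qd (X k.-1 w).
rewrite -(densW A mA) -[mu%:E in leLHS]/(mu%:E).
have e : (mu%:E * P (W @^-1` A))%E = (fine (mu%:E * P (W @^-1` A)))%:E.
  by rewrite fineK// fin_numM// fin_num_measure//; exact: measurable_funPTI.
by rewrite e integral_cst// -e muleAC.
Qed.

(** Fibres of block and adjacent are cylinder events, with one shell of R^p for each
    coordinate, and iid gives their probabilities as products. *)
Section iid_radii.
Context d (Omega : measurableType d) (R : realType) (P : probability Omega R).
Variables (p : nat) (eps : nat -> {RV P >-> 'rV[R]_p}).
Hypothesis eps_iid : iid eps.
Local Open Scope ereal_scope.

Let e k w := radius (eps k w).
Let pr j := P (eps 0%N @^-1` (@radius R p @^-1` [set j])).
Let shell (s : seq nat) i : set 'rV[R]_p := @radius R p @^-1` [set nth 0%N s i].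

Let block_fiber n s : size s = n ->
  block e n @^-1` [set s] = \bigcap_(i < n) eps i @^-1` shell s i.
Proof.
move=> sn; apply/seteqP; split => w /=.
  move=> E i /= i_n; rewrite /shell/= -E (nth_map 0%N) ?size_iota//.
  by rewrite nth_iota.
move=> H; apply: (@eq_from_nth _ 0%N); rewrite ?size_map ?size_iota//.
by move=> i i_n; rewrite (nth_map 0%N) ?size_iota// nth_iota//; exact: (H i i_n).
Qed.

Let P_block n s : size s = n -> P (block e n @^-1` [set s]) = \prod_(i < n) pr (nth 0%N s i).
Proof.
have [indep same] := eps_iid.
move=> sn; rewrite block_fiber// indep; last by move=> i; exact: measurable_radius.
by apply: eq_bigr => i _; rewrite same//; exact: measurable_radius.
Qed.

Let block_cat n s t : size s = n ->
  block e n @^-1` [set s] `&` adjacent e n @^-1` [set t] =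
  block e n.+2 @^-1` [set (s ++ [:: t.1; t.2])].
Proof.
case: t => j j' sn; apply/seteqP; split => w /=; rewrite /block /adjacent -addn2 iotaD map_cat /= ?add0n.
  by move=> [-> [-> ->]].
move=> /eqP; rewrite eqseq_cat; last by rewrite size_map size_iota.
by move=> /andP[/eqP -> /eqP[-> ->]].
Qed.

Let P_adjacent k t : P (adjacent e k @^-1` [set t]) = pr t.1 * pr t.2.
Proof.
have [indep same] := eps_iid; case: t => j j'.
pose B i : set 'rV[R]_p := if (i < k)%N then setT
  else if i == k then @radius R p @^-1` [set j] else @radius R p @^-1` [set j'].
have mB i : measurable (B i).
  by rewrite /B; case: ifP => // _; case: ifP => // _; exact: measurable_radius.
have -> : adjacent e k @^-1` [set (j, j')] = \bigcap_(i < k.+2) eps i @^-1` B i.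
  apply/seteqP; split => w /=.
    move=> [ej ej'] i /= ik; rewrite /B /=; case: ltnP => // ki.
    have [->//|ne] := eqVneq i k; rewrite (_ : i = k.+1)//.
    by apply/eqP; rewrite eqn_leq -ltnS ik ltn_neqAle eq_sym ne.
  move=> H; congr (_, _).
    by have := H k (ltnW (ltnSn _)); rewrite /B /= ltnn eqxx.
  by have := H k.+1 (ltnSn _); rewrite /B /= ltnNge leqnSn/= gtn_eqF.
rewrite indep// 2!big_ord_recr/= big1 ?mul1e => [|i _]; last first.
  by rewrite /B ltn_ord preimage_setT; exact: probability_setT.
by rewrite !same// /B ltnn eqxx ltnNge leqnSn/= gtn_eqF.
Qed.

Lemma radii_indep n s t :
  P (block e n @^-1` [set s] `&` adjacent e n @^-1` [set t]) =
  P (block e n @^-1` [set s]) * P (adjacent e 0 @^-1` [set t]).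
Proof.
have [sn|sn] := eqVneq (size s) n; last first.
  have -> : block e n @^-1` [set s] = set0.
    apply/seteqP; split => // w /= E; move: sn.
    by rewrite -E size_map size_iota eqxx.
  by rewrite set0I measure0 mul0e.
rewrite block_cat// P_adjacent !P_block//; last by rewrite size_cat sn addn2.
rewrite 2!big_ord_recr/= !nth_cat !sn ltnn subnn ltnNge leqnSn/= subSnn/= -muleA; congr (_ * _).
by apply: eq_bigr => i _; rewrite nth_cat sn ltn_ord.
Qed.

Lemma radii_adjacent k t : P (adjacent e k @^-1` [set t]) = P (adjacent e 0 @^-1` [set t]).
Proof. by rewrite !P_adjacent. Qed.

Lemma radii_indep_extra N (zp : {RV P >-> 'rV[R]_N}) t i : indep_rv_seq zp eps ->
  P (adjacent e 0 @^-1` [set t] `&` (@radius R N \o zp) @^-1` [set i]) =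
  P (adjacent e 0 @^-1` [set t]) * P ((@radius R N \o zp) @^-1` [set i]).
Proof.
move=> zp_indep; have b0 : block e 0 @^-1` [set [::]] = setT by apply/seteqP; split.
have E : adjacent e 0 @^-1` [set t] = block e 2 @^-1` [set [:: t.1; t.2]].
  by rewrite -[[:: _; _]]cat0s -block_cat// b0 setTI.
rewrite E block_fiber// setIC muleC.
apply: (zp_indep (@radius R N @^-1` [set i])); first exact: measurable_radius.
by move=> k; exact: measurable_radius.
Qed.

End iid_radii.

(** * Distance travelled between consecutive Doeblin sets *)

Lemma elipschitz_continuous (R : realType) m n (a : R) (F : 'rV[R]_m -> 'rV[R]_n) :
  0 <= a -> elipschitz a F -> continuous F.
Proof.
move=> a0 Flip x U /nbhs_ballP[eps /= eps0 sub].
have am0 : 0 <= a * m%:R by apply: mulr_ge0.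
have c0 : 0 < a * m%:R + 1 by exact: ltr_wpDl.
have d0 : 0 < eps / (a * m%:R + 1) by exact: divr_gt0.
apply/nbhs_ballP; exists (eps / (a * m%:R + 1)) => //= y xy; apply: sub.
have exy : enorm (x - y) <= m%:R * (eps / (a * m%:R + 1)).
  apply: enorm_le_max; first exact: ltW.
  by move=> i; rewrite !mxE; apply: ltW; have [_ /(_ 0 i)] := xy.
split=> // i j; rewrite (ord1 i) /ball /=.
have -> : F x 0 j - F y 0 j = (F x - F y) 0 j by rewrite !mxE.
apply: le_lt_trans (coord_le_enorm _ _) _; apply: le_lt_trans (Flip _ _) _.
apply: le_lt_trans (ler_wpM2l a0 exy) _.
by rewrite !mulrA ltr_pdivrMr// [ltLHS]mulrC ltr_pM2l// ltrDl.
Qed.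

Section constants.
Variables (R : realType) (N p : nat).
Hypotheses (p_gt0 : (0 < p)%N) (p_leN : (p <= N)%N).

Let enorm_const (t : R) : 0 <= t -> t <= enorm (const_mx t : 'rV[R]_N).
Proof.
move=> t0; have := coord_le_enorm (const_mx t : 'rV[R]_N) (Ordinal (leq_trans p_gt0 p_leN)).
by rewrite mxE ger0_norm.
Qed.

Lemma enorm0 n : enorm (0 : 'rV[R]_n) = 0.
Proof. by rewrite /enorm big1 ?sqrtr0// => i _; rewrite mxE expr0n. Qed.

(** The dimension is positive, so some pair of points has a positive distance. *)
Lemma elipschitz_ge0 n (a : R) (F : 'rV[R]_N -> 'rV[R]_n) : elipschitz a F -> 0 <= a.
Proof.
move=> /(_ (const_mx 1) 0); rewrite subr0 => H.
have e1 : 0 < enorm (const_mx 1 : 'rV[R]_N) by exact: lt_le_trans ltr01 (enorm_const ler01).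
by have := le_trans (enorm_ge0 _) H; rewrite pmulr_lge0.
Qed.

Variables (h : 'rV[R]_N -> 'rV[R]_p) (b0 b : R).
Hypothesis h_inv : forall y1 y2 x1 x2, h x1 = y1 -> h x2 = y2 ->
    enorm (x1 - x2) <= b0 + b * enorm (y1 - y2).

Lemma inverse_offset_ge0 : 0 <= b0.
Proof.
have := @h_inv _ _ 0 0 erefl erefl.
by rewrite subrr enorm0 subrr enorm0 mulr0 addr0.
Qed.

(** Otherwise the whole space would have diameter at most b0. *)
Lemma inverse_slope_gt0 : 0 < b.
Proof.
rewrite ltNge; apply/negP => b_le0.
have := @h_inv _ _ (const_mx (b0 + 1)) 0 erefl erefl; rewrite subr0 => H.
have b01 : 0 <= b0 + 1 by rewrite addr_ge0// inverse_offset_ge0.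
have := le_trans (enorm_const b01) H.
rewrite lerD2l => /(lt_le_trans ltr01); rewrite ltNge => /negP; apply.
by rewrite mulr_le0_ge0// enorm_ge0.
Qed.

End constants.

Lemma le_sup_norm (R : realType) T n (F : T -> 'rV[R]_n) x :
  (sup_norm F < +oo)%E -> enorm (F x) <= fine (sup_norm F).
Proof.
move=> Foo; have le1 : ((enorm (F x))%:E <= sup_norm F)%E.
  by apply: ereal_sup_ubound; exists x.
rewrite -lee_fin fineK// fin_numElt Foo andbT.
by apply: lt_le_trans le1; exact: ltNyr.
Qed.

Section geometry.
Variables (R : realType) (N p : nat) (f fs : 'rV[R]_N -> 'rV[R]_N)
  (h hs : 'rV[R]_N -> 'rV[R]_p) (a b0 b as_ b0s bs : R).
Hypotheses (f_lip : elipschitz a f) (fs_lip : elipschitz as_ fs)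
  (h_surj : range h = setT) (hs_surj : range hs = setT)
  (h_inv : forall y1 y2 x1 x2, h x1 = y1 -> h x2 = y2 ->
    enorm (x1 - x2) <= b0 + b * enorm (y1 - y2))
  (hs_inv : forall x1 x2 : 'rV[R]_N,
    enorm (x1 - x2) <= b0s + bs * enorm (hs x1 - hs x2))
  (f_fs : (sup_norm (fun x => f x - fs x)%R < +oo)%E)
  (h_hs : (sup_norm (fun x => h x - hs x)%R < +oo)%E)
  (a0 : 0 <= a) (as0 : 0 <= as_) (b_ge0 : 0 <= b).

Let F := fine (sup_norm (fun x => f x - fs x)).
Let H := fine (sup_norm (fun x => hs x - h x)).

Let le_H x : enorm (hs x - h x) <= H.
Proof.
apply: (@le_sup_norm _ _ _ (fun x => hs x - h x)); apply: le_lt_trans h_hs.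
apply: ge_ereal_sup => _ [v _ <-]; apply: ereal_sup_ubound; exists v => //.
by rewrite enormB.
Qed.

Let h_preimage y : exists x, h x = y.
Proof. have [x _ <-] : range h y by rewrite h_surj. by exists x. Qed.

Let hs_preimage y : exists x, hs x = y.
Proof. have [x _ <-] : range hs y by rewrite hs_surj. by exists x. Qed.

Let near_preimage r y x x1 : h x1 = y -> enorm (h x - y) <= r -> enorm (x - x1) <= b0 + b * r.
Proof.
move=> hx1 xr; apply: le_trans (h_inv erefl hx1) _.
by rewrite lerD2l ler_wpM2l.
Qed.

Let near_star y x1 z1 : h x1 = y -> hs z1 = y -> enorm (x1 - z1) <= b0 + b * H.
Proof.
move=> hx1 hz1; apply: le_trans (h_inv hx1 erefl) _.
by rewrite lerD2l ler_wpM2l// -hz1.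
Qed.

Let near_state y x1 z1 e : hs z1 = y -> y = hs x1 + e -> enorm (z1 - x1) <= b0s + bs * enorm e.
Proof.
by move=> hz1 ye; apply: le_trans (hs_inv _ _) _; rewrite hz1 ye addrAC subrr add0r.
Qed.

(** Chain from u to f x through a preimage of y' under h, a preimage of y' under hs,
    X', fs X, and the images under fs and f of preimages of y; X and X' are the
    states of the observation process behind y and y'. *)
Lemma doeblin_distance r x u X X' z e e' y y' :
  X' = fs X + z -> y = hs X + e -> y' = hs X' + e' ->
  enorm (h x - y) <= r -> enorm (h u - y') <= r ->
  enorm (u - f x) <= (a + 1) * b0 + (a + 1) * b * r + kappa b0 b as_ f fs h hs +
    (1 + as_) * b0s + as_ * bs * enorm e + bs * enorm e' + enorm z.
Proof.
move=> X'E yE y'E xr ur.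
have [x1 hx1] := h_preimage y; have [u1 hu1] := h_preimage y'.
have [z1 hz1] := hs_preimage y; have [v1 hv1] := hs_preimage y'.
have d1 := near_preimage hu1 ur.
have d2 := near_star hu1 hv1.
have d3 := near_state hv1 y'E.
have d4 : enorm (X' - fs X) = enorm z by rewrite X'E addrAC subrr add0r.
have d5 : enorm (fs X - fs z1) <= as_ * (b0s + bs * enorm e).
  by apply: le_trans (fs_lip _ _) _; rewrite ler_wpM2l// enormB; exact: near_state hz1 yE.
have d6 : enorm (fs z1 - fs x1) <= as_ * (b0 + b * H).
  by apply: le_trans (fs_lip _ _) _; rewrite ler_wpM2l// enormB; exact: near_star hx1 hz1.
have d7 : enorm (fs x1 - f x1) <= F.
  by rewrite enormB; exact: (@le_sup_norm _ _ _ (fun x => f x - fs x)).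
have d8 : enorm (f x1 - f x) <= a * (b0 + b * r).
  by apply: le_trans (f_lip _ _) _; rewrite ler_wpM2l// enormB; exact: near_preimage hx1 xr.
have t1 := enorm_triangle u u1 (f x).
have t2 := enorm_triangle u1 v1 (f x).
have t3 := enorm_triangle v1 X' (f x).
have t4 := enorm_triangle X' (fs X) (f x).
have t5 := enorm_triangle (fs X) (fs z1) (f x).
have t6 := enorm_triangle (fs z1) (fs x1) (f x).
have t7 := enorm_triangle (fs x1) (f x1) (f x).
rewrite /kappa -/F -/H.
rewrite d4 in t4.
have S : enorm (u - f x) <= (b0 + b * r) + (b0 + b * H) + (b0s + bs * enorm e') + enorm z +
    as_ * (b0s + bs * enorm e) + as_ * (b0 + b * H) + F + a * (b0 + b * r).
  clear -t1 t2 t3 t4 t5 t6 t7 d1 d2 d3 d5 d6 d7 d8; lra.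
apply: le_trans S _; rewrite le_eqVlt; apply/orP; left; apply/eqP; clear; ring.
Qed.

End geometry.

(** * Observation process *)

Section log_cost.
Variables (R : realType) (N : nat) (psi : 'rV[R]_N -> R) (mu : R).
Hypotheses (psi_ge0 : forall v, 0 <= psi v) (mu_gt0 : 0 < mu).
Local Notation qm := (qminus mu psi).

Implicit Types s t : R.

(** The negative part of the logarithm of q^-, as a real number. *)
Definition log_cost s : R := Num.max 0 (- ln (fine (qm s))).

Lemma log_cost_ge0 s : 0 <= log_cost s. Proof. by rewrite le_max lexx. Qed.

Lemma qminus_ge0 s : (0 <= qm s)%E.
Proof.
apply: mule_ge0; first by rewrite lee_fin ltW.
by apply: le_ereal_inf_tmp => _ [v _ <-]; rewrite lee_fin.
Qed.

Lemma qminus_le s v : enorm v <= s -> (qm s <= (mu * psi v)%:E)%E.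
Proof.
move=> vs; rewrite EFinM; apply: lee_wpmul2l; first by rewrite lee_fin ltW.
by apply: ereal_inf_lbound; exists v.
Qed.

Lemma qminus_fin s : 0 <= s -> qm s \is a fin_num.
Proof.
move=> s0; rewrite ge0_fin_numE ?qminus_ge0//.
by apply: le_lt_trans (ltry (mu * psi 0)); apply: qminus_le; rewrite enorm0.
Qed.

Lemma qminus_antitone s t : s <= t -> (qm t <= qm s)%E.
Proof.
move=> st; apply: lee_wpmul2l; first by rewrite lee_fin ltW.
apply: ereal_inf_le_tmp => _ [v /= vs <-]; exists v => //=; exact: le_trans vs st.
Qed.

Hypothesis qminus_gt0 : forall s, (0 < qm s)%E.

Let fine_qm s : 0 <= s -> 0 < fine (qm s).
Proof. by move=> s0; rewrite -lte_fin fineK// qminus_fin. Qed.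

Lemma log_cost_lower s v : enorm v <= s -> expR (- log_cost s) <= mu * psi v.
Proof.
move=> vs; have s0 := le_trans (enorm_ge0 v) vs.
apply: (@le_trans _ _ (fine (qm s))); last first.
  by rewrite -lee_fin fineK ?qminus_fin// qminus_le.
rewrite -[leRHS]lnK ?posrE ?fine_qm// ler_expR lerNl.
by rewrite le_max lexx orbT.
Qed.

Lemma le_log_cost s t : 0 <= s -> s <= t -> log_cost s <= log_cost t.
Proof.
move=> s0 st; have t0 := le_trans s0 st.
rewrite ge_max log_cost_ge0/= le_max; apply/orP; right.
rewrite lerN2 ler_ln ?posrE ?fine_qm//.
by apply: fine_le; rewrite ?qminus_fin// qminus_antitone.
Qed.

Lemma logp_ge0 (x : R) : 0 <= x -> logp x%:E = (Num.max (ln x) 0)%:E.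
Proof.
rewrite le_eqVlt => /predU1P[<-|x0]; rewrite /logp.
  by rewrite le0_lneNy// ln0// maxxx; exact: max_r.
by rewrite lne_EFin// EFin_max.
Qed.

(** The cost at s is at most the modulus of log q^- at a larger radius t, and x *
    max(log x, 0) is nondecreasing on the half-line. *)
Lemma llogl_log_cost s t : 0 <= s -> s <= t ->
  ((log_cost s * Num.max (ln (log_cost s)) 0)%:E <=
   `|lne (qm t)| * logp `|lne (qm t)|)%E.
Proof.
move=> s0 st; have t0 := le_trans s0 st.
rewrite -(fineK (qminus_fin t0)) lne_EFin ?fine_qm// abse_EFin logp_ge0// -EFinM lee_fin.
set L := `|_|.
have sL : log_cost s <= L.
  apply: le_trans (le_log_cost s0 st) _.
  by rewrite ge_max normr_ge0/= /L -normrN ler_norm.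
apply: ler_pM => //; rewrite ?log_cost_ge0// ?le_max ?lexx ?orbT//.
have [l0|l0] := leP (ln (log_cost s)) 0; first by rewrite lexx orbT.
apply/orP; left.
have c0 : 0 < log_cost s by rewrite ltNge; apply/negP => /ln0 e; rewrite e ltxx in l0.
by rewrite ler_ln ?posrE//; exact: lt_le_trans c0 sL.
Qed.

End log_cost.

(** offset and level below are the bound of doeblin_distance; arg is the radius in
    the moment condition. *)
Section observed_costs.
Context (R : realType) (N p : nat) d (Omega : measurableType d) (P : probability Omega R).
Variables (f fs : 'rV[R]_N -> 'rV[R]_N) (h hs : 'rV[R]_N -> 'rV[R]_p).
Variables (a b0 b as_ b0s bs : R).
Hypotheses (a_ge0 : 0 <= a) (b0_ge0 : 0 <= b0) (b_gt0 : 0 < b) (as_ge0 : 0 <= as_)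
  (b0s_gt0 : 0 < b0s) (bs_gt0 : 0 < bs).
Variables (q : 'rV[R]_N -> 'rV[R]_N -> R) (psi : 'rV[R]_N -> R) (mum : R).
Hypotheses (psi_gt0 : forall u, 0 < psi u) (mum_gt0 : 0 < mum)
  (q_ge : forall x u, mum * psi u <= q x u).
Hypotheses (f_lipschitz : elipschitz a f) (fs_lipschitz : elipschitz as_ fs)
  (h_surj : range h = setT) (hs_surj : range hs = setT)
  (h_inv : forall y1 y2 x1 x2, h x1 = y1 -> h x2 = y2 ->
    enorm (x1 - x2) <= b0 + b * enorm (y1 - y2))
  (hs_inv : forall x1 x2 : 'rV[R]_N,
    enorm (x1 - x2) <= b0s + bs * enorm (hs x1 - hs x2))
  (mfs : measurable_fun setT fs)
  (f_fs : (sup_norm (fun x => f x - fs x)%R < +oo)%E)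
  (h_hs : (sup_norm (fun x => h x - hs x)%R < +oo)%E).
Variables (qs : 'rV[R]_N -> 'rV[R]_N -> R) (psis : 'rV[R]_N -> R) (mups : R).
Hypotheses (qs_density : forall x, is_density (qs x)) (psis_density : is_density psis)
  (mups_gt0 : 0 < mups) (qs_le : forall x u, qs x u <= mups * psis u).
Variables (Xs zetas : nat -> {RV P >-> 'rV[R]_N}) (epss : nat -> {RV P >-> 'rV[R]_p})
  (zetap : {RV P >-> 'rV[R]_N}) (Ys : nat -> Omega -> 'rV[R]_p).
Hypotheses (epss_iid : iid epss)
  (zetas_cond : forall k, (1 <= k)%N ->
    cond_density (past Xs epss k) (zetas k) (fun w => qs (Xs k.-1 w)))
  (Xs_rec : forall k w, (1 <= k)%N -> Xs k w = fs (Xs k.-1 w) + zetas k w)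
  (Ys_def : forall k w, Ys k w = hs (Xs k w) + epss k w)
  (zetap_indep : indep_rv_seq zetap epss) (zetap_density : has_density zetap psis).

Let arg Delta w := (a + 1) * b0 + (a + 1) * b * Delta + kappa b0 b as_ f fs h hs +
     2 * as_ * bs + as_ * bs * enorm (epss 0%N w) + bs * enorm (epss 1%N w) +
     enorm (zetap w).
Hypothesis V_LlogL : forall Delta : R, 0 < Delta ->
  (\int[P]_w (`|lne (qminus mum psi (arg Delta w))| *
     logp `|lne (qminus mum psi (arg Delta w))|) < +oo)%E.

Let kap := kappa b0 b as_ f fs h hs.

Let kap_ge0 : 0 <= kap.
Proof.
have sn0 n (F : 'rV[R]_N -> 'rV[R]_n) : 0 <= fine (sup_norm F).
  apply: fine_ge0; apply: (@le_trans _ _ (enorm (F 0))%:E); first by rewrite lee_fin enorm_ge0.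
  by apply: ereal_sup_ubound; exists 0.
rewrite /kap /kappa; apply: addr_ge0; first exact: sn0.
apply: mulr_ge0; last exact: addr_ge0.
by apply: addr_ge0 => //; apply: mulr_ge0; [exact: ltW|exact: sn0].
Qed.

Let slope_gt0 : 0 < (a + 1) * b. Proof. by apply: mulr_gt0 => //; exact: ltr_wpDl. Qed.

Let psi_ge0 v : 0 <= psi v. Proof. exact: ltW. Qed.

Let le_arg Delta w : (a + 1) * b * Delta <= arg Delta w.
Proof.
have asbs : 0 <= as_ * bs by apply: mulr_ge0 => //; exact: ltW.
have t1 : 0 <= (a + 1) * b0 by apply: mulr_ge0 => //; exact: addr_ge0.
have t2 : 0 <= as_ * bs * enorm (epss 0%N w) by apply: mulr_ge0 => //; exact: enorm_ge0.
have t3 : 0 <= bs * enorm (epss 1%N w) by apply: mulr_ge0; [exact: ltW|exact: enorm_ge0].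
have t4 := enorm_ge0 (zetap w); have t5 := kap_ge0.
rewrite /arg -/kap; lra.
Qed.

(** If q^- vanished at some radius, it would vanish at every larger one, and the
    moment condition would fail for Delta large enough. *)
Lemma observed_qminus_gt0 s : (0 < qminus mum psi s)%E.
Proof.
have q0 t := qminus_ge0 psi_ge0 mum_gt0 t.
rewrite lt_neqAle q0 andbT eq_sym; apply/negP => /eqP qs0.
pose Delta := (`|s| + 1) / ((a + 1) * b).
have D0 : 0 < Delta by rewrite divr_gt0// ltr_wpDl.
have qarg w : qminus mum psi (arg Delta w) = 0%E.
  apply/eqP; rewrite eq_le q0 andbT -qs0; apply: qminus_antitone => //.
  apply: le_trans (le_arg Delta w); rewrite /Delta mulrC divfK ?gt_eqF//.
  by apply: le_trans (ler_norm _) _; rewrite lerDl.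
have := V_LlogL D0.
under eq_integral => w _ do rewrite qarg le0_lneNy//= /logp/=.
rewrite (_ : (+oo * maxe +oo 0 = +oo)%E); last by rewrite max_l ?leey// mulyy.
suff -> : (\int[P]_w +oo)%E = (+oo * P setT :> \bar R)%E.
  rewrite (_ : P setT = 1%E) ?mule1 ?ltxx//; exact: probability_setT.
exact: integral_cst.
Qed.

Let asbs_ge0 : 0 <= as_ * bs. Proof. by apply: mulr_ge0 => //; exact: ltW. Qed.

Let e k w := radius (epss k w).
Let z k w := radius (zetas k w).
Let zp w := radius (zetap w).

Let offset r := (a + 1) * b0 + (a + 1) * b * r + kap + (1 + as_) * b0s.

Let offset_ge0 r : 0 <= r -> 0 <= offset r.
Proof.
move=> r0; rewrite /offset; apply: addr_ge0; last first.
  by apply: mulr_ge0; [exact: addr_ge0|exact: ltW].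
apply: addr_ge0 => //; apply: addr_ge0; last by apply: mulr_ge0 => //; exact: ltW.
by apply: mulr_ge0 => //; exact: addr_ge0.
Qed.

Let level r (t0 t1 u : R) := offset r + as_ * bs * t0 + bs * t1 + u.

Let le_level r t0 t0' t1 t1' u u' : t0 <= t0' -> t1 <= t1' -> u <= u' ->
  level r t0 t1 u <= level r t0' t1' u'.
Proof.
move=> t0t t1t uu; apply: lerD => //; apply: lerD; last by apply: ler_wpM2l => //; exact: ltW.
by rewrite lerD2l; exact: ler_wpM2l.
Qed.

(** Each noise is replaced by the integer part of its norm plus one, an upper bound. *)
Definition step_cost r (j j' i : nat) : R :=
  log_cost psi mum (level r j.+1%:R j'.+1%:R i.+1%:R).

Let level_ge0 r (j j' i : nat) : 0 <= r -> 0 <= level r j.+1%:R j'.+1%:R i.+1%:R.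
Proof.
move=> r0; rewrite /level; apply: addr_ge0 => //; apply: addr_ge0.
  by apply: addr_ge0; [exact: offset_ge0|exact: mulr_ge0].
by apply: mulr_ge0 => //; exact: ltW.
Qed.

Let past_radius_e k i j : (i <= k)%N -> past Xs epss k (e i @^-1` [set j]).
Proof.
by move=> ik; exact: (past_eps ik (measurable_radius (R := R) (n := p) j)).
Qed.

Let past_radius_z k i j : (0 < i < k)%N -> past Xs epss k (z i @^-1` [set j]).
Proof.
by move=> ik; exact: (past_zeta mfs Xs_rec ik (measurable_radius (R := R) (n := N) j)).
Qed.

Let past_history k s : past Xs epss k.+1 (history e z k @^-1` [set s]).
Proof.
rewrite (_ : _ @^-1` _ = (fun x => [seq e i x | i <- iota 0 k.+2]) @^-1` [set s.1] `&`
  (fun x => [seq z i x | i <- iota 1 k]) @^-1` [set s.2]); last first.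
  by case: s => s s'; apply/seteqP; split => x /=; [case|case=> <- <-].
apply: past_setI; apply: past_map_fiber => i j.
  by rewrite mem_iota => /andP[_ ik]; exact: past_radius_e.
by rewrite mem_iota add1n => /andP[i0 ik]; apply: past_radius_z; rewrite i0.
Qed.

Let past_adjacent k t : past Xs epss k.+1 (adjacent e k @^-1` [set t]).
Proof.
rewrite (_ : _ @^-1` _ = e k @^-1` [set t.1] `&` e k.+1 @^-1` [set t.2]); last first.
  by case: t => j j'; apply/seteqP; split => x /=; [case|case=> <- <-].
by apply: past_setI; exact: past_radius_e.
Qed.

Let z_dom k F i : past Xs epss k.+1 F ->
  (P (F `&` z k.+1 @^-1` [set i]) <= mups%:E * P F * P (zp @^-1` [set i]))%E.
Proof.
move=> pF.
exact: (past_domination (zetas_cond (ltn0Sn k)) zetap_density psis_density qs_density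
  (ltW mups_gt0) qs_le pF (measurable_radius i)).
Qed.

(** Delta exceeds r by enough to absorb the roundings and the constant (1 + as_) *
    b0s in level. *)
Let cost_moment r : 0 < r ->
  (\int[P]_x (step_cost r (e 0%N x) (e 1%N x) (zp x) *
     Num.max (ln (step_cost r (e 0%N x) (e 1%N x) (zp x))) 0)%:E < +oo)%E.
Proof.
move=> r0; pose Delta := r + ((1 + as_) * b0s + as_ * bs + bs + 1) / ((a + 1) * b).
have Delta0 : 0 < Delta.
  rewrite ltr_wpDr//; apply: divr_ge0; last exact: ltW.
  apply: addr_ge0 => //; apply: addr_ge0; last exact: ltW.
  by apply: addr_ge0 => //; apply: mulr_ge0; [exact: addr_ge0|exact: ltW].
apply: le_lt_trans (V_LlogL Delta0); apply: ge0_le_integral_any => x _.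
  by rewrite lee_fin mulr_ge0 ?log_cost_ge0// le_max lexx orbT.
apply: llogl_log_cost => //; first exact: observed_qminus_gt0.
  exact/level_ge0/ltW.
apply: (@le_trans _ _ (level r (enorm (epss 0%N x) + 1) (enorm (epss 1%N x) + 1)
    (enorm (zetap x) + 1))).
  by apply: le_level; rewrite -addn1 natrD lerD2r radius_le.
have DE : (a + 1) * b * Delta = (a + 1) * b * r + ((1 + as_) * b0s + as_ * bs + bs + 1).
  by rewrite /Delta mulrDr [X in _ + X]mulrC divfK ?gt_eqF.
rewrite /arg -/kap DE /level /offset; have := asbs_ge0.
move: (enorm _) (enorm _) (enorm _) => E1 E2 E3; nra.
Qed.

Lemma step_cost_average r : 0 < r -> {ae P, forall x, exists C n0, forall n, (n0 <= n)%N ->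
  \sum_(k < n) step_cost r (e k x) (e k.+1 x) (z k.+1 x) <= C * n%:R}.
Proof.
move=> r0.
have m_fiber n (U : {RV P >-> 'rV[R]_n}) i : measurable ((fun w => radius (U w)) @^-1` [set i]).
  exact: (measurable_funPTI U (measurable_radius (R := R) (n := n) i)).
apply: (@bounded_averages _ Omega R P e z zp (step_cost r) mups).
- by move=> k i; exact: m_fiber.
- by move=> k i; exact: m_fiber.
- by move=> i; exact: m_fiber.
- by move=> j j' i; exact: log_cost_ge0.
- exact: ltW.
- by move=> k s i; exact: (@z_dom k _ i (@past_history k s)).
- by move=> n s t; exact: radii_indep.
- by move=> t i; exact: radii_indep_extra.
- move=> k t i; rewrite -(radii_adjacent epss_iid k) muleA.
  exact: (@z_dom k _ i (@past_adjacent k t)).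
- exact: cost_moment.
Qed.

Lemma step_density_lower r k x u w : 0 <= r ->
  doeblin_set h (Ys k w) r x -> doeblin_set h (Ys k.+1 w) r u ->
  expR (- step_cost r (e k w) (e k.+1 w) (z k.+1 w)) <= q x (u - f x).
Proof.
move=> r0 xC uC; apply: le_trans (q_ge _ _); apply: log_cost_lower => //.
  exact: observed_qminus_gt0.
apply: le_trans (doeblin_distance f_lipschitz fs_lipschitz h_surj hs_surj h_inv hs_inv
  f_fs h_hs a_ge0 as_ge0 (ltW b_gt0) (Xs_rec w (ltn0Sn k)) (Ys_def k w) (Ys_def k.+1 w) xC uC) _.
by rewrite -/kap -/(offset r) -/(level r _ _ _); apply: le_level; exact/ltW/lt_radius.
Qed.

(** One null set for all radii: the Doeblin sets grow with r, so integer radii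
    suffice. *)
Lemma observed_doeblin_lower : {ae P, forall w, forall r, 0 < r -> exists W c n0,
  [/\ forall i, 0 <= W i,
      forall k x u, doeblin_set h (Ys k w) r x -> doeblin_set h (Ys k.+1 w) r u ->
        expR (- W k.+1) <= q x (u - f x) &
      forall n, (n0 <= n)%N -> \sum_(i < n) W i.+1 <= c * n%:R]}.
Proof.
have /ae_foralln : forall m : nat, {ae P, forall x, exists C n0, forall n, (n0 <= n)%N ->
    \sum_(k < n) step_cost m.+1%:R (e k x) (e k.+1 x) (z k.+1 x) <= C * n%:R}.
  by move=> m; exact: step_cost_average.
apply: filterS => w Hw r r0; have [C [n0 HC]] := Hw (Num.truncn r).
pose rr : R := (Num.truncn r).+1%:R.
have rrr : r <= rr by have /andP[_ /ltW] := truncn_itv (ltW r0).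
exists (fun i => if i is k.+1 then step_cost rr (e k w) (e k.+1 w) (z k.+1 w) else 0), C, n0.
split.
- by case=> // k; exact: log_cost_ge0.
- move=> k x u xC uC; apply: step_density_lower => //.
    exact: le_trans xC rrr.
  exact: le_trans uC rrr.
- exact: HC.
Qed.

End observed_costs.

Theorem mainTheorem5 (R : realType) (N p : nat)
  (p_gt0 : (0 < p)%N) (p_leN : (p <= N)%N)
  (* filtering model *)
  (f : 'rV[R]_N -> 'rV[R]_N) (h : 'rV[R]_N -> 'rV[R]_p)
  (mf : measurable_fun setT f) (mh : measurable_fun setT h)
  (upsilon : 'rV[R]_p -> R)
  (upsilon_density : is_density upsilon)
  (upsilon_gt0 : forall u, 0 < upsilon u)
  (q : 'rV[R]_N -> 'rV[R]_N -> R) (q_kernel : is_density_kernel q)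
  (* (E1) *)
  (a b0 b : R) (f_lipschitz : elipschitz a f)
  (h_ucont : unif_continuous h) (h_surj : range h = setT)
  (h_inv : forall y1 y2 x1 x2, h x1 = y1 -> h x2 = y2 ->
    enorm (x1 - x2) <= b0 + b * enorm (y1 - y2))
  (* (E2) *)
  (upsilon_bounded : exists M, forall u, upsilon u <= M)
  (upsilon_vanish : forall e : R, 0 < e ->
    exists M, forall u, M <= enorm u -> upsilon u <= e)
  (upsilon_compact : forall K : set 'rV[R]_p, compact K ->
    (0 < ereal_inf [set (upsilon y)%:E | y in K])%E)
  (* (G) *)
  (psi : 'rV[R]_N -> R) (mum mup : R)
  (psi_density : is_density psi) (psi_gt0 : forall u, 0 < psi u)
  (mum_gt0 : 0 < mum) (mup_gt0 : 0 < mup)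
  (q_psi : forall x u, mum * psi u <= q x u <= mup * psi u)
  (* observation process *)
  (d : measure_display) (Omega : measurableType d) (P : probability Omega R)
  (fs : 'rV[R]_N -> 'rV[R]_N) (hs : 'rV[R]_N -> 'rV[R]_p)
  (mhs : measurable_fun setT hs)
  (as_ b0s bs : R) (fs_lipschitz : elipschitz as_ fs)
  (hs_surj : range hs = setT) (b0s_gt0 : 0 < b0s) (bs_gt0 : 0 < bs)
  (hs_inv : forall x1 x2 : 'rV[R]_N,
    enorm (x1 - x2) <= b0s + bs * enorm (hs x1 - hs x2))
  (qs : 'rV[R]_N -> 'rV[R]_N -> R) (qs_kernel : is_density_kernel qs)
  (psis : 'rV[R]_N -> R) (mums mups : R)
  (psis_density : is_density psis) (mums_gt0 : 0 < mums) (mups_gt0 : 0 < mups)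
  (qs_psis : forall x u, mums * psis u <= qs x u <= mups * psis u)
  (Xs zetas : nat -> {RV P >-> 'rV[R]_N}) (epss : nat -> {RV P >-> 'rV[R]_p})
  (epss_iid : iid epss)
  (zetas_epss : forall k, (1 <= k)%N -> indep_rv (zetas k) (epss k))
  (zetas_cond : forall k, (1 <= k)%N ->
    cond_density (past Xs epss k) (zetas k) (fun w => qs (Xs k.-1 w)))
  (Xs_rec : forall k w, (1 <= k)%N -> Xs k w = fs (Xs k.-1 w) + zetas k w)
  (Ys : nat -> Omega -> 'rV[R]_p)
  (Ys_def : forall k w, Ys k w = hs (Xs k w) + epss k w)
  (* discrepancy and moment conditions *)
  (f_fs : (sup_norm (fun x => f x - fs x)%R < +oo)%E)
  (h_hs : (sup_norm (fun x => h x - hs x)%R < +oo)%E)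
  (zetap : {RV P >-> 'rV[R]_N}) (zetap_indep : indep_rv_seq zetap epss)
  (zetap_density : has_density zetap psis)
  (V : R -> Omega -> \bar R)
  (V_def : forall Delta w, V Delta w = lne (qminus mum psi
    ((a + 1) * b0 + (a + 1) * b * Delta + kappa b0 b as_ f fs h hs +
     2 * as_ * bs + as_ * bs * enorm (epss 0%N w) + bs * enorm (epss 1%N w) +
     enorm (zetap w))))
  (V_LlogL : forall Delta : R, 0 < Delta ->
    (\int[P]_w (`|V Delta w| * logp `|V Delta w|) < +oo)%E) :
  let Q := transition f q in
  let g := likelihood h upsilon in
  let C := doeblin_set h in
  forall (nu nu' : probability 'rV[R]_N R) (Delta : R), 0 < Delta ->
  {ae P, forall w, (0 < \int[nu]_x Q x (C (Ys 1%N w) Delta))%E} ->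
  {ae P, forall w, (0 < \int[nu']_x Q x (C (Ys 1%N w) Delta))%E} ->
  {ae P, forall w,
    (limn_esup (fun n => n%:R^-1%:E *
       lne (tv_norm (fun A => filter_dist Q g nu n (Ys ^~ w) A -
                              filter_dist Q g nu' n (Ys ^~ w) A))) < 0)%E}.

Proof.
move=> Q g C nu nu' Delta Delta0 nuC nuC'.
have a0 := elipschitz_ge0 p_gt0 p_leN f_lipschitz.
have as0 := elipschitz_ge0 p_gt0 p_leN fs_lipschitz.
have b00 := inverse_offset_ge0 h_inv.
have b_gt0 := inverse_slope_gt0 p_gt0 p_leN h_inv.
have [mupsilon _ _] := upsilon_density.
have [mpsi psi0 psi1] := psi_density.
have [M upsilon_le] := upsilon_bounded.
have q_ge x u : mum * psi u <= q x u by have /andP[] := q_psi x u.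
have q_le x u : q x u <= mup * psi u by have /andP[] := q_psi x u.
have qs_le x u : qs x u <= mups * psis u by have /andP[] := qs_psis x u.
have mfs : measurable_fun setT fs.
  by apply: continuous_measurable_rV; exact: (elipschitz_continuous as0).
have V_arg (r : R) : 0 < r -> (\int[P]_w (`|lne (qminus mum psi
    ((a + 1) * b0 + (a + 1) * b * r + kappa b0 b as_ f fs h hs +
     2 * as_ * bs + as_ * bs * enorm (epss 0%N w) + bs * enorm (epss 1%N w) +
     enorm (zetap w)))| * logp `|lne (qminus mum psi
    ((a + 1) * b0 + (a + 1) * b * r + kappa b0 b as_ f fs h hs +
     2 * as_ * bs + as_ * bs * enorm (epss 0%N w) + bs * enorm (epss 1%N w) +
     enorm (zetap w)))|) < +oo)%E.
  by move=> /V_LlogL; under eq_integral do rewrite V_def.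
have lower := observed_doeblin_lower a0 b00 b_gt0 as0 b0s_gt0 bs_gt0 psi_gt0 mum_gt0 q_ge
  f_lipschitz fs_lipschitz h_surj hs_surj h_inv hs_inv mfs f_fs h_hs (proj2 qs_kernel)
  psis_density mups_gt0 qs_le epss_iid zetas_cond Xs_rec Ys_def zetap_indep zetap_density V_arg.
have iF : (lebesgue_rV R N).-integrable setT (EFin \o (fun v => mup * psi v)).
  rewrite (_ : _ \o _ = fun v => (mup%:E * (psi v)%:E)%E)//; apply: integrableZl => //.
  apply/integrableP; split; first exact/measurable_EFinP.
  by under eq_integral do rewrite /= ger0_norm//; rewrite psi1 ltry.
apply: filterS3 nuC nuC' lower => w nuCw nuCw' loww.
exact: (filter_forgetting mf q_kernel mh h_ucont h_surj mupsilon upsilon_gt0 upsilon_le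
  upsilon_vanish upsilon_compact iF (fun v => mulr_ge0 (ltW mup_gt0) (psi0 v)) q_le loww
  Delta0 nuCw nuCw').
Qed.
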